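(* Let $\mathcal T$ be a triangulation of a surface $S$ of topological type $(g,n)$ and let $\Theta:E\to[0,\pi)$ satisfy $\mathbf{(C1)}$. In Euclidean background geometry, for any initial $r(0)\in\mathbb R_+^{|V|}$ the solution $r(t)$ of $$\frac{dr_i}{dt}=(K_{av}-K_i)r_i,\qquad i=1,\dots,|V|,\qquad K_{av}=2\pi\chi(S)/|V|,$$ exists for all $t\ge0$, and the following are equivalent: $(E_1)$ $r(t)$ converges as $t\to+\infty$; $(E_2)$ $(K_{av},\dots,K_{av})$ belongs to the image of the curvature map; $(E_3)$ for every proper non-empty subset $A\subsetneq V$, $2\pi\chi(S)|A|/|V|>-\sum_{(e,v)\in Lk(A)}(\pi-\Theta(e))+2\pi\chi(G(A)\setminus\partial S)+\pi\chi(G(A)\cap\partial S)$. Moreover, if one of these holds, then $r(t)$ converges exponentially fast to a radius vector producing a Euclidean cone metric $\mu$ on $S$ all of whose vertex curvatures equal $K_{av}$, such that $(S,\mu)$ supports a circle pattern $\mathcal P$ realizing $(\mathcal T,\Theta)$.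
   Context: $S$: compact oriented surface of genus $g$ with $n\ge0$ boundary circles, $\chi(S)=2-2g-n$. $\mathcal T$: vertices $V=\{v_1,\dots,v_{|V|}\}$, edges $E$, triangles $F$, boundary vertices $V_\partial$. $\mathbf{(C1)}$: whenever $e_1,e_2,e_3$ bound a triangle, $I(e_1)+I(e_2)I(e_3)\ge0$ and cyclic analogues, $I=\cos\Theta$. Euclidean curvature: for $r\in\mathbb R_+^{|V|}$ each triangle $v_iv_jv_k$ is the Euclidean triangle with side lengths $l_{ij}=\sqrt{r_i^2+r_j^2+2r_ir_j\cos\Theta([v_i,v_j])}$ etc.; glued they give a Euclidean cone metric; $\sigma(v_i)$ is the total angle at $v_i$; $K_i=2\pi-\sigma(v_i)$ for interior, $\pi-\sigma(v_i)$ for boundary vertices; the curvature map is $r\mapsto(K_1,\dots,K_{|V|})$. A circle pattern realizing $(\mathcal T,\Theta)$: circles centered at the vertices with the given radii, intersecting along each edge $e$ at exterior angle $\Theta(e)$. $G(A)$: union of open cells of $\mathcal T$ having a vertex in $A$; $\chi$ of a union of open cells is #0-cells − #1-cells + #2-cells. $Lk(A)$: pairs $(e,v)$, $v\in A$, $e\in E$ with no endpoint in $A$, forming a triangle with $v$. *)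

(* Defs.v *)
From HB Require Import structures.
From mathcomp Require Import all_boot all_order all_algebra.
From mathcomp Require Import all_classical all_reals all_analysis.
Set Implicit Arguments. Unset Strict Implicit. Unset Printing Implicit Defensive.
Import Order.TTheory GRing.Theory Num.Theory.
Import numFieldNormedType.Exports.
Local Open Scope ring_scope.


(* Combinatorics of a triangulation.  The vertex set is the finite type V;
   the triangles are a set F of 3-element vertex sets; edges are the
   2-element vertex sets contained in some triangle.                   *)

Definition tri_edges (V : finType) (F : {set {set V}}) : {set {set V}} :=
  [set e : {set V} | (#|e| == 2)%N && [exists t in F, e \subset t]].

Definition faces_at (V : finType) (F : {set {set V}}) (e : {set V}) :=
  [set t in F | e \subset t].

Definition bd_edge (V : finType) (F : {set {set V}}) (e : {set V}) : bool :=
  (e \in tri_edges F) && (#|faces_at F e| == 1)%N.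

Definition bd_vertex (V : finType) (F : {set {set V}}) (v : V) : bool :=
  [exists e in tri_edges F, bd_edge F e && (v \in e)].

Definition link_verts (V : finType) (F : {set {set V}}) (v : V) : {set V} :=
  [set a | (a != v) && [exists t in F, (v \in t) && (a \in t)]].

Definition link_rel (V : finType) (F : {set {set V}}) (v : V) : rel V :=
  fun a b => [&& a \in link_verts F v, b \in link_verts F v & [set v; a; b] \in F].

Definition skel_rel (V : finType) (F : {set {set V}}) : rel V :=
  fun a b => [exists t in F, (a \in t) && (b \in t)].

(* coherent orientation: nx t is the cyclic successor map on triangle t *)
Definition coherent_orientation (V : finType) (F : {set {set V}})
    (nx : {set V} -> V -> V) : Prop :=
  (forall t v, t \in F -> v \in t ->
     [/\ nx t v \in t, nx t v != v & nx t (nx t (nx t v)) = v]) /\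
  (forall t1 t2 a b, t1 \in F -> t2 \in F -> t1 != t2 ->
     a \in t1 -> b \in t1 -> a \in t2 -> b \in t2 -> a != b ->
     nx t1 a = b -> nx t2 b = a).

(* F is a (simplicial) triangulation of a compact connected oriented
   surface, possibly with boundary, with vertex set V. *)
Definition surface_triangulation (V : finType) (F : {set {set V}}) : Prop :=
  (forall t, t \in F -> #|t| = 3%N) /\
  (forall v : V, exists2 t, t \in F & v \in t) /\
  (forall e, e \in tri_edges F -> (#|faces_at F e| == 1)%N || (#|faces_at F e| == 2)%N) /\
  (forall v a b, a \in link_verts F v -> b \in link_verts F v ->
     connect (link_rel F v) a b) /\
  (forall a b : V, connect (skel_rel F) a b) /\
  (exists nx, coherent_orientation F nx).

Definition euler_char (R : realType) (V : finType) (F : {set {set V}}) : R :=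
  #|V|%:R - #|tri_edges F|%:R + #|F|%:R.

Definition cond_C1 (R : realType) (V : finType) (F : {set {set V}})
    (Theta : {set V} -> R) : Prop :=
  forall a b c : V, [set a; b; c] \in F ->
    0 <= cos (Theta [set a; b]) + cos (Theta [set b; c]) * cos (Theta [set a; c]).

Definition edge_len (R : realType) (V : finType) (Theta : {set V} -> R)
    (r : V -> R) (a b : V) : R :=
  Num.sqrt (r a ^+ 2 + r b ^+ 2 + 2 * r a * r b * cos (Theta [set a; b])).

Definition tri_angle (R : realType) (V : finType) (Theta : {set V} -> R)
    (r : V -> R) (v a b : V) : R :=
  let l := edge_len Theta r in
  acos ((l v a ^+ 2 + l v b ^+ 2 - l a b ^+ 2) / (2 * l v a * l v b)).

(* total cone angle at v: each triangle {v,a,b} is counted through the two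
   ordered pairs (a,b), (b,a), whence the factor 1/2 *)
Definition cone_angle (R : realType) (V : finType) (F : {set {set V}})
    (Theta : {set V} -> R) (r : V -> R) (v : V) : R :=
  2^-1 * \sum_(a : V) \sum_(b : V | [set v; a; b] \in F) tri_angle Theta r v a b.

Definition curvature (R : realType) (V : finType) (F : {set {set V}})
    (Theta : {set V} -> R) (r : V -> R) (v : V) : R :=
  (if bd_vertex F v then pi else 2 * pi) - cone_angle F Theta r v.

Definition K_av (R : realType) (V : finType) (F : {set {set V}}) : R :=
  2 * pi * euler_char R F / #|V|%:R.

Definition flow_solution (R : realType) (V : finType) (F : {set {set V}})
    (Theta : {set V} -> R) (r0 : V -> R) (r : R -> V -> R) : Prop :=
  [/\ r 0 = r0,
      (forall t : R, 0 <= t -> forall i, 0 < r t i),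
      (forall i, ((fun s => r s i) @ at_right (0 : R) --> r0 i)%classic) &
      (forall t : R, 0 < t -> forall i : V,
         is_derive t (1 : R) (fun s : R => r s i)
           ((K_av R F - curvature F Theta (r t) i) * r t i))].

Definition Lk_sum (R : realType) (V : finType) (F : {set {set V}})
    (Theta : {set V} -> R) (A : {set V}) : R :=
  \sum_(e in tri_edges F | [disjoint e & A])
     \sum_(v in A | v |: e \in F) (pi - Theta e).

(* chi(G(A) \ dS): interior vertices in A, interior edges meeting A,
   triangles meeting A (open triangles are never in dS) *)
Definition chi_GA_int (R : realType) (V : finType) (F : {set {set V}})
    (A : {set V}) : R :=
  #|[set v in A | ~~ bd_vertex F v]|%:R
  - #|[set e in tri_edges F | ~~ bd_edge F e & ~~ [disjoint e & A]]|%:R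
  + #|[set t in F | ~~ [disjoint t & A]]|%:R.

Definition chi_GA_bd (R : realType) (V : finType) (F : {set {set V}})
    (A : {set V}) : R :=
  #|[set v in A | bd_vertex F v]|%:R
  - #|[set e in tri_edges F | bd_edge F e & ~~ [disjoint e & A]]|%:R.

(* the edge lengths of r define non-degenerate Euclidean triangles, hence
   a Euclidean cone metric on S *)
Definition euclidean_cone_metric (R : realType) (V : finType)
    (F : {set {set V}}) (Theta : {set V} -> R) (r : V -> R) : Prop :=
  forall a b c : V, [set a; b; c] \in F ->
    edge_len Theta r a b < edge_len Theta r a c + edge_len Theta r b c.

(* the metric with edge lengths l supports a circle pattern realizing
   (T,Theta): circles of radii rho centred at the vertices such that, for
   every edge [a,b], the circles at a and b (centres at distance l a b)
   intersect at exterior angle Theta [a,b] *)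
Definition supports_circle_pattern (R : realType) (V : finType)
    (F : {set {set V}}) (Theta : {set V} -> R) (l : V -> V -> R) : Prop :=
  exists rho : V -> R, (forall i, 0 < rho i) /\
    forall a b : V, a != b -> [set a; b] \in tri_edges F ->
      [/\ `|rho a - rho b| <= l a b, l a b <= rho a + rho b &
          acos ((l a b ^+ 2 - rho a ^+ 2 - rho b ^+ 2) / (2 * rho a * rho b))
            = Theta [set a; b]].

(* Main.v *)
Require Import Defs.
From HB Require Import structures.
From mathcomp Require Import all_boot all_order all_algebra.
From mathcomp Require Import all_classical all_reals all_analysis.
From mathcomp Require Import ring lra.
Import Order.TTheory GRing.Theory Num.Theory.
Import numFieldNormedType.Exports.
Local Open Scope ring_scope.

(** In the coordinates u = ln r the flow is u' = G(u) with G = K_av - K.  In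
    each triangle the derivative of the angle at x is A_xp (u_p' - u_x') +
    A_xq (u_q' - u_x') with a nonnegative coefficient symmetric in its two
    vertices, at most one of the three coefficients vanishing; so G is strongly
    monotone on bounded sets modulo constants, two bounded solutions with the
    same sum approach each other exponentially, and a bounded solution
    converges to an equilibrium.  No potential is needed.

    Summing angles over the triangles meeting A shows that K(A) minus the lower
    bound of (E3) is a sum of positive triangle defects, which tend to 0 when
    the radii of A are much smaller than the others.  Hence an equilibrium
    forces (E3), and (E3) makes G coercive by Abel summation along the sorted
    values of u, so that the solution is bounded.  Global existence is
    Peano's theorem for the bounded continuous field G. *)

Set Implicit Arguments.
Unset Strict Implicit.
Unset Printing Implicit Defensive.

(** * Triangles with prescribed intersection angles *)

(** (C1) enters through the shape of two polynomials: in the expansion [gramE] of the squared area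
    and in the numerator of [edge_weight], its left-hand sides are exactly the coefficients of the
    mixed monomials, so signs of geometric quantities are signs of coefficients. Tangent circles
    (Theta = 0) can make coefficients vanish. Two positive weights per triangle still suffice for
    monotonicity, because the difference along the third side is determined by the other two. The
    monotonicity constant depends on a bound for u, so boundedness must be obtained first: from an
    equilibrium, since the distance to it does not increase; from convergence of r; or from (E3).
    Boundedness of ln r is the hub through which the equivalences pass. The components of G add up
    to 0 by Gauss-Bonnet, which fixes the sum of u along a solution. With boundary this requires as
    many boundary edges as boundary vertices, and it is here that the orientation and the connected
    links are used. *)

Definition sqlen (R : realType) (x p a : R) : R := x ^+ 2 + p ^+ 2 + 2 * x * p * a.

(** Half of l_xp^2 + l_xq^2 - l_pq^2, that is l_xp l_xq times the cosine of the angle at x.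
    Throughout, a, b, c are the cosines for the edges xp, xq, pq. *)
Definition cosnum (R : realType) (x p q a b c : R) : R :=
  x ^+ 2 + x * p * a + x * q * b - p * q * c.

(* Four times the squared area of the triangle. *)
Definition gram (R : realType) (x p q a b c : R) : R :=
  sqlen x p a * sqlen x q b - cosnum x p q a b c ^+ 2.

Definition admissible (R : realType) (a b c : R) : Prop :=
  [/\ -1 < a <= 1, -1 < b <= 1 & -1 < c <= 1] /\
  [/\ 0 <= a + b * c, 0 <= b + a * c & 0 <= c + a * b].

(** The angle at x written as an arc cotangent: it lies in (0, pi) for all arguments, and it is
    differentiated without approaching the endpoints of acos. [ang_acos] identifies it with the law
    of cosines. *)
Definition ang (R : realType) (x p q a b c : R) : R :=
  pi / 2 - atan (cosnum x p q a b c / Num.sqrt (gram x p q a b c)).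

Lemma gramE (R : realType) (x p q a b c : R) :
  gram x p q a b c = x ^+ 2 * p ^+ 2 * (1 - a ^+ 2) + x ^+ 2 * q ^+ 2 * (1 - b ^+ 2)
   + p ^+ 2 * q ^+ 2 * (1 - c ^+ 2) + 2 * x ^+ 2 * p * q * (c + a * b)
   + 2 * x * p ^+ 2 * q * (b + a * c) + 2 * x * p * q ^+ 2 * (a + b * c).
Proof. rewrite /gram /sqlen /cosnum; ring. Qed.

Lemma gram_rot (R : realType) (x p q a b c : R) :
  gram p q x c a b = gram x p q a b c.
Proof. rewrite /gram /sqlen /cosnum; ring. Qed.

Lemma gram_swap (R : realType) (x p q a b c : R) :
  gram x q p b a c = gram x p q a b c.
Proof. rewrite /gram /sqlen /cosnum; ring. Qed.

Lemma admissible_rot (R : realType) (a b c : R) : admissible a b c -> admissible c a b.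
Proof.
move=> [[ha hb hc] [h1 h2 h3]]; split; split => //.
  by rewrite mulrC.
by rewrite mulrC.
Qed.

Lemma admissible_swap (R : realType) (a b c : R) : admissible a b c -> admissible b a c.
Proof. by move=> [[ha hb hc] [h1 h2 h3]]; split; split => //; rewrite (mulrC b). Qed.

Lemma sqr_le1 (R : realType) (a : R) : -1 < a <= 1 -> 0 <= 1 - a ^+ 2.
Proof. by move=> /andP[h1 h2]; nra. Qed.

Lemma sqlen_gt0 (R : realType) (x p a : R) :
  0 < x -> 0 < p -> -1 < a <= 1 -> 0 < sqlen x p a.
Proof.
move=> x0 p0 /andP[a1 a2].
have -> : sqlen x p a = (x - p) ^+ 2 + 2 * (x * p) * (1 + a) by rewrite /sqlen; ring.
apply: ltr_wpDl; first exact: sqr_ge0.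
by rewrite !mulr_gt0 // -ltrBlDl sub0r.
Qed.

(** All terms of [gramE] are nonnegative. If a < 1 or b < 1 a squared term is positive; if a = b = 1
    the coefficient c + a b = c + 1 is, because c > -1. *)
Lemma gram_gt0 (R : realType) (x p q a b c : R) :
  0 < x -> 0 < p -> 0 < q -> admissible a b c -> 0 < gram x p q a b c.
Proof.
move=> x0 p0 q0 [[ha hb hc] [h1 h2 h3]]; rewrite gramE.
have xp : 0 < x ^+ 2 * p ^+ 2 by rewrite mulr_gt0 ?exprn_gt0.
have xq : 0 < x ^+ 2 * q ^+ 2 by rewrite mulr_gt0 ?exprn_gt0.
have pq : 0 < p ^+ 2 * q ^+ 2 by rewrite mulr_gt0 ?exprn_gt0.
have xxpq : 0 < 2 * x ^+ 2 * p * q by rewrite !mulr_gt0 ?exprn_gt0.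
have xppq : 0 < 2 * x * p ^+ 2 * q by rewrite !mulr_gt0 ?exprn_gt0.
have xpqq : 0 < 2 * x * p * q ^+ 2 by rewrite !mulr_gt0 ?exprn_gt0.
have t1 := mulr_ge0 (ltW xp) (sqr_le1 ha).
have t2 := mulr_ge0 (ltW xq) (sqr_le1 hb).
have t3 := mulr_ge0 (ltW pq) (sqr_le1 hc).
have t4 := mulr_ge0 (ltW xxpq) h3.
have t5 := mulr_ge0 (ltW xppq) h2.
have t6 := mulr_ge0 (ltW xpqq) h1.
have [[/andP[a1 a2] /andP[b1 b2]] /andP[c1 c2]] := (ha, hb, hc).
have [aa|na] := eqVneq a 1; last first.
  have alt : a < 1 by rewrite lt_neqAle na.
  have : 0 < 1 - a ^+ 2 by nra.
  by move/(mulr_gt0 xp); lra.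
have [bb|nb] := eqVneq b 1; last first.
  have blt : b < 1 by rewrite lt_neqAle nb.
  have : 0 < 1 - b ^+ 2 by nra.
  by move/(mulr_gt0 xq); lra.
have : 0 < c + a * b by rewrite aa bb mulr1; lra.
by move/(mulr_gt0 xxpq); lra.
Qed.

Lemma sin_ang (R : realType) (x p q a b c : R) :
  0 < x -> 0 < p -> 0 < q -> admissible a b c ->
  sin (ang x p q a b c) = Num.sqrt (gram x p q a b c) /
    (Num.sqrt (sqlen x p a) * Num.sqrt (sqlen x q b)).
Proof.
move=> x0 p0 q0 adm; have S0 := gram_gt0 x0 p0 q0 adm.
have [[ha hb hc] _] := adm.
have L1 := sqlen_gt0 x0 p0 ha; have L2 := sqlen_gt0 x0 q0 hb.
rewrite /ang sinB sin_pihalf cos_pihalf mul1r mul0r subr0 cos_atan expr_div_n.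
rewrite sqr_sqrtr ?(ltW S0)//.
have -> : 1 + cosnum x p q a b c ^+ 2 / gram x p q a b c =
   (sqlen x p a * sqlen x q b) / gram x p q a b c.
  by rewrite -[X in X + _](divff (lt0r_neq0 S0)) -mulrDl /gram subrK.
by rewrite sqrtrM ?mulr_ge0 ?(ltW L1) ?(ltW L2)// sqrtrM ?(ltW L1)// invfM sqrtrV ?(ltW S0)// invrK mulrC.
Qed.

Lemma cos_ang (R : realType) (x p q a b c : R) :
  0 < x -> 0 < p -> 0 < q -> admissible a b c ->
  cos (ang x p q a b c) = cosnum x p q a b c /
    (Num.sqrt (sqlen x p a) * Num.sqrt (sqlen x q b)).
Proof.
move=> x0 p0 q0 adm; have := sin_ang x0 p0 q0 adm.
have S0 := gram_gt0 x0 p0 q0 adm.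
rewrite /ang sinB cosB sin_pihalf cos_pihalf !mul0r !mul1r subr0 add0r => Ec.
have c0 : 0 < cos (atan (cosnum x p q a b c / Num.sqrt (gram x p q a b c))).
  by apply: cos_gt0_pihalf; rewrite atan_gtNpi2 atan_ltpi2.
have := atanK (cosnum x p q a b c / Num.sqrt (gram x p q a b c)).
rewrite {1}/tan => /(canRL (divfK (lt0r_neq0 c0))) ->; rewrite Ec.
by rewrite mulrA divfK ?gt_eqF ?sqrtr_gt0.
Qed.

Lemma ang_itv (R : realType) (x p q a b c : R) : 0 < ang x p q a b c < pi.
Proof.
rewrite /ang; set t := _ / Num.sqrt _.
have := atan_gtNpi2 t; have := atan_ltpi2 t.
by move=> h1 h2; apply/andP; split; lra.
Qed.

Lemma ang_acos (R : realType) (x p q a b c : R) :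
  0 < x -> 0 < p -> 0 < q -> admissible a b c ->
  acos (cosnum x p q a b c / (Num.sqrt (sqlen x p a) * Num.sqrt (sqlen x q b)))
  = ang x p q a b c.
Proof.
move=> x0 p0 q0 adm; rewrite -cos_ang// cosK//.
by have /andP[h1 h2] := ang_itv x p q a b c; rewrite in_itv/= !ltW.
Qed.

Lemma sqlenC (R : realType) (x p a : R) : sqlen p x a = sqlen x p a.
Proof. rewrite /sqlen; ring. Qed.

(** The addition formulas give cos (A + B) = - cos C and sin (A + B) > 0. The second keeps A + B
    below pi, where cos is injective. *)
Lemma ang_sum (R : realType) (x p q a b c : R) :
  0 < x -> 0 < p -> 0 < q -> admissible a b c ->
  ang x p q a b c + ang p q x c a b + ang q x p b c a = pi.
Proof.
move=> x0 p0 q0 adm.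
have adm2 := admissible_rot adm; have adm3 := admissible_rot adm2.
have [[ha hb hc] _] := adm.
have S0 := gram_gt0 x0 p0 q0 adm.
have L1 := sqlen_gt0 x0 p0 ha; have L2 := sqlen_gt0 x0 q0 hb.
have L3 := sqlen_gt0 p0 q0 hc.
have [/andP[A0 A1] /andP[B0 B1] /andP[C0 C1]] :=
  And3 (ang_itv x p q a b c) (ang_itv p q x c a b) (ang_itv q x p b c a).
set A := ang x p q a b c in A0 A1 *; set B := ang p q x c a b in B0 B1 *.
set C := ang q x p b c a in C0 C1 *.
have EcA := cos_ang x0 p0 q0 adm; have EsA := sin_ang x0 p0 q0 adm.
have EcB := cos_ang p0 q0 x0 adm2; have EsB := sin_ang p0 q0 x0 adm2.
have EcC := cos_ang q0 x0 p0 adm3.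
rewrite -/A in EcA EsA; rewrite -/B (sqlenC x p) in EcB; rewrite -/B gram_rot (sqlenC x p) in EsB.
rewrite -/C (sqlenC x q) (sqlenC p q) in EcC.
set l1 := Num.sqrt (sqlen x p a) in EcA EsA EcB EsB.
set l2 := Num.sqrt (sqlen x q b) in EcA EsA EcC.
set l3 := Num.sqrt (sqlen p q c) in EcC EcB EsB.
have l10 : 0 < l1 by rewrite sqrtr_gt0.
have l20 : 0 < l2 by rewrite sqrtr_gt0.
have l30 : 0 < l3 by rewrite sqrtr_gt0.
have El1 : l1 ^+ 2 = sqlen x p a by rewrite sqr_sqrtr ?ltW.
set s := Num.sqrt _ in EsA EsB.
have s0 : 0 < s by rewrite sqrtr_gt0.
have Es : s ^+ 2 = gram x p q a b c by rewrite sqr_sqrtr ?ltW.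
have E1 : cos (A + B) = - cos C.
  rewrite cosD EcA EcB EsA EsB EcC.
  have -> : - (cosnum q x p b c a / (l2 * l3)) =
     (- (l1 ^+ 2) * cosnum q x p b c a) / (l1 ^+ 2 * l2 * l3).
    by field; rewrite !gt_eqF.
  have -> : cosnum x p q a b c / (l1 * l2) * (cosnum p q x c a b / (l3 * l1)) -
     s / (l1 * l2) * (s / (l3 * l1)) =
     (cosnum x p q a b c * cosnum p q x c a b - s ^+ 2) / (l1 ^+ 2 * l2 * l3).
    by field; rewrite !gt_eqF.
  congr (_ / _); rewrite Es El1 /gram /sqlen /cosnum; ring.
have E2 : 0 < sin (A + B).
  rewrite sinD EcA EcB EsA EsB.
  have -> : s / (l1 * l2) * (cosnum p q x c a b / (l3 * l1)) +
     cosnum x p q a b c / (l1 * l2) * (s / (l3 * l1)) =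
     s * (cosnum p q x c a b + cosnum x p q a b c) / (l1 ^+ 2 * l2 * l3).
    by field; rewrite !gt_eqF.
  have -> : cosnum p q x c a b + cosnum x p q a b c = sqlen x p a.
    rewrite /sqlen /cosnum; ring.
  by rewrite divr_gt0 ?mulr_gt0// exprn_gt0.
have AB : A + B < pi.
  rewrite ltNge; apply/negP => h.
  have : sin (A + B - pi) < 0 by rewrite sinB cospi sinpi; lra.
  by apply/negP; rewrite -leNgt sin_ge0_pi//; apply/andP; split; lra.
have : acos (cos (A + B)) = acos (- cos C) by rewrite E1.
rewrite cosK ?in_itv/=; last by apply/andP; split; lra.
rewrite acosN ?cos_geN1 ?cos_le1// cosK ?in_itv/=; last by apply/andP; split; lra.
lra.
Qed.

Lemma tri_angle_ang (R : realType) (V : finType) (Theta : {set V} -> R) (r : V -> R)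
    (v p q : V) :
  (forall i, 0 < r i) ->
  admissible (cos (Theta [set v; p])) (cos (Theta [set v; q])) (cos (Theta [set p; q])) ->
  tri_angle Theta r v p q =
  ang (r v) (r p) (r q) (cos (Theta [set v; p])) (cos (Theta [set v; q]))
      (cos (Theta [set p; q])).
Proof.
move=> r0 adm; have [[ha hb hc] _] := adm.
rewrite -ang_acos// /tri_angle /edge_len -!/(sqlen _ _ _); congr acos.
have l1 := sqlen_gt0 (r0 v) (r0 p) ha; have l2 := sqlen_gt0 (r0 v) (r0 q) hb.
have l3 := sqlen_gt0 (r0 p) (r0 q) hc.
rewrite !sqr_sqrtr ?(ltW l1) ?(ltW l2) ?(ltW l3)//.
rewrite -mulrA invfM mulrA; congr (_ / _).
by rewrite /sqlen /cosnum; field.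
Qed.

(** * Upper bound of an angle, and its limits for disproportionate radii *)

(** This says cos A > - c. For c >= 0, l_xp >= |p + x a| because l_xp^2 - (p + x a)^2 = x^2 (1 -
    a^2), likewise for l_xq, and the resulting product expands into the expressions of (C1). For c =
    - k < 0, (C1) forces a, b > 0, and the squares of both sides are compared monomial by
    monomial. *)
Lemma cosnum_gt_opp (R : realType) (x p q a b c : R) :
  0 < x -> 0 < p -> 0 < q -> admissible a b c ->
  0 < cosnum x p q a b c + c * (Num.sqrt (sqlen x p a) * Num.sqrt (sqlen x q b)).
Proof.
move=> x0 p0 q0 adm; have [[ha hb hc] [h1 h2 h3]] := adm.
have L1 := sqlen_gt0 x0 p0 ha; have L2 := sqlen_gt0 x0 q0 hb.
set l1 := Num.sqrt _; set l2 := Num.sqrt _.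
have l10 : 0 < l1 by rewrite sqrtr_gt0.
have l20 : 0 < l2 by rewrite sqrtr_gt0.
have El1 : l1 ^+ 2 = sqlen x p a by rewrite sqr_sqrtr ?ltW.
have El2 : l2 ^+ 2 = sqlen x q b by rewrite sqr_sqrtr ?ltW.
have [[/andP[a1 a2] /andP[b1 b2]] /andP[c1 c2]] := (ha, hb, hc).
have xp : 0 < x * p by rewrite mulr_gt0.
have xq : 0 < x * q by rewrite mulr_gt0.
have pq : 0 < p * q by rewrite mulr_gt0.
have xx : 0 < x ^+ 2 by rewrite exprn_gt0.
case: (leP 0 c) => c0.
  have le1 : p + x * a <= l1.
    rewrite (le_trans (ler_norm _))// -(ler_pXn2r (n := 2)) ?nnegrE ?(ltW l10)//.
    rewrite real_normK ?num_real// El1 /sqlen.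
    have := mulr_ge0 (ltW xx) (sqr_le1 ha); lra.
  have le2 : q + x * b <= l2.
    rewrite (le_trans (ler_norm _))// -(ler_pXn2r (n := 2)) ?nnegrE ?(ltW l20)//.
    rewrite real_normK ?num_real// El2 /sqlen.
    have := mulr_ge0 (ltW xx) (sqr_le1 hb); lra.
  have key : c * ((p + x * a) * (q + x * b)) <= c * (l1 * l2).
    apply: ler_wpM2l => //.
    have [u0|u0] := leP 0 (p + x * a); have [v0|v0] := leP 0 (q + x * b).
    - exact: ler_pM.
    - by rewrite (le_trans (mulr_ge0_le0 u0 (ltW v0)))// mulr_ge0// ltW.
    - by rewrite (le_trans (mulr_le0_ge0 (ltW u0) v0))// mulr_ge0// ltW.
    (* Both factors negative is impossible: a, b < 0 and c >= 0 contradict 0 <= b + a c. *)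
    - have an : a < 0 by rewrite -(pmulr_rlt0 a x0); lra.
      have bn : b < 0 by rewrite -(pmulr_rlt0 b x0); lra.
      have : a * c <= 0 by rewrite mulr_le0_ge0 // ltW.
      lra.
  rewrite (lt_le_trans _ (lerD (lexx _) key))//.
  have -> : cosnum x p q a b c + c * ((p + x * a) * (q + x * b)) =
    x ^+ 2 * (1 + a * b * c) + x * p * (a + b * c) + x * q * (b + a * c).
    rewrite /cosnum; ring.
  rewrite -addrA ltr_pwDl ?addr_ge0 ?mulr_ge0 ?(ltW x0) ?(ltW p0) ?(ltW q0)//.
  rewrite mulr_gt0//.
  have abl : -1 < a * b by nra.
  have [ab0|ab0] := leP 0 (a * b); first by have := mulr_ge0 ab0 c0; lra.
  have : 0 <= - (a * b) * (1 - c) by rewrite mulr_ge0; lra.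
  lra.
have [k Ec] : exists k, c = - k by exists (- c); rewrite opprK.
subst c; have k0 : 0 < k by rewrite -oppr_lt0.
have kab : k <= a * b by lra.
have a0 : 0 < a by nra.
have b0 : 0 < b by nra.
have k1 : k < 1 by lra.
have N0 : 0 < cosnum x p q a b (- k).
  have := mulr_gt0 xp a0; have := mulr_gt0 xq b0; have := mulr_gt0 pq k0.
  rewrite /cosnum; lra.
rewrite mulNr subr_gt0 -(ltr_pXn2r (n := 2)) ?nnegrE ?mulr_ge0 ?(ltW l10) ?(ltW l20) ?(ltW N0) ?(ltW k0)//.
rewrite !exprMn El1 El2 -subr_gt0.
have -> : cosnum x p q a b (- k) ^+ 2 - k ^+ 2 * (sqlen x p a * sqlen x q b) =
  x ^+ 2 * x ^+ 2 * (1 - k ^+ 2) + (x * p) ^+ 2 * (a ^+ 2 - k ^+ 2)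
  + (x * q) ^+ 2 * (b ^+ 2 - k ^+ 2)
  + 2 * x ^+ 2 * (x * p) * (a * (1 - k ^+ 2)) + 2 * x ^+ 2 * (x * q) * (b * (1 - k ^+ 2))
  + 2 * x ^+ 2 * (p * q) * (k + a * b - 2 * k ^+ 2 * (a * b))
  + 2 * (x * p) * (p * q) * (k * (a - k * b)) + 2 * (x * q) * (p * q) * (k * (b - k * a)).
  rewrite /cosnum /sqlen; ring.
have kk1 : 0 < 1 - k ^+ 2 by nra.
have ka : k <= a by nra.
have kb : k <= b by nra.
have ab1 : a * b <= 1 by nra.
have m : 0 <= k + a * b - 2 * k ^+ 2 * (a * b).
  have -> : k + a * b - 2 * k ^+ 2 * (a * b) =
    k * (1 - k * (a * b)) + (a * b) * (1 - k ^+ 2) by ring.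
  rewrite addr_ge0 ?mulr_ge0 ?(ltW k0) ?(ltW a0) ?(ltW b0) ?(ltW kk1)//.
  nra.
have f1 : 0 <= a ^+ 2 - k ^+ 2 by rewrite subr_ge0 ler_pXn2r ?nnegrE// ltW.
have f2 : 0 <= b ^+ 2 - k ^+ 2 by rewrite subr_ge0 ler_pXn2r ?nnegrE// ltW.
have f3 : 0 <= a - k * b by lra.
have f4 : 0 <= b - k * a by lra.
have ge0 y z w : 0 < y -> 0 < z -> 0 <= w -> 0 <= 2 * y * z * w.
  by move=> y0 z0 w0; rewrite mulr_ge0// ltW// !mulr_gt0.
apply: ltr_pwDl; last by apply: ge0 => //; rewrite mulr_ge0// ltW.
apply: ltr_pwDl; last by apply: ge0 => //; rewrite mulr_ge0// ltW.
apply: ltr_pwDl; last exact: ge0.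
apply: ltr_pwDl; last by apply: ge0 => //; rewrite ltW// mulr_gt0.
apply: ltr_pwDl; last by apply: ge0 => //; rewrite ltW// mulr_gt0.
apply: ltr_pwDl; last exact: mulr_ge0 (sqr_ge0 _) f2.
apply: ltr_pwDl; last exact: mulr_ge0 (sqr_ge0 _) f1.
by rewrite !mulr_gt0.
Qed.

(** The bound is the limit of the angle as x tends to 0 ([ang_near_opp]); its strictness becomes the
    strict inequality of (E3). *)
Lemma ang_lt_opp (R : realType) (x p q a b c : R) :
  0 < x -> 0 < p -> 0 < q -> admissible a b c ->
  ang x p q a b c < pi - acos c.
Proof.
move=> x0 p0 q0 adm; have [[ha hb hc] _] := adm.
have /andP[c1 c2] := hc.
have L1 := sqlen_gt0 x0 p0 ha; have L2 := sqlen_gt0 x0 q0 hb.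
have [/andP[A0 A1]] := ang_itv x p q a b c.
have B0 : 0 <= acos c by rewrite acos_ge0// ltW.
have B1 : acos c < pi by rewrite acos_ltpi// c1.
rewrite -ltr_cos ?in_itv/=; try by apply/andP; split; lra.
have -> : cos (pi - acos c) = - c.
  by rewrite cosB cospi sinpi mul0r addr0 acosK ?in_itv/= ?(ltW c1)// mulN1r.
rewrite cos_ang// ltr_pdivlMr ?mulr_gt0 ?sqrtr_gt0//.
by have := cosnum_gt_opp x0 p0 q0 adm; lra.
Qed.


Lemma sqrt_sqlen_le (R : realType) (x p a : R) :
  0 < x -> 0 < p -> -1 < a <= 1 -> Num.sqrt (sqlen x p a) <= x + p.
Proof.
move=> x0 p0 ha; have L := sqlen_gt0 x0 p0 ha; case/andP: ha => _ a1.
rewrite -(ler_pXn2r (n := 2)) ?nnegrE ?sqrtr_ge0 ?addr_ge0 ?(ltW x0) ?(ltW p0)//.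
rewrite sqr_sqrtr ?(ltW L)// /sqlen.
have : 0 <= x * p * (1 - a) by rewrite mulr_ge0 ?subr_ge0// ltW// mulr_gt0.
lra.
Qed.

Lemma sqrt_sqlen_ge (R : realType) (x p a : R) :
  0 < x -> 0 < p -> -1 < a <= 1 -> p - x <= Num.sqrt (sqlen x p a).
Proof.
move=> x0 p0 ha; have L := sqlen_gt0 x0 p0 ha; case/andP: ha => a1 _.
rewrite (le_trans (ler_norm _))// -(ler_pXn2r (n := 2)) ?nnegrE ?sqrtr_ge0//.
rewrite real_normK ?num_real// sqr_sqrtr ?(ltW L)// /sqlen.
have : 0 <= x * p * (1 + a) by rewrite mulr_ge0 ?(ltW (mulr_gt0 x0 p0))//; lra.
lra.
Qed.

(** When x is small against p and q, the sides at x are p and q up to a relative error O(d), and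
    [cosnum] is - p q c + O(d) p q; so the cosine tends to - c. *)
Lemma ang_near_opp (R : realType) (a b c eps : R) : admissible a b c -> 0 < eps ->
  exists2 d : R, 0 < d & forall x p q, 0 < x -> 0 < p -> 0 < q ->
    x <= d * p -> x <= d * q -> pi - acos c - eps <= ang x p q a b c.
Proof.
move=> adm e0; have [[ha hb hc] _] := adm; have /andP[c1 c2] := hc.
have [b0|b0] := leP (pi - acos c - eps) 0.
  exists 1 => // x p q *; apply: le_trans b0 _.
  by have /andP[/ltW] := ang_itv x p q a b c.
have B0 : 0 <= acos c by rewrite acos_ge0// ltW.
have B1 : acos c < pi by rewrite acos_ltpi// c1.
have cosopp : cos (pi - acos c) = - c.
  by rewrite cosB cospi sinpi mul0r addr0 acosK ?in_itv/= ?(ltW c1)// mulN1r.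
set k := cos (pi - acos c - eps).
have kc : - c < k.
  rewrite -cosopp ltr_cos ?in_itv/=; try by apply/andP; split; lra.
  by lra.
have k1 : k <= 1 by exact: cos_le1.
have k2 : -1 <= k by exact: cos_geN1.
have [eta Eeta] : exists eta, eta = k + c by exists (k + c).
(* The lengths cost at most 3 d and the three small terms of [cosnum] at most d each, so the
   available gap eta must exceed 6 d. Since eta <= 2, also d <= 1/4. *)
have [d Ed] : exists d, d = eta / 8 by exists (eta / 8).
exists d; first by lra.
move=> x p q x0 p0 q0 xp xq.
have d0 : 0 < d by lra.
have d4 : d <= 1/4 by lra.
have /andP[A0 A1] := ang_itv x p q a b c.
apply: ltW; rewrite -ltr_cos ?in_itv/=; try by apply/andP; split; lra.
rewrite -/k cos_ang//.
have l1u := sqrt_sqlen_le x0 p0 ha; have l1l := sqrt_sqlen_ge x0 p0 ha.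
have l2u := sqrt_sqlen_le x0 q0 hb; have l2l := sqrt_sqlen_ge x0 q0 hb.
have l10 : 0 < Num.sqrt (sqlen x p a) by rewrite sqrtr_gt0 sqlen_gt0.
have l20 : 0 < Num.sqrt (sqlen x q b) by rewrite sqrtr_gt0 sqlen_gt0.
move: (Num.sqrt (sqlen x p a)) (Num.sqrt (sqlen x q b)) l1u l1l l2u l2l l10 l20 => l1 l2 l1u l1l l2u l2l l10 l20.
rewrite ltr_pdivrMr ?mulr_gt0//.
clear -x0 p0 q0 xp xq d0 d4 ha hb hc c1 c2 k1 k2 Eeta Ed kc l1u l1l l2u l2l l10 l20.
have pq : 0 < p * q by rewrite mulr_gt0.
have up : l1 * l2 <= (1 + 3 * d) * (p * q).
  apply: (@le_trans _ _ (((1 + d) * p) * ((1 + d) * q))).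
    by apply: ler_pM; rewrite ?(ltW l10) ?(ltW l20)//; lra.
  have -> : (1 + d) * p * ((1 + d) * q) = (1 + d * (2 + d)) * (p * q) by ring.
  by rewrite ler_pM2r// lerD2l mulrC ler_pM2r//; lra.
have lo : (1 - 2 * d) * (p * q) <= l1 * l2.
  apply: (@le_trans _ _ (((1 - d) * p) * ((1 - d) * q))).
    have -> : (1 - d) * p * ((1 - d) * q) = (1 - 2 * d) * (p * q) + d ^+ 2 * (p * q) by ring.
    by rewrite lerDl mulr_ge0 ?sqr_ge0 ?ltW.
  by apply: ler_pM; rewrite ?mulr_ge0 ?(ltW p0) ?(ltW q0)//; lra.
have kl : (k - 3 * d) * (p * q) <= k * (l1 * l2).
  have [k0|k0] := leP 0 k.
    have := ler_wpM2l k0 lo.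
    have : 0 <= (3 - 2 * k) * d * (p * q) by rewrite !mulr_ge0 ?(ltW d0) ?(ltW pq)//; lra.
    lra.
  have := ler_wnM2l (ltW k0) up.
  have : 0 <= (1 + k) * d * (p * q) by rewrite !mulr_ge0 ?(ltW d0) ?(ltW pq)//; lra.
  lra.
apply: lt_le_trans kl.
have h1 : x ^+ 2 <= d * (p * q).
  have -> : x ^+ 2 = x * x by [].
  apply: (@le_trans _ _ ((d * p) * (d * q))).
    by apply: ler_pM; rewrite // ltW.
  have : 0 <= d * (1 - d) * (p * q) by rewrite !mulr_ge0 ?(ltW d0) ?(ltW pq)//; lra.
  lra.
have h2 : x * p * a <= d * (p * q).
  have : 0 <= x * p * (1 - a) by rewrite mulr_ge0 ?(ltW (mulr_gt0 x0 p0))//; case/andP: ha; lra.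
  have : 0 <= (d * q - x) * p by rewrite mulr_ge0 ?(ltW p0)//; lra.
  lra.
have h3 : x * q * b <= d * (p * q).
  have : 0 <= x * q * (1 - b) by rewrite mulr_ge0 ?(ltW (mulr_gt0 x0 q0))//; case/andP: hb; lra.
  have : 0 <= (d * p - x) * q by rewrite mulr_ge0 ?(ltW q0)//; lra.
  lra.
have : 0 < (k + c - 6 * d) * (p * q) by rewrite mulr_gt0//; lra.
rewrite /cosnum; lra.
Qed.

Lemma ang_near0 (R : realType) (a b c eps : R) : admissible a b c -> 0 < eps ->
  exists2 d : R, 0 < d & forall x p q, 0 < x -> 0 < p -> 0 < q ->
    p <= d * x -> q <= d * x -> ang x p q a b c <= eps.
Proof.
move=> adm e0; have [[ha hb hc] _] := adm; have /andP[c1 c2] := hc.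
have [b0|b0] := leP pi eps.
  exists 1 => // x p q *; apply: le_trans b0.
  by have /andP[_ /ltW] := ang_itv x p q a b c.
set k := cos eps.
have k1 : k < 1.
  rewrite -cos0 ltr_cos ?in_itv/= ?lexx ?pi_ge0 ?(ltW e0) ?(ltW b0)//.
have k2 : -1 <= k by exact: cos_geN1.
(* With 1 - k = 6 d, both k l_xp l_xq <= (1 - 3 d) x^2 and [cosnum] >= (1 - 3 d) x^2 hold. *)
have [d Ed] : exists d, d = (1 - k) / 6 by exists ((1 - k) / 6).
exists d; first by lra.
move=> x p q x0 p0 q0 px qx.
have d0 : 0 < d by lra.
have d3 : d <= 1/3 by lra.
have /andP[A0 A1] := ang_itv x p q a b c.
rewrite leNgt -ltr_cos ?in_itv/=; try by apply/andP; split; lra.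
rewrite -leNgt -/k cos_ang//.
have l1u := sqrt_sqlen_le x0 p0 ha.
have l2u := sqrt_sqlen_le x0 q0 hb.
have l10 : 0 < Num.sqrt (sqlen x p a) by rewrite sqrtr_gt0 sqlen_gt0.
have l20 : 0 < Num.sqrt (sqlen x q b) by rewrite sqrtr_gt0 sqlen_gt0.
move: (Num.sqrt (sqlen x p a)) (Num.sqrt (sqlen x q b)) l1u l2u l10 l20 => l1 l2 l1u l2u l10 l20.
rewrite ler_pdivlMr ?mulr_gt0//.
clear -x0 p0 q0 px qx d0 d3 ha hb hc c1 c2 k1 k2 Ed l1u l2u l10 l20.
have xx : 0 < x ^+ 2 by rewrite exprn_gt0.
have up : l1 * l2 <= (1 + 3 * d) * x ^+ 2.
  apply: (@le_trans _ _ (((1 + d) * x) * ((1 + d) * x))).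
    by apply: ler_pM; rewrite ?(ltW l10) ?(ltW l20)//; lra.
  have -> : (1 + d) * x * ((1 + d) * x) = (1 + d * (2 + d)) * x ^+ 2 by ring.
  by rewrite ler_pM2r// lerD2l mulrC ler_pM2r//; lra.
have kl : k * (l1 * l2) <= (1 - 3 * d) * x ^+ 2.
  have [k0|k0] := leP 0 k.
    have := ler_wpM2l k0 up.
    have : 0 <= (1 - k) * d * x ^+ 2 by rewrite !mulr_ge0 ?(ltW d0) ?(ltW xx)//; lra.
    have : (1 - k) * x ^+ 2 = 6 * d * x ^+ 2 by rewrite Ed; field.
    lra.
  apply: (@le_trans _ _ 0); first by rewrite nmulr_rle0// ltW// mulr_gt0.
  by rewrite mulr_ge0 ?(ltW xx)//; lra.
apply: le_trans kl _.
have h2 : - (x * p * a) <= d * x ^+ 2.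
  have : 0 <= x * p * (1 + a) by rewrite mulr_ge0 ?(ltW (mulr_gt0 x0 p0))//; case/andP: ha; lra.
  have : 0 <= (d * x - p) * x by rewrite mulr_ge0 ?(ltW x0)//; lra.
  lra.
have h3 : - (x * q * b) <= d * x ^+ 2.
  have : 0 <= x * q * (1 + b) by rewrite mulr_ge0 ?(ltW (mulr_gt0 x0 q0))//; case/andP: hb; lra.
  have : 0 <= (d * x - q) * x by rewrite mulr_ge0 ?(ltW x0)//; lra.
  lra.
have h1 : p * q * c <= d * x ^+ 2.
  apply: (@le_trans _ _ ((d * x) * (d * x))).
    apply: (@le_trans _ _ (p * q)); first by rewrite ger_pMr// mulr_gt0.
    by apply: ler_pM; rewrite // ltW.
  have : 0 <= d * (1 - d) * x ^+ 2 by rewrite !mulr_ge0 ?(ltW d0) ?(ltW xx)//; lra.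
  lra.
rewrite /cosnum; lra.
Qed.

(** * Derivatives of the angles in logarithmic radii, and their monotonicity *)

(** The partial derivative of the angle at x with respect to ln p; under (C1) each term of the
    numerator is nonnegative. *)
Definition edge_weight (R : realType) (x p q a b c : R) : R :=
  (x ^+ 2 * p ^+ 2 * (1 - a ^+ 2) + x ^+ 2 * p * q * (c + a * b)
   + x * p ^+ 2 * q * (b + a * c)) / (Num.sqrt (gram x p q a b c) * sqlen x p a).

Lemma edge_weight_sym (R : realType) (x p q a b c : R) :
  edge_weight p x q a c b = edge_weight x p q a b c.
Proof.
rewrite /edge_weight (sqlenC x) -gram_rot gram_swap; congr (_ / _); ring.
Qed.

Lemma is_derive_conv (R : realType) (f : R -> R) (s df dg : R) :
  is_derive s 1 f df -> df = dg -> is_derive s 1 f dg.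
Proof. by move=> h <-. Qed.

Lemma is_derive_add (R : realType) (f g : R -> R) (s df dg : R) :
  is_derive s 1 f df -> is_derive s 1 g dg -> is_derive s 1 (fun t => f t + g t) (df + dg).
Proof. exact: is_deriveD. Qed.

Lemma is_derive_mul (R : realType) (f g : R -> R) (s df dg : R) :
  is_derive s 1 f df -> is_derive s 1 g dg ->
  is_derive s 1 (fun t => f t * g t) (f s * dg + g s * df).
Proof. exact: is_deriveM. Qed.

Lemma is_derive_const (R : realType) (k s : R) : is_derive s 1 (fun=> k) 0.
Proof. exact: is_derive_cst. Qed.

Lemma is_derive_opp (R : realType) (f : R -> R) (s df : R) :
  is_derive s 1 f df -> is_derive s 1 (fun t => - f t) (- df).
Proof. exact: is_deriveN. Qed.

Lemma is_derive_sqr (R : realType) (f : R -> R) (s df : R) :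
  is_derive s 1 f df -> is_derive s 1 (fun t => f t ^+ 2) (2 * f s * df).
Proof.
move=> hf; apply: (is_derive_eq (is_derive_mul hf hf : is_derive s 1 (fun t => f t ^+ 2) _)).
ring.
Qed.

(** wx, wp, wq are the speeds of the logarithms of the radii. Only their differences occur, since
    angles are invariant under scaling. *)
Lemma is_derive_ang (R : realType) (x p q : R -> R) (s wx wp wq a b c : R) :
  0 < x s -> 0 < p s -> 0 < q s -> admissible a b c ->
  is_derive s 1 x (x s * wx) -> is_derive s 1 p (p s * wp) -> is_derive s 1 q (q s * wq) ->
  is_derive s 1 (fun t => ang (x t) (p t) (q t) a b c)
    (edge_weight (x s) (p s) (q s) a b c * (wp - wx) +
     edge_weight (x s) (q s) (p s) b a c * (wq - wx)).
Proof.
move=> x0 p0 q0 adm dx dp dq; have [[ha hb _] _] := adm.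
have S0 := gram_gt0 x0 p0 q0 adm.
have L10 := sqlen_gt0 x0 p0 ha; have L20 := sqlen_gt0 x0 q0 hb.
have dlen (y r : R -> R) (wy wr k : R) : is_derive s 1 y (y s * wy) ->
    is_derive s 1 r (r s * wr) -> is_derive s 1 (fun t => sqlen (y t) (r t) k)
      (2 * y s ^+ 2 * wy + 2 * r s ^+ 2 * wr + 2 * y s * r s * k * (wy + wr)).
  move=> dy dr; refine (is_derive_conv (is_derive_add (is_derive_add (is_derive_sqr dy)
    (is_derive_sqr dr)) (is_derive_mul (is_derive_mul (is_derive_mul (is_derive_const 2 s) dy)
    dr) (is_derive_const k s))) _).
  by ring.
pose dN := 2 * x s ^+ 2 * wx + x s * p s * a * (wx + wp) + x s * q s * b * (wx + wq)
  - p s * q s * c * (wp + wq).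
have dnum : is_derive s 1 (fun t => cosnum (x t) (p t) (q t) a b c) dN.
  refine (is_derive_conv (is_derive_add (is_derive_add (is_derive_add (is_derive_sqr dx)
    (is_derive_mul (is_derive_mul dx dp) (is_derive_const a s)))
    (is_derive_mul (is_derive_mul dx dq) (is_derive_const b s)))
    (is_derive_opp (is_derive_mul (is_derive_mul dp dq) (is_derive_const c s)))) _).
  by rewrite /dN; ring.
have [dS [ddS EdS]] : exists dS, is_derive s 1 (fun t => gram (x t) (p t) (q t) a b c) dS /\
   dS = sqlen (x s) (p s) a * (2 * x s ^+ 2 * wx + 2 * q s ^+ 2 * wq + 2 * x s * q s * b * (wx + wq))
    + sqlen (x s) (q s) b * (2 * x s ^+ 2 * wx + 2 * p s ^+ 2 * wp + 2 * x s * p s * a * (wx + wp))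
    - 2 * cosnum (x s) (p s) (q s) a b c * dN.
  eexists; split.
    exact: (is_derive_add (is_derive_mul (dlen _ _ _ _ a dx dp) (dlen _ _ _ _ b dx dq))
      (is_derive_opp (is_derive_sqr dnum))).
  by rewrite /=; ring.
have dsq : is_derive s 1 (fun t => Num.sqrt (gram (x t) (p t) (q t) a b c))
   ((2 * Num.sqrt (gram (x s) (p s) (q s) a b c))^-1 * dS).
  exact: (@is_derive1_comp R Num.sqrt (fun t => gram (x t) (p t) (q t) a b c) s _ _
    (is_derive1_sqrt S0) ddS).
have sq0 : Num.sqrt (gram (x s) (p s) (q s) a b c) != 0 by rewrite gt_eqF ?sqrtr_gt0.
have dinv := @is_deriveV R (fun t => Num.sqrt (gram (x t) (p t) (q t) a b c)) s _ _ sq0 dsq.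
have dquo := is_derive_mul dnum dinv.
have dat := @is_derive1_comp R (@atan R)
  (fun t => cosnum (x t) (p t) (q t) a b c / Num.sqrt (gram (x t) (p t) (q t) a b c))
  s _ _ (is_derive1_atan _) dquo.
refine (is_derive_conv (is_derive_add (is_derive_const (pi / 2) s) (is_derive_opp dat)) _).
rewrite add0r /= /edge_weight [gram (x s) (q s) (p s) b a c]gram_swap.
have Es : Num.sqrt (gram (x s) (p s) (q s) a b c) ^+ 2 = gram (x s) (p s) (q s) a b c.
  by rewrite sqr_sqrtr ?(ltW S0).
have EL : sqlen (x s) (p s) a * sqlen (x s) (q s) b =
   Num.sqrt (gram (x s) (p s) (q s) a b c) ^+ 2 + cosnum (x s) (p s) (q s) a b c ^+ 2.
  by rewrite Es /gram subrK.
set sg := Num.sqrt _ in sq0 Es EL *.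
set N := cosnum _ _ _ _ _ _ in EL EdS *.
have LL0 : sg ^+ 2 + N ^+ 2 != 0 by rewrite -EL mulf_neq0 ?gt_eqF.
(* The derivative of pi/2 - atan (N / sg), using sg' = dS / (2 sg). The identity sg^2 + N^2 = l_xp^2
   l_xq^2 then turns its denominator into squared lengths. *)
transitivity (- (dN * sg ^+ 2 - N * dS / 2) / (sg * (sg ^+ 2 + N ^+ 2))).
  rewrite /GRing.scale/=; field; rewrite sq0 /= LL0 //=.
rewrite -EL Es.
set n1 := (X in X / (sg * sqlen _ (p s) _)); set n2 := (X in X / (sg * sqlen _ (q s) _)).
transitivity ((n1 * sqlen (x s) (q s) b * (wp - wx) + n2 * sqlen (x s) (p s) a * (wq - wx))
   / (sg * (sqlen (x s) (p s) a * sqlen (x s) (q s) b))); last first.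
  by field; rewrite sq0 !gt_eqF.
congr (_ / _); rewrite EdS /n1 /n2 /dN /N /gram /sqlen /cosnum; by field.
Qed.

(** The numerator of [edge_weight] at equal radii 1: it records whether the weight can vanish,
    independently of the radii. *)
Definition edge_defect (R : realType) (a b c : R) : R :=
  (1 - a ^+ 2) + (c + a * b) + (b + a * c).

Lemma edge_defect_ge0 (R : realType) (a b c : R) : admissible a b c -> 0 <= edge_defect a b c.
Proof.
by move=> [[ha hb hc] [h1 h2 h3]]; do 2 apply: addr_ge0 => //; exact: sqr_le1.
Qed.

Lemma edge_weight_ge (R : realType) (m M : R) : 0 < m -> m <= M ->
  exists2 k : R, 0 < k & forall x p q a b c, m <= x <= M -> m <= p <= M -> m <= q <= M ->
    admissible a b c -> k * edge_defect a b c <= edge_weight x p q a b c.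
Proof.
move=> m0 mM; have M0 : 0 < M by lra.
(* Every monomial of the numerator has degree 4 in the radii, hence is at least m^4; the square root
   of [gram] and the squared length are each at most 4 M^2. *)
exists (m ^+ 4 / (16 * M ^+ 4)); first by rewrite divr_gt0 ?mulr_gt0 ?exprn_gt0.
move=> x p q a b c /andP[x1 x2] /andP[p1 p2] /andP[q1 q2] adm.
have [[ha hb _] [_ h2 h3]] := adm.
have x0 : 0 < x by lra. have p0 : 0 < p by lra. have q0 : 0 < q by lra.
have S0 := gram_gt0 x0 p0 q0 adm.
have L1 := sqlen_gt0 x0 p0 ha; have L2 := sqlen_gt0 x0 q0 hb.
have lenM y r k : 0 < y -> 0 < r -> y <= M -> r <= M -> -1 < k <= 1 -> sqlen y r k <= 4 * M ^+ 2.
  move=> y0 r0 yM rM hk; have L := sqlen_gt0 y0 r0 hk.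
  rewrite -[sqlen _ _ _]sqr_sqrtr ?(ltW L)//.
  have -> : 4 * M ^+ 2 = (M + M) ^+ 2 by ring.
  rewrite ler_pXn2r ?nnegrE ?sqrtr_ge0 ?addr_ge0 ?(ltW M0)//.
  by rewrite (le_trans (sqrt_sqlen_le y0 r0 hk))// lerD.
have sS : Num.sqrt (gram x p q a b c) <= 4 * M ^+ 2.
  rewrite -(ler_pXn2r (n := 2)) ?nnegrE ?sqrtr_ge0 ?mulr_ge0 ?sqr_ge0 ?ler0n ?(ltW M0)//.
  rewrite sqr_sqrtr ?(ltW S0)//.
  apply: (@le_trans _ _ (sqlen x p a * sqlen x q b)).
    by rewrite /gram gerBl sqr_ge0.
  by rewrite [X in _ <= X]expr2 ler_pM ?(ltW L1) ?(ltW L2) ?lenM//.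
have den : Num.sqrt (gram x p q a b c) * sqlen x p a <= 16 * M ^+ 4.
  have -> : 16 * M ^+ 4 = (4 * M ^+ 2) * (4 * M ^+ 2) by ring.
  by apply: ler_pM; rewrite ?sqrtr_ge0 ?(ltW L1)// lenM.
have sS0 : 0 < Num.sqrt (gram x p q a b c) by rewrite sqrtr_gt0.
rewrite /edge_weight [X in X <= _]mulrAC ler_pM ?invr_ge0 ?mulr_ge0 ?exprn_ge0 ?(ltW m0) ?(ltW M0) ?edge_defect_ge0 ?ler0n//.
  have mon y r z w : m <= y -> m <= r -> m <= z -> m <= w -> m ^+ 4 <= y * r * z * w.
    move=> *; have -> : m ^+ 4 = m * m * m * m by ring.
    by rewrite !ler_pM ?mulr_ge0 ?(ltW m0).
  rewrite /edge_defect mulrDr (mulrDr _ (1 - a ^+ 2)); apply: lerD; first apply: lerD.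
  - by apply: ler_wpM2r; rewrite ?sqr_le1//; have := mon x x p p x1 x1 p1 p1; lra.
  - by apply: ler_wpM2r => //; have := mon x x p q x1 x1 p1 q1; lra.
  - by apply: ler_wpM2r => //; have := mon x p p q x1 p1 p1 q1; lra.
by rewrite lef_pV2 ?posrE ?mulr_gt0 ?exprn_gt0.
Qed.

(** If both vanish then a = b = 1, and the first defect becomes 2 (1 + c), which is positive. *)
Lemma edge_defect_pair (R : realType) (a b c : R) : admissible a b c ->
  0 < edge_defect a b c \/ 0 < edge_defect b a c.
Proof.
move=> adm; have := edge_defect_ge0 adm; have := edge_defect_ge0 (admissible_swap adm).
rewrite !le_eqVlt => /orP[/eqP e2|]; last by right.
move=> /orP[/eqP e1|]; last by left.
have [[ha hb hc] [h1 h2 h3]] := adm; exfalso; move: e1 e2; rewrite /edge_defect.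
have := sqr_le1 ha; have := sqr_le1 hb => t1 t2 e1 e2.
have a1 : a = 1.
  have : (1 - a) * (1 + a) = 0 by lra.
  by move/eqP; rewrite mulf_eq0 => /orP[]/eqP; case/andP: ha; lra.
have b1 : b = 1.
  have : (1 - b) * (1 + b) = 0 by lra.
  by move/eqP; rewrite mulf_eq0 => /orP[]/eqP; case/andP: hb; lra.
by rewrite a1 b1 in e1; case/andP: hc; lra.
Qed.

(** By [edge_defect_pair], at least two of the three coefficients are positive; they control two of
    the differences, and hence the third. *)
Lemma edge_defect_coercive (R : realType) (a b c : R) : admissible a b c ->
  exists2 k : R, 0 < k & forall x y z : R,
    k * ((x - y) ^+ 2 + (x - z) ^+ 2 + (y - z) ^+ 2) <=
    edge_defect a b c * (x - y) ^+ 2 + edge_defect b a c * (x - z) ^+ 2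
     + edge_defect c a b * (y - z) ^+ 2.
Proof.
have two (d1 d2 d3 : R) : 0 < d1 -> 0 < d2 -> 0 <= d3 -> exists2 k : R, 0 < k &
    forall u v w : R, k * (u ^+ 2 + v ^+ 2 + (u - v) ^+ 2) <=
      d1 * u ^+ 2 + d2 * v ^+ 2 + d3 * (u - v) ^+ 2.
  (* The factor 3 comes from u^2 + v^2 + (u - v)^2 = 3 (u^2 + v^2) - (u + v)^2. *)
  move=> d10 d20 d30; exists (Num.min d1 d2 / 3).
    by rewrite divr_gt0// lt_min d10.
  move=> u v w.
  have k1 : Num.min d1 d2 <= d1 by rewrite ge_min lexx.
  have k2 : Num.min d1 d2 <= d2 by rewrite ge_min lexx orbT.
  have k0 : 0 < Num.min d1 d2 by rewrite lt_min d10.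
  move: (Num.min d1 d2) k1 k2 k0 => k k1 k2 k0.
  have := mulr_ge0 d30 (sqr_ge0 (u - v)).
  have : 0 <= (d1 - k) * u ^+ 2 by rewrite mulr_ge0 ?sqr_ge0 ?subr_ge0.
  have : 0 <= (d2 - k) * v ^+ 2 by rewrite mulr_ge0 ?sqr_ge0 ?subr_ge0.
  have : 0 <= k / 3 * (u + v) ^+ 2 by rewrite mulr_ge0 ?sqr_ge0// divr_ge0 ?ltW.
  lra.
move=> adm; have adm2 := admissible_rot adm; have adm3 := admissible_rot adm2.
have swap (a' b' c' : R) : edge_defect a' b' c' = edge_defect a' c' b' by rewrite /edge_defect; ring.
have d1 := edge_defect_ge0 adm; have d2 := edge_defect_ge0 (admissible_swap adm).
have d3 := edge_defect_ge0 adm2.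
have p12 := edge_defect_pair adm; have p13 := edge_defect_pair adm2.
have p23 := edge_defect_pair adm3.
rewrite (swap a c b) in p13; rewrite (swap b c a) (swap c b a) in p23.
have [a0|a0] := ltP 0 (edge_defect a b c).
  have [b0|b0] := ltP 0 (edge_defect b a c).
    have [k k0 hk] := two _ _ _ a0 b0 d3; exists k => // x y z.
    have := hk (x - y) (x - z) 0; have -> : x - y - (x - z) = - (y - z) by ring.
    by rewrite sqrrN.
  have c0 : 0 < edge_defect c a b by case: p23 => //; lra.
  have [k k0 hk] := two _ _ _ a0 c0 d2; exists k => // x y z.
  have := hk (y - x) (y - z) 0; have -> : y - x - (y - z) = - (x - z) by ring.
  by rewrite sqrrN -(sqrrN (y - x)) opprB; lra.
have b0 : 0 < edge_defect b a c by case: p12 => //; lra.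
have c0 : 0 < edge_defect c a b by case: p13 => //; lra.
have [k k0 hk] := two _ _ _ b0 c0 d1; exists k => // x y z.
have := hk (z - x) (z - y) 0; have -> : z - x - (z - y) = - (x - y) by ring.
by rewrite sqrrN -(sqrrN (z - x)) -(sqrrN (z - y)) !opprB; lra.
Qed.

Lemma is_derive_continuous (R : realType) (f df : R -> R) :
  (forall s : R, is_derive s 1 f (df s)) -> continuous f.
Proof.
move=> hf s; apply: differentiable_continuous; apply/derivable1_diffP.
exact: (@ex_derive R R R s 1 f _ (hf s)).
Qed.

(** Mean value theorem along the segment from v to u: by symmetry of the weights, the derivative of
    the sum of angles times displacements is minus the weighted sum of squared differences of
    displacements. *)
Lemma ang_monotone (R : realType) (a b c B : R) : admissible a b c ->
  exists2 k : R, 0 < k & forall u1 u2 u3 v1 v2 v3 : R,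
    `|u1| <= B -> `|u2| <= B -> `|u3| <= B -> `|v1| <= B -> `|v2| <= B -> `|v3| <= B ->
    (ang (expR u1) (expR u2) (expR u3) a b c - ang (expR v1) (expR v2) (expR v3) a b c)
      * (u1 - v1) +
    (ang (expR u2) (expR u3) (expR u1) c a b - ang (expR v2) (expR v3) (expR v1) c a b)
      * (u2 - v2) +
    (ang (expR u3) (expR u1) (expR u2) b c a - ang (expR v3) (expR v1) (expR v2) b c a)
      * (u3 - v3) <=
    - k * (((u1 - v1) - (u2 - v2)) ^+ 2 + ((u1 - v1) - (u3 - v3)) ^+ 2 +
           ((u2 - v2) - (u3 - v3)) ^+ 2).
Proof.
move=> adm; have adm2 := admissible_rot adm; have adm3 := admissible_rot adm2.
(* The absolute value makes the interval of radii nonempty also for negative B, where the hypotheses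
   on u and v are contradictory. *)
have eB : expR (- `|B|) <= expR `|B| :> R.
  by rewrite ler_expR; have := normr_ge0 B; lra.
have [k1 k10 hk1] := edge_weight_ge (expR_gt0 (- `|B|)) eB.
have [k2 k20 hk2] := edge_defect_coercive adm.
exists (k1 * k2); first by rewrite mulr_gt0.
move=> u1 u2 u3 v1 v2 v3 U1 U2 U3 V1 V2 V3.
pose w1 := u1 - v1; pose w2 := u2 - v2; pose w3 := u3 - v3.
pose y (v w t : R) := expR (v + t * w).
have dy (v w s : R) : is_derive s 1 (y v w) (y v w s * w).
  have d1 : is_derive s 1 (fun t : R => v + t * w) w.
    refine (is_derive_conv (is_derive_add (is_derive_const v s)
      (is_derive_mul (is_derive_id s (1 : R)) (is_derive_const w s))) _).
    by rewrite /= mulr0 add0r add0r mulr1.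
  exact: (@is_derive1_comp R expR (fun t : R => v + t * w) s _ _ (is_derive_expR _) d1).
have y0 v w t : 0 < y v w t by exact: expR_gt0.
pose phi t := ang (y v1 w1 t) (y v2 w2 t) (y v3 w3 t) a b c * w1 +
  ang (y v2 w2 t) (y v3 w3 t) (y v1 w1 t) c a b * w2 +
  ang (y v3 w3 t) (y v1 w1 t) (y v2 w2 t) b c a * w3.
pose dphi t := - (edge_weight (y v1 w1 t) (y v2 w2 t) (y v3 w3 t) a b c * (w1 - w2) ^+ 2 +
   edge_weight (y v1 w1 t) (y v3 w3 t) (y v2 w2 t) b a c * (w1 - w3) ^+ 2 +
   edge_weight (y v2 w2 t) (y v3 w3 t) (y v1 w1 t) c a b * (w2 - w3) ^+ 2).
have dphiP (s : R) : is_derive s 1 phi (dphi s).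
  have e1 := is_derive_ang (y0 v1 w1 s) (y0 v2 w2 s) (y0 v3 w3 s) adm (dy _ _ _) (dy _ _ _) (dy _ _ _).
  have e2 := is_derive_ang (y0 v2 w2 s) (y0 v3 w3 s) (y0 v1 w1 s) adm2 (dy _ _ _) (dy _ _ _) (dy _ _ _).
  have e3 := is_derive_ang (y0 v3 w3 s) (y0 v1 w1 s) (y0 v2 w2 s) adm3 (dy _ _ _) (dy _ _ _) (dy _ _ _).
  refine (is_derive_conv (is_derive_add (is_derive_add
    (is_derive_mul e1 (is_derive_const w1 s)) (is_derive_mul e2 (is_derive_const w2 s)))
    (is_derive_mul e3 (is_derive_const w3 s))) _).
  rewrite (edge_weight_sym (y v1 w1 s) (y v2 w2 s)) (edge_weight_sym (y v1 w1 s) (y v3 w3 s)).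
  rewrite (edge_weight_sym (y v2 w2 s) (y v3 w3 s)) /dphi; ring.
have [t t01 Et] : exists2 t, t \in `]0, 1[%R & phi 1 - phi 0 = dphi t * (1 - 0).
  apply: MVT => //; exact/continuous_subspaceT/(is_derive_continuous dphiP).
have y1 u v : y v (u - v) 1 = expR u by rewrite /y mul1r addrC subrK.
have yz u v : y v (u - v) 0 = expR v by rewrite /y mul0r addr0.
have -> : forall x1 x2 x3 z1 z2 z3 : R, (x1 - z1) * (u1 - v1) + (x2 - z2) * (u2 - v2) +
    (x3 - z3) * (u3 - v3) = (x1 * w1 + x2 * w2 + x3 * w3) - (z1 * w1 + z2 * w2 + z3 * w3).
  by move=> *; rewrite /w1 /w2 /w3; ring.
move: Et; rewrite /phi !y1 !yz => ->; rewrite subr0 mulr1.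
have yB u v : `|u| <= B -> `|v| <= B -> expR (- `|B|) <= y v (u - v) t <= expR `|B|.
  rewrite !ler_norml => /andP[h1 h2] /andP[h3 h4]; rewrite /y !ler_expR.
  move: t01; rewrite in_itv/= => /andP[t0 t1].
  have BB : `|B| = B by rewrite ger0_norm//; lra.
  have -> : v + t * (u - v) = (1 - t) * v + t * u by ring.
  rewrite BB.
  have := ler_wpM2l (ltW t0) h1; have := ler_wpM2l (ltW t0) h2.
  have t1' : 0 <= 1 - t by lra.
  have := ler_wpM2l t1' h3; have := ler_wpM2l t1' h4.
  by move=> *; apply/andP; split; lra.
rewrite /dphi mulNr lerN2 -mulrA.
have E1 := hk1 _ _ _ _ _ _ (yB _ _ U1 V1) (yB _ _ U2 V2) (yB _ _ U3 V3) adm.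
have E2 := hk1 _ _ _ _ _ _ (yB _ _ U1 V1) (yB _ _ U3 V3) (yB _ _ U2 V2) (admissible_swap adm).
have E3 := hk1 _ _ _ _ _ _ (yB _ _ U2 V2) (yB _ _ U3 V3) (yB _ _ U1 V1) adm2.
apply: (@le_trans _ _ (k1 * (edge_defect a b c * (w1 - w2) ^+ 2 +
   edge_defect b a c * (w1 - w3) ^+ 2 + edge_defect c a b * (w2 - w3) ^+ 2))).
  by rewrite ler_pM2l.
rewrite mulrDr (mulrDr k1 (_ * _)) (mulrA k1 _ (_ ^+ 2)) (mulrA k1 (edge_defect b a c)).
rewrite (mulrA k1 (edge_defect c a b)); apply: lerD; first apply: lerD.
- exact: (ler_wpM2r (sqr_ge0 _) E1).
- exact: (ler_wpM2r (sqr_ge0 _) E2).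
- exact: (ler_wpM2r (sqr_ge0 _) E3).
Qed.

Lemma cvg_ang (R : realType) (T : Type) (G : set_system T) (FG : Filter G)
    (x p q : T -> R) (x0 p0 q0 a b c : R) :
  0 < x0 -> 0 < p0 -> 0 < q0 -> admissible a b c ->
  (x @ G --> x0)%classic -> (p @ G --> p0)%classic -> (q @ G --> q0)%classic ->
  ((fun t => ang (x t) (p t) (q t) a b c) @ G --> ang x0 p0 q0 a b c)%classic.
Proof.
move=> x00 p00 q00 adm cx cp cq; have S0 := gram_gt0 x00 p00 q00 adm.
have csq (f : T -> R) (l : R) : (f @ G --> l)%classic ->
    ((fun t => f t ^+ 2) @ G --> l ^+ 2)%classic.
  by move=> cf; rewrite expr2; under eq_fun do rewrite expr2; exact: cvgM.
have clen (y r : T -> R) (y0 r0 k : R) : (y @ G --> y0)%classic -> (r @ G --> r0)%classic ->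
    ((fun t => sqlen (y t) (r t) k) @ G --> sqlen y0 r0 k)%classic.
  move=> cy cr; apply: cvgD; first by apply: cvgD; exact: csq.
  apply: cvgM; last exact: cvg_cst.
  apply: cvgM => //; apply: cvgM => //; exact: cvg_cst.
have cnum : ((fun t => cosnum (x t) (p t) (q t) a b c) @ G --> cosnum x0 p0 q0 a b c)%classic.
  have c3 (y r : T -> R) (y0 r0 k : R) : (y @ G --> y0)%classic -> (r @ G --> r0)%classic ->
      ((fun t => y t * r t * k) @ G --> y0 * r0 * k)%classic.
    by move=> cy cr; apply: cvgM; [exact: cvgM | exact: cvg_cst].
  by apply: cvgB; [apply: cvgD; [apply: cvgD; [exact: csq|exact: c3]|exact: c3]|exact: c3].
have cgram : ((fun t => gram (x t) (p t) (q t) a b c) @ G --> gram x0 p0 q0 a b c)%classic.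
  by apply: cvgB; [apply: cvgM; exact: clen | exact: csq].
apply: cvgB; first exact: cvg_cst.
apply: (@continuous_cvg _ _ _ _ _ _ (@atan R)); first exact: continuous_atan.
apply: cvgM => //; apply: cvgV; first by rewrite gt_eqF ?sqrtr_gt0.
apply: (@continuous_cvg _ _ _ _ _ _ (@Num.sqrt R)) => //; exact: sqrt_continuous.
Qed.

(** * Combinatorics of triangulated surfaces *)

(** Summing over ordered triples avoids choosing an order of the corners: a triangle counts six
    times, a triangle with a marked corner twice. This is the origin of the factors 1/6 and 1/2
    below. *)
Definition tri_sum (R : realType) (V : finType) (F : {set {set V}}) (f : V -> V -> V -> R) : R :=
  \sum_v \sum_a \sum_(b | [set v; a; b] \in F) f v a b.

Lemma eq_tri_sum (R : realType) (V : finType) (F : {set {set V}}) (f g : V -> V -> V -> R) :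
  (forall v a b, [set v; a; b] \in F -> f v a b = g v a b) -> tri_sum F f = tri_sum F g.
Proof. by move=> fg; do 2 (apply: eq_bigr => ? _); apply: eq_bigr => ? ?; exact: fg. Qed.

Lemma tri_sumD (R : realType) (V : finType) (F : {set {set V}}) (f g : V -> V -> V -> R) :
  tri_sum F (fun v a b => f v a b + g v a b) = tri_sum F f + tri_sum F g.
Proof.
rewrite /tri_sum -big_split; apply: eq_bigr => v _ /=.
by rewrite -big_split; apply: eq_bigr => a _ /=; rewrite -big_split.
Qed.

Lemma tri_sumZ (R : realType) (V : finType) (F : {set {set V}}) (k : R) (f : V -> V -> V -> R) :
  tri_sum F (fun v a b => k * f v a b) = k * tri_sum F f.
Proof.
rewrite /tri_sum mulr_sumr; apply: eq_bigr => v _; rewrite mulr_sumr.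
by apply: eq_bigr => a _; rewrite mulr_sumr.
Qed.

Lemma tri_sumN (R : realType) (V : finType) (F : {set {set V}}) (f : V -> V -> V -> R) :
  tri_sum F (fun v a b => - f v a b) = - tri_sum F f.
Proof. by rewrite -mulN1r -tri_sumZ; apply: eq_tri_sum => *; rewrite mulN1r. Qed.

Lemma tri_sumB (R : realType) (V : finType) (F : {set {set V}}) (f g : V -> V -> V -> R) :
  tri_sum F (fun v a b => f v a b - g v a b) = tri_sum F f - tri_sum F g.
Proof. by rewrite tri_sumD tri_sumN. Qed.

Lemma set3_swap (V : finType) (v a b : V) : [set v; b; a] = [set v; a; b].
Proof. by rewrite finset.setUAC. Qed.

Lemma set3_rot (V : finType) (v a b : V) : [set a; b; v] = [set v; a; b].
Proof. by apply/finset.setP => x; rewrite !inE orbC orbA. Qed.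

Lemma tri_sum_rot (R : realType) (V : finType) (F : {set {set V}}) (f : V -> V -> V -> R) :
  tri_sum F (fun v a b => f a b v) = tri_sum F f.
Proof.
rewrite /tri_sum exchange_big; apply: eq_bigr => a _ /=.
rewrite (exchange_big_dep predT)//=.
by apply: eq_bigr => b _; apply: eq_bigl => v; rewrite (set3_rot v a b).
Qed.

Lemma tri_sum_ge0 (R : realType) (V : finType) (F : {set {set V}}) (f : V -> V -> V -> R) :
  (forall v a b, [set v; a; b] \in F -> 0 <= f v a b) -> 0 <= tri_sum F f.
Proof. by move=> f0; do 3 (apply: sumr_ge0 => ? ?); exact: f0. Qed.

Lemma tri_sum_ge_term (R : realType) (V : finType) (F : {set {set V}}) (f : V -> V -> V -> R) v a b :
  (forall v a b, [set v; a; b] \in F -> 0 <= f v a b) -> [set v; a; b] \in F ->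
  f v a b <= tri_sum F f.
Proof.
move=> f0 h; rewrite /tri_sum (bigD1 v)//= (bigD1 a)//= (bigD1 b)//= -!addrA lerDl.
rewrite !addr_ge0//; last by do 3 (apply: sumr_ge0 => ? ?); exact: f0.
  by apply: sumr_ge0 => c /andP[? _]; exact: f0.
by do 2 (apply: sumr_ge0 => ? ?); exact: f0.
Qed.

Lemma set3E (V : finType) (v a b : V) : [set v; a; b] = v |: [set a; b].
Proof. by rewrite finset.setUA. Qed.

Lemma set3_neq (V : finType) (F : {set {set V}}) (v a b : V) :
  (forall t, t \in F -> #|t| = 3%N) -> [set v; a; b] \in F ->
  [/\ v != a, v != b & a != b].
Proof.
move=> F3 /F3; rewrite set3E cardsU1 cards2 !inE negb_or.
by case: (v != a); case: (v != b); case: (a != b).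
Qed.

Lemma set3_edge (V : finType) (F : {set {set V}}) (v a b : V) :
  (forall t, t \in F -> #|t| = 3%N) -> [set v; a; b] \in F -> [set a; b] \in tri_edges F.
Proof.
move=> F3 h; have [_ _ ab] := set3_neq F3 h; rewrite inE cards2 ab /=.
by apply/existsP; exists [set v; a; b]; rewrite h set3E finset.subsetUr.
Qed.

Lemma sum_pairs (R : realType) (V : finType) (P : pred {set V}) (h : {set V} -> R) :
  \sum_a \sum_(b | (a != b) && P [set a; b]) h [set a; b] =
  2 * \sum_(e : {set V} | (#|e| == 2)%N && P e) h e.
Proof.
rewrite pair_big_dep /= (partition_big (fun p : V * V => [set p.1; p.2])
  (fun e => (#|e| == 2)%N && P e)) /=; last first.
  by move=> [a b] /= /andP[ab Pab]; rewrite cards2 ab.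
rewrite mulr_sumr; apply: eq_bigr => e /andP[/cards2P [x [y [xy Ee]]] Pe]; rewrite {e}Ee in Pe *.
rewrite (eq_bigr (fun=> h [set x; y])); last by move=> p /andP[_ /eqP ->].
rewrite sumr_const -[LHS]mulr_natl; congr (_%:R * _).
rewrite (_ : 2%N = #|[set (x, y); (y, x)]|); last first.
  by rewrite cards2 xpair_eqE (negPf xy).
apply: eq_card => -[a b]; rewrite !inE !xpair_eqE /= -topredE /=.
apply/idP/idP => [/andP[/andP[ab _] /eqP E]|].
  have : a \in [set x; y] by rewrite -E !inE eqxx.
  have : b \in [set x; y] by rewrite -E !inE eqxx orbT.
  rewrite !inE => /orP[]/eqP eb /orP[]/eqP ea; subst; rewrite ?eqxx ?orbT//= in ab *.
case/orP => /andP[/eqP -> /eqP ->]; first by rewrite xy Pe eqxx.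
by rewrite eq_sym xy finset.setUC Pe eqxx.
Qed.

Lemma tri_sum_edges (R : realType) (V : finType) (F : {set {set V}}) (g : {set V} -> V -> R) :
  (forall t, t \in F -> #|t| = 3%N) ->
  tri_sum F (fun v a b => g [set a; b] v) =
  2 * \sum_(e in tri_edges F) \sum_(v | v |: e \in F) g e v.
Proof.
move=> F3; rewrite (exchange_big_dep predT)//= mulr_sumr; apply: eq_bigr => v _.
transitivity (2 * \sum_(e : {set V} | (#|e| == 2)%N && (v |: e \in F)) g e v).
  rewrite -(sum_pairs (fun e => v |: e \in F) (fun e => g e v)).
  apply: eq_bigr => a _; apply: eq_bigl => b; rewrite -set3E.
  by case: (boolP (_ \in F)) => [/(set3_neq F3)[_ _ ->]|]//; rewrite andbF.
congr (_ * _); apply: eq_bigl => e.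
case: (boolP (v |: e \in F)) => [vF|]; rewrite ?andbF// !andbT inE.
case: eqP => //= _; symmetry; apply/existsP; exists (v |: e).
by rewrite vF finset.subsetUr.
Qed.

Lemma tri_sum_faces (R : realType) (V : finType) (F : {set {set V}}) (f : {set V} -> R) :
  (forall t, t \in F -> #|t| = 3%N) ->
  tri_sum F (fun v a b => f [set v; a; b]) = 6 * \sum_(t in F) f t.
Proof.
move=> F3; have -> : tri_sum F (fun v a b => f [set v; a; b]) =
    tri_sum F (fun v a b => f (v |: [set a; b])).
  by apply: eq_tri_sum => v a b _; rewrite set3E.
rewrite (tri_sum_edges (fun e v => f (v |: e)))// (exchange_big_dep predT)//=.
transitivity (2 * \sum_v \sum_(t in F | v \in t) f t : R); last first.
  rewrite (exchange_big_dep (fun t => t \in F)) /=; last by move=> v t _ /andP[].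
  rewrite -[6]/((2 * 3)%:R) natrM -mulrA; congr (_ * _); rewrite mulr_sumr.
  apply: eq_bigr => t tF; rewrite tF /= sumr_const (_ : #|_| = 3%N) ?mulr_natl//.
  by rewrite -(F3 _ tF).
congr (_ * _); apply: eq_bigr => v _.
(* Triangles at v correspond to their edges opposite to v. *)
rewrite [RHS](reindex_onto (fun e => v |: e) (fun t => t :\ v)) /=; last first.
  by move=> t /andP[_ vt]; rewrite finset.setD1K.
apply: eq_bigl => e; case: (boolP (v |: e \in F)) => [vF|]; rewrite ?andbF// andbT !inE eqxx /=.
apply/idP/eqP => [/andP[/eqP e2 _]|E].
  rewrite finset.setU1K//; apply/negP => ve; have := F3 _ vF.
  by rewrite (finset.setUidPr _) ?e2// finset.sub1set.
have := F3 _ vF; rewrite cardsU1 -{1}E !inE eqxx /= add1n => -[->] /=.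
by apply/existsP; exists (v |: e); rewrite vF finset.subsetUr.
Qed.

(** * Oriented vertex links, and the count of boundary edges *)

Lemma connect_closed (T : finType) (e : rel T) (P : T -> Prop) (x y : T) :
  (forall a b, P a -> e a b -> P b) -> connect e x y -> P x -> P y.
Proof.
move=> cl /connectP[p]; elim: p x => [|z p IH] x /= => [_ ->//|].
by move=> /andP[xz pz] Ey Px; apply: (IH z) => //; exact: cl Px xz.
Qed.

Lemma connect_pred (T : finType) (e : rel T) (x y : T) :
  connect e x y -> y = x \/ exists2 d, connect e x d & e d y.
Proof.
move=> h; apply: (connect_closed (P := fun y => y = x \/ exists2 d, connect e x d & e d y) _ h);
  last by left.
move=> a b ha ab; right; exists a => //.
by case: ha => [->|[d xd da]]; [exact: connect0 | exact: connect_trans (connect1 da)].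
Qed.

(** The link of v as a directed graph: the orientation traverses the triangle as v, a, b. Coherence
    makes this relation functional and injective. *)
Definition oriented_arc (V : finType) (F : {set {set V}}) (nx : {set V} -> V -> V) (v : V) : rel V :=
  fun a b => [exists t in F, [&& v \in t, nx t v == a & nx t a == b]].

Lemma orient_face (V : finType) (F : {set {set V}}) (nx : {set V} -> V -> V) (t : {set V}) (v a : V) :
  (forall t, t \in F -> #|t| = 3%N) -> coherent_orientation F nx ->
  t \in F -> v \in t -> a \in t -> a != v -> nx t v = a \/ nx t a = v.
Proof.
move=> F3 [nx3 _] tF vt ta av; have [n1 n2 n3] := nx3 _ _ tF vt.
have [m1 m2 m3] := nx3 _ _ tF n1.
have mv : nx t (nx t v) != v.
  by apply/negP => /eqP E; move: n3; rewrite E => E'; rewrite E' eqxx in n2.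
have Et : [set v; nx t v; nx t (nx t v)] = t.
  apply/eqP; rewrite eqEcard !finset.subUset !finset.sub1set vt n1 m1 (F3 _ tF).
  by rewrite set3E cardsU1 cards2 !inE negb_or !(eq_sym v) n2 mv eq_sym m2.
move: ta; rewrite -Et !inE (negPf av) /= => /orP[/eqP ->|/eqP ->]; rewrite !Et; first by left.
by right.
Qed.

Lemma orient_inj (V : finType) (F : {set {set V}}) (nx : {set V} -> V -> V) (t : {set V}) (a b : V) :
  coherent_orientation F nx -> t \in F -> a \in t -> b \in t -> nx t a = nx t b -> a = b.
Proof.
move=> [nx3 _] tF ta tb E; have [_ _ <-] := nx3 _ _ tF ta; have [_ _ <-] := nx3 _ _ tF tb.
by rewrite E.
Qed.

Lemma oriented_arc_edges (V : finType) (F : {set {set V}}) (nx : {set V} -> V -> V) (v a b : V) :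
  coherent_orientation F nx -> oriented_arc F nx v a b ->
  exists2 t, t \in F & [/\ v \in t, a \in t, b \in t, nx t v = a & nx t a = b /\ nx t b = v] /\
    [/\ a != v, b != a & b != v].
Proof.
move=> [nx3 _] /existsP[t /and4P[tF vt /eqP va /eqP ab]]; exists t => //.
have [n1 n2 n3] := nx3 _ _ tF vt; rewrite va in n1 n2 n3.
have [m1 m2 m3] := nx3 _ _ tF n1; rewrite ab in m1 m2 n3.
have [l1 l2 l3] := nx3 _ _ tF m1; rewrite n3 in l2.
by split; split; rewrite // eq_sym.
Qed.

(** Two distinct triangles on the edge va traverse it in opposite directions, so only one of them
    can run from v to a. *)
Lemma oriented_arc_fun (V : finType) (F : {set {set V}}) (nx : {set V} -> V -> V) (v a b b' : V) :
  coherent_orientation F nx -> oriented_arc F nx v a b -> oriented_arc F nx v a b' -> b = b'.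
Proof.
move=> O /(oriented_arc_edges O)[t tF [[vt ta bt va [ab bv]] [h1 h2 h3]]].
move=> /(oriented_arc_edges O)[t' tF' [[vt' ta' bt' va' [ab' bv']] [h1' h2' h3']]].
have [E|nt] := eqVneq t t'; first by rewrite -ab -ab' E.
case: O => _ /(_ t t' v a tF tF' nt vt ta vt' ta'); rewrite eq_sym => /(_ h1 va) E.
by rewrite -ab' E eqxx in h3'.
Qed.

Lemma oriented_arc_inj (V : finType) (F : {set {set V}}) (nx : {set V} -> V -> V) (v a a' b : V) :
  coherent_orientation F nx -> oriented_arc F nx v a b -> oriented_arc F nx v a' b -> a = a'.
Proof.
move=> O /(oriented_arc_edges O)[t tF [[vt ta bt va [ab bv]] [h1 h2 h3]]].
move=> /(oriented_arc_edges O)[t' tF' [[vt' ta' bt' va' [ab' bv']] [h1' h2' h3']]].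
have [E|nt] := eqVneq t t'; first by rewrite -va -va' E.
case: O => _ /(_ t t' b v tF tF' nt bt vt bt' vt' h3 bv) E.
by rewrite -va' E eqxx in h2'.
Qed.

Lemma link_rel_arc (V : finType) (F : {set {set V}}) (nx : {set V} -> V -> V) (v a b : V) :
  (forall t, t \in F -> #|t| = 3%N) -> coherent_orientation F nx ->
  link_rel F v a b -> oriented_arc F nx v a b \/ oriented_arc F nx v b a.
Proof.
move=> F3 O /and3P[_ _ tF]; have [va vb ab] := set3_neq F3 tF.
have vt : v \in [set v; a; b] by rewrite !inE eqxx.
have ta : a \in [set v; a; b] by rewrite !inE eqxx orbT.
have bt : b \in [set v; a; b] by rewrite !inE eqxx !orbT.
have av : a != v by rewrite eq_sym.
have bv : b != v by rewrite eq_sym.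
have ba : b != a by rewrite eq_sym.
set t := [set v; a; b] in vt ta bt tF *.
have [E|E] := orient_face F3 O tF vt ta av.
  left; apply/existsP; exists t; rewrite tF vt E eqxx /=.
  have [->//|E'] := orient_face F3 O tF ta bt ba.
  by move: bv; rewrite (orient_inj O tF bt vt) ?eqxx// E E'.
right; apply/existsP; exists t; rewrite tF vt /=.
have [E'|E'] := orient_face F3 O tF vt bt bv; last first.
  by move: ab; rewrite (orient_inj O tF ta bt) ?eqxx// E E'.
rewrite E' eqxx /=; have [E2|->//] := orient_face F3 O tF ta bt ba.
by move: bv; rewrite -E2 E eqxx.
Qed.

Lemma face_eq_bd (V : finType) (F : {set {set V}}) (e t t' : {set V}) :
  bd_edge F e -> t \in F -> e \subset t -> t' \in F -> e \subset t' -> t = t'.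
Proof.
move=> /andP[_ /cards1P[s Es]] tF et tF' et'.
have : t \in faces_at F e by rewrite inE tF.
have : t' \in faces_at F e by rewrite inE tF'.
by rewrite Es !inE => /eqP -> /eqP ->.
Qed.

Lemma subset2 (V : finType) (t : {set V}) (a b : V) :
  ([set a; b] \subset t) = (a \in t) && (b \in t).
Proof. by rewrite finset.subUset !finset.sub1set. Qed.

Lemma arc_link (V : finType) (F : {set {set V}}) (nx : {set V} -> V -> V) (v a b : V) :
  coherent_orientation F nx -> oriented_arc F nx v a b ->
  a \in link_verts F v /\ b \in link_verts F v.
Proof.
move=> O /(oriented_arc_edges O)[t tF [[vt ta bt _ _] [h1 _ h3]]].
by split; rewrite inE ?h1 ?h3 /=; apply/existsP; exists t; rewrite tF vt.
Qed.

Lemma link_arc_total (V : finType) (F : {set {set V}}) (nx : {set V} -> V -> V) (v a : V) :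
  (forall t, t \in F -> #|t| = 3%N) -> coherent_orientation F nx -> a \in link_verts F v ->
  (exists b, oriented_arc F nx v a b) \/ (exists b, oriented_arc F nx v b a).
Proof.
move=> F3 O; rewrite inE => /andP[av /existsP[t /and3P[tF vt ta]]].
have [h|h] := orient_face F3 O tF vt ta av.
  by left; exists (nx t a); apply/existsP; exists t; rewrite tF vt h !eqxx.
right; exists (nx t v); apply/existsP; exists t; rewrite tF vt eqxx /=.
by have [_ _ E] := (proj1 O) _ _ tF ta; rewrite -[X in _ == X]E h.
Qed.

(* The boundary edges issuing from v along the induced orientation of the
   boundary: they start the directed path that is the link of v. *)
Definition bd_out (V : finType) (F : {set {set V}}) (nx : {set V} -> V -> V) : {set V * V} :=
  [set p | bd_edge F [set p.1; p.2] &&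
    [exists t in F, [&& p.1 \in t, p.2 \in t, p.1 != p.2 & nx t p.1 == p.2]]].

(** A predecessor of a would come from a triangle running from a to v, but the only triangle on this
    boundary edge runs from v to a. *)
Lemma bd_out_no_pred (V : finType) (F : {set {set V}}) (nx : {set V} -> V -> V) (v a b : V) :
  coherent_orientation F nx -> (v, a) \in bd_out F nx -> ~~ oriented_arc F nx v b a.
Proof.
move=> O; rewrite inE /= => /andP[bd /existsP[t /and5P[tF vt ta va /eqP E]]].
apply/negP => /(oriented_arc_edges O)[t' tF' [[vt' bt' ta' E1 [E2 _]] [h1 h2 h3]]].
have Et : t = t' by apply: (face_eq_bd bd); rewrite ?subset2 ?vt ?vt'.
by move: h2; rewrite -E1 -Et E eqxx.
Qed.

(** Without a predecessor, a has a successor, so some triangle runs from v to a. By coherence a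
    second triangle on va would run from a to v and give a a predecessor. *)
Lemma no_pred_bd_out (V : finType) (F : {set {set V}}) (nx : {set V} -> V -> V) (v a : V) :
  (forall t, t \in F -> #|t| = 3%N) -> coherent_orientation F nx -> a \in link_verts F v ->
  (forall b, ~~ oriented_arc F nx v b a) -> (v, a) \in bd_out F nx.
Proof.
move=> F3 O aL npred.
have [[b /(oriented_arc_edges O)[t tF [[vt ta bt E [E1 E2]] [h1 h2 h3]]]]|[b]] := link_arc_total F3 O aL;
  last by rewrite (negPf (npred b)).
rewrite inE /=; apply/andP; split; last first.
  by apply/existsP; exists t; rewrite tF vt ta E eq_sym h1 eqxx.
have va : v != a by rewrite eq_sym.
rewrite /bd_edge inE cards2 va /=; apply/andP; split.
  by apply/existsP; exists t; rewrite tF subset2 vt.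
apply/cards1P; exists t; apply/finset.setP => t'; rewrite !inE subset2.
apply/idP/eqP => [/and3P[tF' vt' ta']|->]; last by rewrite tF vt ta.
apply/eqP/negPn/negP => nt.
have /negP[] := npred (nx t' v); apply/existsP; exists t'; rewrite tF' vt' eqxx /=.
have [h|h] := orient_face F3 O tF' vt' ta' h1.
  have nt' : t != t' by rewrite eq_sym.
  have := proj2 O _ _ _ _ tF tF' nt' vt ta vt' ta' va E => h'.
  by have [_ _] := proj1 O _ _ tF' vt'; rewrite h h' h => /eqP; rewrite (negPf h1).
by have [_ _ E3] := proj1 O _ _ tF' ta'; rewrite -[X in _ == X]E3 h.
Qed.

(** The vertices reachable from a along arcs are closed under undirected link adjacency, since
    predecessors are unique and a has none. As the link is connected, a' is reachable, and having no
    predecessor it equals a. *)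
Lemma bd_out_unique (V : finType) (F : {set {set V}}) (nx : {set V} -> V -> V) (v a a' : V) :
  (forall t, t \in F -> #|t| = 3%N) -> coherent_orientation F nx ->
  (forall v a b, a \in link_verts F v -> b \in link_verts F v -> connect (link_rel F v) a b) ->
  (v, a) \in bd_out F nx -> (v, a') \in bd_out F nx -> a = a'.
Proof.
move=> F3 O conn ha ha'.
have inL x : (v, x) \in bd_out F nx -> x \in link_verts F v.
  rewrite !inE /= => /andP[_ /existsP[t /and5P[tF vt xt vx _]]].
  by rewrite eq_sym vx; apply/existsP; exists t; rewrite tF vt.
have h : connect (oriented_arc F nx v) a a'.
  apply: (connect_closed (P := fun y => connect (oriented_arc F nx v) a y) _
            (conn v a a' (inL _ ha) (inL _ ha'))); last exact: connect0.
  move=> b c ab /(link_rel_arc F3 O)[bc|cb]; first exact: connect_trans (connect1 bc).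
  have [E|[d ad db]] := connect_pred ab.
    by have := bd_out_no_pred c O ha; rewrite -E cb.
  by rewrite (oriented_arc_inj O cb db).
have [->//|[d _ da']] := connect_pred h.
by have := bd_out_no_pred d O ha'; rewrite da'.
Qed.

(** If the given boundary edge runs towards v, its other end a has no successor in the link. Were
    every link vertex to have a predecessor, choosing predecessors would be an injective self-map of
    the finite link, hence onto, and a would precede something. *)
Lemma bd_out_exists (V : finType) (F : {set {set V}}) (nx : {set V} -> V -> V) (v : V) :
  (forall t, t \in F -> #|t| = 3%N) -> coherent_orientation F nx ->
  bd_vertex F v -> exists a, (v, a) \in bd_out F nx.
Proof.
move=> F3 O /existsP[e /and3P[eE bd ve]].
have [a [va Ee]] : exists a, v != a /\ e = [set v; a].
  move: eE ve; rewrite inE => /andP[/cards2P[x [y [xy ->]]] _].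
  rewrite !inE => /orP[/eqP ->|/eqP ->]; first by exists y.
  by exists x; rewrite eq_sym finset.setUC.
have [t [tF vt ta]] : exists t, [/\ t \in F, v \in t & a \in t].
  move: eE; rewrite Ee inE => /andP[_ /existsP[t /andP[tF]]]; rewrite subset2 => /andP[vt ta].
  by exists t.
have av : a != v by rewrite eq_sym.
rewrite Ee in bd.
have [E|E] := orient_face F3 O tF vt ta av.
  by exists a; rewrite inE /= bd; apply/existsP; exists t; rewrite tF vt ta va E eqxx.
have nosucc b : ~~ oriented_arc F nx v a b.
  apply/negP => /(oriented_arc_edges O)[t' tF' [[vt' ta' bt' E1 [E2 _]] [h1 h2 h3]]].
  have Et : t = t' by apply: (face_eq_bd bd); rewrite ?subset2 ?vt ?vt'.
  by move: h3; rewrite -E2 -Et E eqxx.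
have aL : a \in link_verts F v.
  by rewrite inE av; apply/existsP; exists t; rewrite tF vt.
apply: contrapT => /forallNP none.
have pred b : b \in link_verts F v -> exists d, oriented_arc F nx v d b.
  move=> bL; apply: contrapT => /forallNP np.
  by apply: (none b); apply: no_pred_bd_out => // d; apply/negP/np.
pose p b := odflt b [pick d | oriented_arc F nx v d b].
have pP b : b \in link_verts F v -> oriented_arc F nx v (p b) b.
  move=> /pred[d hd]; rewrite /p; case: pickP => [//|] /(_ d) /=; by rewrite hd.
have pinj : {in link_verts F v &, injective p}.
  move=> b c /pP hb /pP hc E2; rewrite E2 in hb; exact: (oriented_arc_fun O hb hc).
have : p @: link_verts F v = link_verts F v.
  apply/eqP; rewrite eqEcard card_in_imset// leqnn andbT.
  by apply/fintype.subsetP => _ /imsetP[b /pP hb ->]; have [] := arc_link O hb.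
move/finset.setP => /(_ a); rewrite aL => /imsetP[b /pP hb E2].
by have := nosucc b; rewrite E2 hb.
Qed.

(** The boundary has Euler characteristic 0. Outgoing boundary edges biject with boundary edges,
    which carry one induced direction, and with boundary vertices, from which exactly one issues. *)
Lemma card_bd (V : finType) (F : {set {set V}}) : surface_triangulation F ->
  #|[set e in tri_edges F | bd_edge F e]| = #|[set v | bd_vertex F v]|.
Proof.
move=> [F3 [_ [_ [conn [_ [nx O]]]]]].
transitivity #|bd_out F nx|.
  have -> : [set e in tri_edges F | bd_edge F e] = [set [set p.1; p.2] | p in bd_out F nx].
    apply/finset.setP => e; rewrite inE; apply/idP/imsetP => [/andP[eE bd]|[[x y]]]; last first.
      by rewrite inE /= => /andP[bd _] ->; rewrite bd; case/andP: bd => ->.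
    move: eE bd; rewrite inE => /andP[/cards2P[x [y [xy ->]]] /existsP[t /andP[tF]]].
    rewrite subset2 => /andP[xt yt] bd; have yx : y != x by rewrite eq_sym.
    have [E|E] := orient_face F3 O tF xt yt yx.
      by exists (x, y) => //; rewrite inE bd; apply/existsP; exists t; rewrite /= tF xt yt xy E eqxx.
    exists (y, x); last by rewrite finset.setUC.
    by rewrite inE /= finset.setUC bd; apply/existsP; exists t; rewrite /= tF xt yt yx E eqxx.
  apply: card_in_imset => -[x y] [x' y'] /=; rewrite !inE /=.
  move=> /andP[bd /existsP[t /and5P[tF xt yt xy /eqP E]]].
  move=> /andP[bd' /existsP[t' /and5P[tF' xt' yt' xy' /eqP E']]] Es.
  have : x' \in [set x; y] by rewrite Es !inE eqxx.
  have : y' \in [set x; y] by rewrite Es !inE eqxx orbT.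
  rewrite !inE => /orP[]/eqP ey /orP[]/eqP ex; rewrite ex ey in xt' yt' xy' E' * => //;
    try by rewrite eqxx in xy'.
  have Et : t = t' by apply: (face_eq_bd bd); rewrite ?subset2 ?xt ?yt ?xt' ?yt'.
  rewrite -Et in E'; have [_ _] := proj1 O _ _ tF xt; rewrite E E' E => yx.
  by rewrite yx eqxx in xy.
have -> : [set v | bd_vertex F v] = [set p.1 | p in bd_out F nx].
  apply/finset.setP => v; rewrite inE; apply/idP/imsetP => [/(bd_out_exists F3 O)[a ha]|[[x y]]].
    by exists (v, a).
  rewrite inE /= => /andP[bd _] ->; apply/existsP; exists [set x; y].
  by move: (bd) => /andP[-> _]; rewrite bd !inE eqxx.
symmetry; apply: card_in_imset => -[x y] [x' y'] h h' /= E; subst x'.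
by rewrite (bd_out_unique F3 O conn h h').
Qed.

(** * Total curvature of a set of vertices *)

Lemma tri_sum_cyc (R : realType) (V : finType) (F : {set {set V}}) (f : V -> V -> V -> R) :
  tri_sum F (fun v a b => f v a b + f a b v + f b v a) = 3 * tri_sum F f.
Proof.
rewrite 2!tri_sumD (tri_sum_rot F f) -(tri_sum_rot F (fun v a b => f b v a)) /=; ring.
Qed.

Definition ind (R : realType) (V : finType) (A : {set V}) (v : V) : R := (v \in A)%:R.

(* Contribution of one triangle, with corner angles th, to the curvature of A
   minus the lower bound; the first group is nonzero when exactly one corner
   lies in A, the second when at least two do. *)
Definition tri_defect (R : realType) (V : finType) (Theta : {set V} -> R) (th : V -> V -> V -> R)
    (A : {set V}) (v a b : V) : R :=
  let i := ind R A in
  (i v * (1 - i a) * (1 - i b) * (pi - Theta [set a; b]) +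
   i a * (1 - i b) * (1 - i v) * (pi - Theta [set b; v]) +
   i b * (1 - i v) * (1 - i a) * (pi - Theta [set v; a])) +
  pi * (i v * i a + i a * i b + i b * i v - 2 * (i v * i a * i b)) -
  (i v * th v a b + i a * th a b v + i b * th b v a).

Lemma disjoint2 (V : finType) (A : {set V}) (a b : V) :
  [disjoint [set a; b] & A] = (a \notin A) && (b \notin A).
Proof.
by rewrite finset.disjoints_subset finset.subUset !finset.sub1set !inE.
Qed.

Lemma disjoint3 (V : finType) (A : {set V}) (v a b : V) :
  [disjoint [set v; a; b] & A] = [&& v \notin A, a \notin A & b \notin A].
Proof.
by rewrite finset.disjoints_subset !finset.subUset !finset.sub1set !inE andbA.
Qed.

Lemma sum_curvature (R : realType) (V : finType) (F : {set {set V}}) (Theta : {set V} -> R)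
    (r : V -> R) (A : {set V}) :
  \sum_(v in A) curvature F Theta r v =
  2 * pi * #|[set v in A | ~~ bd_vertex F v]|%:R + pi * #|[set v in A | bd_vertex F v]|%:R
   - 2^-1 * tri_sum F (fun v a b => ind R A v * tri_angle Theta r v a b).
Proof.
rewrite /curvature sumrB; congr (_ - _).
  rewrite (bigID (bd_vertex F)) /= addrC; congr (_ + _).
    rewrite (eq_bigr (fun=> 2 * pi)); last by move=> v /andP[_ /negPf ->].
    by rewrite sumr_const -[LHS]mulr_natr; congr (_ * _%:R); apply: eq_card => v; rewrite inE.
  rewrite (eq_bigr (fun=> pi)); last by move=> v /andP[_ ->].
  by rewrite sumr_const -[LHS]mulr_natr; congr (_ * _%:R); apply: eq_card => v; rewrite inE.
rewrite /cone_angle -mulr_sumr /tri_sum; congr (_ * _).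
rewrite big_mkcond; apply: eq_bigr => v _; rewrite /ind; case: (v \in A).
  by apply: eq_bigr => a _; apply: eq_bigr => b _; rewrite mul1r.
by rewrite big1// => a _; rewrite big1// => b _; rewrite mul0r.
Qed.

Lemma Lk_sum_tri (R : realType) (V : finType) (F : {set {set V}}) (Theta : {set V} -> R)
    (A : {set V}) : (forall t, t \in F -> #|t| = 3%N) ->
  tri_sum F (fun v a b => ind R A v * (1 - ind R A a) * (1 - ind R A b) * (pi - Theta [set a; b]))
  = 2 * Lk_sum F Theta A.
Proof.
move=> F3; pose g (e : {set V}) (v : V) : R := (v \in A)%:R * [disjoint e & A]%:R * (pi - Theta e).
transitivity (tri_sum F (fun v a b => g [set a; b] v)).
  apply: eq_tri_sum => v a b _; rewrite /g disjoint2 /ind.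
  by case: (v \in A); case: (a \in A); case: (b \in A); rewrite /=; ring.
rewrite tri_sum_edges//; congr (_ * _); rewrite /Lk_sum big_mkcondr /=.
apply: eq_bigr => e _; rewrite /g; case: [disjoint e & A] => /=; last first.
  by rewrite big1// => v _; rewrite mulr0 mul0r.
rewrite [RHS]big_mkcondl /=; apply: eq_bigr => v _.
by case: (v \in A); rewrite ?mul0r// !mul1r.
Qed.

Lemma card_faces_at (V : finType) (F : {set {set V}}) (e : {set V}) :
  (forall t, t \in F -> #|t| = 3%N) -> (#|e| == 2)%N ->
  #|faces_at F e| = #|[set v | v |: e \in F]|.
Proof.
move=> F3 /eqP e2.
have nin v : v |: e \in F -> v \notin e.
  by move=> /F3; rewrite cardsU1 e2; case: (v \in e).
have -> : faces_at F e = (fun v => v |: e) @: [set v | v |: e \in F].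
  apply/finset.setP => t; rewrite inE; apply/andP/imsetP => [[tF et]|[v]]; last first.
    by rewrite inE => vF ->; rewrite vF finset.subsetUr.
  have : #|t :\: e| = 1%N by rewrite cardsD (finset.setIidPr et) e2 (F3 _ tF).
  move/eqP/cards1P => [v Ev]; have Et : t = v |: e.
    by rewrite -Ev finset.setUC; apply/finset.setP => x; rewrite !inE;
       case: (boolP (x \in e)) => //= /(fintype.subsetP et) ->.
  by exists v => //; rewrite inE -Et.
apply: card_in_imset => v w; rewrite !inE => /nin ve /nin we E.
have : v \in w |: e by rewrite -E !inE eqxx.
by rewrite !inE (negPf ve) orbF => /eqP.
Qed.

(** An edge occurs in two orders in each of its triangles: four times if interior, twice on the
    boundary. *)
Lemma edges_meeting (R : realType) (V : finType) (F : {set {set V}}) (A : {set V}) :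
  (forall t, t \in F -> #|t| = 3%N) ->
  (forall e, e \in tri_edges F -> (#|faces_at F e| == 1)%N || (#|faces_at F e| == 2)%N) ->
  tri_sum F (fun v a b => 1 - (1 - ind R A a) * (1 - ind R A b)) =
  4 * #|[set e in tri_edges F | ~~ bd_edge F e & ~~ [disjoint e & A]]|%:R
  + 2 * #|[set e in tri_edges F | bd_edge F e & ~~ [disjoint e & A]]|%:R.
Proof.
move=> F3 F12; pose g (e : {set V}) (v : V) : R := (~~ [disjoint e & A])%:R.
transitivity (tri_sum F (fun v a b => g [set a; b] v)).
  apply: eq_tri_sum => v a b _; rewrite /g disjoint2 /ind.
  by case: (a \in A); case: (b \in A); rewrite /=; ring.
rewrite tri_sum_edges//.
have cardE (P : pred {set V}) : #|[set e in tri_edges F | P e]|%:R =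
    \sum_(e in tri_edges F) (P e)%:R :> R.
  rewrite -sum1_card natr_sum big_mkcond [RHS]big_mkcond; apply: eq_bigr => e _.
  by rewrite inE; case: (e \in _) => //=; case: (P e).
rewrite !cardE (_ : 4 = 2 * 2); last by ring.
rewrite -mulrA -mulrDr; congr (_ * _); rewrite mulr_sumr -big_split /=.
apply: eq_bigr => e eE; rewrite /g sumr_const.
have e2 : (#|e| == 2)%N by move: eE; rewrite inE => /andP[].
have -> : #|[pred v | v |: e \in F]| = #|faces_at F e|.
  by rewrite (card_faces_at F3 e2); apply: eq_card => v; rewrite inE.
rewrite /bd_edge eE /=; move: (F12 e eE); case: [disjoint e & A] => /=.
  by rewrite mul0rn !andbF mulr0 addr0.
rewrite !andbT; case: eqP => [-> _|_ /= /eqP ->] /=; first by rewrite mulr0 add0r.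
by rewrite mulr1 addr0.
Qed.

Lemma faces_meeting (R : realType) (V : finType) (F : {set {set V}}) (A : {set V}) :
  (forall t, t \in F -> #|t| = 3%N) ->
  tri_sum F (fun v a b => 1 - (1 - ind R A v) * (1 - ind R A a) * (1 - ind R A b)) =
  6 * #|[set t in F | ~~ [disjoint t & A]]|%:R.
Proof.
move=> F3; transitivity (tri_sum F (fun v a b => (~~ [disjoint [set v; a; b] & A])%:R : R)).
  apply: eq_tri_sum => v a b _; rewrite disjoint3 /ind.
  by case: (v \in A); case: (a \in A); case: (b \in A); rewrite /=; ring.
rewrite (tri_sum_faces (fun t => (~~ [disjoint t & A])%:R))//; congr (_ * _).
rewrite -sum1_card natr_sum big_mkcond [RHS]big_mkcond; apply: eq_bigr => t _.
by rewrite inE; case: (t \in F) => //=; case: [disjoint t & A].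
Qed.

Lemma curvature_defect (R : realType) (V : finType) (F : {set {set V}}) (Theta : {set V} -> R)
    (r : V -> R) (A : {set V}) :
  (forall t, t \in F -> #|t| = 3%N) ->
  (forall e, e \in tri_edges F -> (#|faces_at F e| == 1)%N || (#|faces_at F e| == 2)%N) ->
  \sum_(v in A) curvature F Theta r v =
  - Lk_sum F Theta A + 2 * pi * chi_GA_int R F A + pi * chi_GA_bd R F A +
  6^-1 * tri_sum F (tri_defect Theta (tri_angle Theta r) A).
Proof.
move=> F3 F12; rewrite sum_curvature.
have EL := Lk_sum_tri Theta A F3; have EE := @edges_meeting R V F A F3 F12.
have EF := @faces_meeting R V F A F3.
set T1 := tri_sum F (fun v a b => ind R A v * tri_angle Theta r v a b).
(* A representative of [tri_defect] before cyclic symmetrization. Its four coefficients are chosen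
   so that one sixth of its sum cancels, in turn, the angles, the link sum, the edges and the
   triangles in the two Euler characteristics. *)
pose g v a b := - 3 * (ind R A v * tri_angle Theta r v a b)
  + 3 * (ind R A v * (1 - ind R A a) * (1 - ind R A b) * (pi - Theta [set a; b]))
  + (3 * pi) * (1 - (1 - ind R A a) * (1 - ind R A b))
  + (- 2 * pi) * (1 - (1 - ind R A v) * (1 - ind R A a) * (1 - ind R A b)).
have Eg : tri_sum F g = - 3 * T1 + 3 * (2 * Lk_sum F Theta A) + (3 * pi) *
    (4 * #|[set e in tri_edges F | ~~ bd_edge F e & ~~ [disjoint e & A]]|%:R
  + 2 * #|[set e in tri_edges F | bd_edge F e & ~~ [disjoint e & A]]|%:R)
    + (- 2 * pi) * (6 * #|[set t in F | ~~ [disjoint t & A]]|%:R).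
  by rewrite /g 3!tri_sumD 4!tri_sumZ EL EE EF.
have -> : tri_sum F (tri_defect Theta (tri_angle Theta r) A) = tri_sum F g.
  have : 3 * tri_sum F (tri_defect Theta (tri_angle Theta r) A) = 3 * tri_sum F g.
    rewrite -(tri_sum_cyc F g) -tri_sumZ; apply: eq_tri_sum => v a b _.
    by rewrite /g /tri_defect /=; ring.
  by move=> h; lra.
rewrite Eg /chi_GA_int /chi_GA_bd; by field.
Qed.

(** * Ordinary differential equations *)

Local Open Scope classical_set_scope.

Lemma ultra_bounded_cvg (R : realType) (U : set_system nat) (f : nat -> R) (a b : R) :
  UltraFilter U -> (forall n, a <= f n <= b) -> exists l : R, f @ U --> l.
Proof.
move=> UU fab; have PU : ProperFilter U by exact: ultra_proper.
have [|p [_ cp]] := @segment_compact R a b (fmap f U) (fmap_proper_filter f PU).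
  by apply: (@filterE _ U) => n; rewrite /preimage/= in_itv/=; exact: fab.
exists p => B Bp; have [//|h] := in_ultra_setVsetC (f @^-1` B) UU.
by have [x [/= nx Bx]] := cp (~` B) B h Bp.
Qed.

Fixpoint euler (R : realType) (V : finType) (G : (V -> R) -> V -> R) (u0 : V -> R) (h : R)
    (k : nat) : V -> R :=
  if k is k'.+1 then fun i => euler G u0 h k' i + h * G (euler G u0 h k') i else u0.

Lemma euler_lip (R : realType) (V : finType) (G : (V -> R) -> V -> R) (u0 : V -> R) (h M : R)
    (j m : nat) i : 0 <= h -> (forall u i, `|G u i| <= M) ->
  `|euler G u0 h (j + m) i - euler G u0 h j i| <= m%:R * (h * M).
Proof.
move=> h0 GM; elim: m => [|m IH]; first by rewrite addn0 subrr normr0 mul0r.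
rewrite addnS /= addrAC (le_trans (ler_normD _ _))// -natr1 mulrDl mul1r lerD//.
by rewrite normrM ger0_norm// ler_wpM2l.
Qed.

Lemma euler_drift (R : realType) (V : finType) (G : (V -> R) -> V -> R) (u0 v : V -> R) (h e : R)
    (j m : nat) i : 0 <= h ->
  (forall k, (j <= k < j + m)%N -> `|G (euler G u0 h k) i - v i| <= e) ->
  `|euler G u0 h (j + m) i - euler G u0 h j i - m%:R * (h * v i)| <= m%:R * (h * e).
Proof.
move=> h0; elim: m => [|m IH] He; first by rewrite addn0 subrr !mul0r subrr normr0.
rewrite addnS /=.
have -> : euler G u0 h (j + m) i + h * G (euler G u0 h (j + m)) i - euler G u0 h j i -
    m.+1%:R * (h * v i) = (euler G u0 h (j + m) i - euler G u0 h j i - m%:R * (h * v i)) +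
    h * (G (euler G u0 h (j + m)) i - v i) by rewrite -natr1; ring.
rewrite (le_trans (ler_normD _ _))// -natr1 mulrDl mul1r lerD//.
  by apply: IH => k /andP[jk km]; apply: He; rewrite jk /= addnS ltnS ltnW.
by rewrite normrM ger0_norm// ler_wpM2l// He// leq_addr addnS /=.
Qed.

Lemma is_derive_of_le (R : realType) (f : R -> R) (t df : R) :
  (forall e, 0 < e -> exists2 d : R, 0 < d & forall s, `|s - t| < d ->
    `|f s - f t - (s - t) * df| <= e * `|s - t|) -> is_derive t 1 f df.
Proof.
move=> H.
have C : (fun h : R => h^-1 *: ((f \o shift t) (h *: (1 : R)) - f t)) @ 0^' --> df.
  apply/cvgrPdist_le => e e0; have [d d0 hd] := H e e0.
  near=> h; have h0 : h != 0 by near: h; exact: nbhs_dnbhs_neq.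
  have hd' : `|h| < d by near: h; apply: dnbhs0_lt.
  rewrite /= /GRing.scale/= mulr1.
  have := hd (h + t); rewrite addrK => /(_ hd') hh.
  have -> : df - h^-1 * (f (h + t) - f t) = - (h^-1 * (f (h + t) - f t - h * df)).
    by field.
  by rewrite normrN normrM normfV mulrC ler_pdivrMr ?normr_gt0.
split; first exact: (cvgP _ C).
by apply: cvg_lim.
Unshelve. all: by end_near.
Qed.

Lemma truncn_grid_cvg (R : realType) (t : R) : 0 <= t ->
  (fun n : nat => (Num.truncn (t * n.+1%:R))%:R * n.+1%:R^-1) @ \oo --> t.
Proof.
move=> t0; apply/cvgrPdist_le => e e0; near=> n.
have n0 : 0 < n.+1%:R :> R by rewrite ltr0n.
have hn : n.+1%:R^-1 <= e.
  rewrite invf_ple ?posrE//; near: n; exists (Num.truncn e^-1) => //= n /= hn.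
  have := truncnS_gt e^-1 => /ltW/le_trans; apply; by rewrite ler_nat ltnS.
have /andP[h1 h2] := truncn_itv (mulr_ge0 t0 (ltW n0)).
have h3 : (Num.truncn (t * n.+1%:R))%:R / n.+1%:R <= t by rewrite ler_pdivrMr.
rewrite ger0_norm ?subr_ge0//; apply: le_trans hn.
rewrite lerBlDr -[X in _ <= X + _]mul1r -mulrDl ler_pdivlMr// addrC natr1.
exact: ltW.
Unshelve. all: by end_near.
Qed.

(* Peano's theorem: the Euler step functions are pointwise bounded, so they
   converge along any free ultrafilter on nat; the limit inherits the Euler
   estimate, which gives its derivative. *)
Theorem peano_global (R : realType) (V : finType) (G : (V -> R) -> V -> R) (M : R) (u0 : V -> R) :
  (forall u i, `|G u i| <= M) ->
  (forall u e, 0 < e -> exists2 d : R, 0 < d & forall u', (forall i, `|u' i - u i| < d) ->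
     forall i, `|G u' i - G u i| < e) ->
  exists u : R -> V -> R, [/\ u 0 = u0,
    forall s t, 0 <= s -> s <= t -> forall i, `|u t i - u s i| <= M * (t - s) &
    forall t : R, 0 < t -> forall i, is_derive t (1 : R) (fun s => u s i) (G (u t) i)].
Proof.
move=> GM Gc.
(* The bound on G gives 0 <= M only if there is a coordinate. *)
have [[i0 _]|Vn] := pselect (exists i : V, True); last first.
  exists (fun=> u0); split => // [s t _ _ i|t _ i]; by case: Vn; exists i.
have M0 : 0 <= M by apply: le_trans (GM u0 i0).
have [U [UU oU]] := @ultraFilterLemma _ (\oo : set_system nat) _.
have PU : ProperFilter U by exact: ultra_proper.
pose h (n : nat) : R := n.+1%:R^-1.
have h0 n : 0 < h n by rewrite invr_gt0 ltr0n.
(* The last grid node not after t: K h <= t < K h + h. *)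
pose K t n := Num.truncn (t * n.+1%:R : R).
pose y t n := euler G u0 (h n) (K t n).
have Kle t n : 0 <= t -> (K t n)%:R * h n <= t.
  move=> t0; rewrite ler_pdivrMr ?ltr0n//.
  by have /andP[] := truncn_itv (mulr_ge0 t0 (ler0n R n.+1)).
have Kge t n : 0 <= t -> t < (K t n)%:R * h n + h n.
  move=> t0; rewrite -{2}[h n]mul1r -mulrDl ltr_pdivlMr ?ltr0n// natr1.
  by have /andP[] := truncn_itv (mulr_ge0 t0 (ler0n R n.+1)).
have Kmono s t n : 0 <= s -> s <= t -> (K s n <= K t n)%N.
  move=> s0 st; rewrite -ltnS -(ltr_nat R).
  have := Kle s n s0; have := Kge t n (le_trans s0 st) => h1 h2.
  have : (K s n)%:R * h n < (K t n).+1%:R * h n by rewrite -natr1 mulrDl mul1r; lra.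
  by rewrite ltr_pM2r.
have Kcvg t : 0 <= t -> (fun n => (K t n)%:R * h n) @ U --> t.
  by move=> t0 B /(truncn_grid_cvg t0) /oU.
have ylip s t n i : 0 <= s -> s <= t -> `|y t n i - y s n i| <= ((K t n)%:R * h n - (K s n)%:R * h n) * M.
  move=> s0 st; rewrite /y -(subnKC (Kmono _ _ n s0 st)).
  rewrite (le_trans (euler_lip _ _ _ _ (ltW (h0 n)) GM))//.
  by rewrite -mulrBl -natrB ?leq_addr// addKn mulrA.
have ex t i : exists l : R, 0 <= t -> (fun n => y t n i) @ U --> l.
  have [t0|] := leP 0 t; last by exists 0.
  have [|l hl] := @ultra_bounded_cvg R U (fun n => y t n i) (u0 i - t * M) (u0 i + t * M) UU.
    move=> n; have := ylip 0 t n i (lexx 0) t0.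
    have K0 : K 0 n = 0%N by rewrite /K mul0r truncn0.
    have y0 : y 0 n i = u0 i by rewrite /y K0.
    rewrite K0 y0 mul0r subr0 ler_norml => /andP[a1 a2].
    have a3 : (K t n)%:R * h n * M <= t * M by rewrite ler_wpM2r// Kle.
    by apply/andP; split; lra.
  by exists l.
pose u t i : R := projT1 (cid (ex t i)).
have uP t i : 0 <= t -> (fun n => y t n i) @ U --> u t i.
  by move=> t0; rewrite /u; case: cid => l /= /(_ t0).
exists u; split.
- apply/funext => i; have := uP 0 i (lexx 0).
  have -> : (fun n => y 0 n i) = (fun=> u0 i).
    by apply/funext => n; rewrite /y /K mul0r truncn0.
  by move=> /norm_cvg_unique; apply; exact: cvg_cst.
- move=> s t s0 st i; have t0 := le_trans s0 st.
  refine (@ler_cvg_to _ U _ R (fun n => `|y t n i - y s n i|)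
    (fun n => ((K t n)%:R * h n - (K s n)%:R * h n) * M) _ _ _ _ _).
  + by apply: cvg_norm; apply: cvgB; exact: uP.
  + rewrite mulrC; apply: cvgM; last exact: cvg_cst.
    by apply: cvgB; exact: Kcvg.
  + by apply: filterE => n; exact: ylip.
move=> t t0 i; apply: is_derive_of_le => e e0.
have [d d0 Gd] := Gc (u t) e e0.
(* Within eta of t an Euler path moves by at most (eta + h) M, which is at most d/2 for large n.
   Together with the distance d/2 of y t n from u t, it stays where G varies by less than e. *)
pose eta := Num.min t (d / (4 * (M + 1))).
have eta0 : 0 < eta by rewrite lt_min t0 divr_gt0// mulr_gt0// ltr_wpDl.
have etat : eta <= t by rewrite ge_min lexx.
have etad : 4 * (eta * M) <= d.
  have : eta * (4 * (M + 1)) <= d.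
    by rewrite -ler_pdivlMr ?ge_min ?lexx ?orbT// mulr_gt0// ltr_wpDl.
  lra.
have key a b : t - eta <= a -> a <= b -> b <= t + eta -> a <= t -> t <= b ->
    `|u b i - u a i - (b - a) * G (u t) i| <= (b - a) * e.
  move=> ha ab hb hat htb; have a0 : 0 <= a by lra.
  have b0 : 0 <= b by lra.
  refine (@ler_cvg_to _ U _ R
    (fun n => `|y b n i - y a n i - ((K b n)%:R * h n - (K a n)%:R * h n) * G (u t) i|)
    (fun n => ((K b n)%:R * h n - (K a n)%:R * h n) * e) _ _ _ _ _).
  - apply: cvg_norm; apply: cvgB; first by apply: cvgB; exact: uP.
    by apply: cvgM; [apply: cvgB; exact: Kcvg | exact: cvg_cst].
  - by apply: cvgM; [apply: cvgB; exact: Kcvg | exact: cvg_cst].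
  have d20 : 0 < d / 2 by rewrite divr_gt0.
  have near1 : \forall n \near U, forall j, `|u t j - y t n j| < d / 2.
    apply: filter_forall => j.
    by have /cvgrPdist_lt/(_ _ d20) := uP t j (ltW t0).
  have near2 : \forall n \near U, h n * M < d / 4.
    have M10 : 0 < M + 1 by rewrite ltr_wpDl.
    apply: oU; near=> n.
    have : h n < d / 4 / (M + 1).
      rewrite /h invf_plt ?posrE ?divr_gt0//; near: n.
      exists (Num.truncn (d / 4 / (M + 1))^-1) => //= n hn.
      by apply: lt_le_trans (truncnS_gt _) _; rewrite ler_nat ltnS.
    rewrite ltr_pdivlMr// mulrDr mulr1; have := h0 n; lra.
  near=> n.
  have n1 : forall j, `|u t j - y t n j| < d / 2 by near: n.
  have n2 : h n * M < d / 4 by near: n.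
  rewrite -mulrBl -natrB ?Kmono// -!mulrA /y -{1}(subnKC (Kmono _ _ n a0 ab)).
  apply: euler_drift; first exact: ltW.
  move=> k; rewrite subnKC ?Kmono// => /andP[k1 k2]; apply: ltW; apply: Gd => j.
  rewrite -(subrK (y t n j) (euler _ _ _ _ j)) -addrA (le_lt_trans (ler_normD _ _))//.
  have n1' := n1 j; rewrite distrC in n1'.
  suff : `|euler G u0 (h n) k j - y t n j| <= d / 2 by lra.
  apply: (@le_trans _ _ (eta * M + h n * M)); last by lra.
  have ht1 := Kle t n (ltW t0); have ht2 := Kge t n (ltW t0).
  have hb1 := Kle b n b0; have ha2 := Kge a n a0.
  rewrite -mulrDl.
  have [kt|tk] := leqP k (K t n).
    rewrite /y distrC -(subnKC kt) (le_trans (euler_lip _ _ _ _ (ltW (h0 n)) GM))//.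
    rewrite mulrA ler_wpM2r// natrB// mulrBl.
    have : (K a n)%:R * h n <= k%:R * h n by rewrite ler_pM2r// ler_nat.
    lra.
  rewrite /y -(subnKC (ltnW tk)) (le_trans (euler_lip _ _ _ _ (ltW (h0 n)) GM))//.
  rewrite mulrA ler_wpM2r// natrB ?(ltnW tk)// mulrBl.
  have : k%:R * h n <= (K b n)%:R * h n by rewrite ler_pM2r// ler_nat ltnW.
  lra.
exists eta => // s st; have := st; rewrite ltr_norml => /andP[s1 s2].
have [ts|ts] := leP t s.
  rewrite (ger0_norm (_ : 0 <= s - t)) ?subr_ge0// (mulrC e); apply: key; lra.
rewrite (ltr0_norm (_ : s - t < 0)) ?subr_lt0// opprB (mulrC e).
have -> : u s i - u t i - (s - t) * G (u t) i = - (u t i - u s i - (t - s) * G (u t) i) by ring.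
rewrite normrN; apply: key; lra.
Unshelve. all: by end_near.
Qed.

(** * Contraction, limits and barriers for trajectories *)

Definition trajectory (R : realType) (V : finType) (G : (V -> R) -> V -> R) (u : R -> V -> R) :=
  (forall i, (fun s => u s i) @ at_right (0 : R) --> u 0 i) /\
  (forall t : R, 0 < t -> forall i, is_derive t (1 : R) (fun s => u s i) (G (u t) i)).

(** Coordinatewise continuity along arbitrary filters, so that it applies directly to sequences and
    to t tending to +oo. *)
Definition filter_continuous (R : realType) (V : finType) (G : (V -> R) -> V -> R) :=
  forall (T : Type) (F : set_system T), Filter F -> forall (f : T -> V -> R) (u : V -> R),
    (forall i, (fun t => f t i) @ F --> u i) -> forall i, (fun t => G (f t) i) @ F --> G u i.

Lemma filter_continuous_eps (R : realType) (V : finType) (G : (V -> R) -> V -> R) :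
  filter_continuous G ->
  forall u e, 0 < e -> exists2 d : R, 0 < d & forall u', (forall i, `|u' i - u i| < d) ->
     forall i, `|G u' i - G u i| < e.
Proof.
move=> Gc u e e0; apply: contrapT => H.
have bad (n : nat) : exists u', (forall i, `|u' i - u i| < n.+1%:R^-1) /\
    exists i, e <= `|G u' i - G u i|.
  apply: contrapT => H2; apply: H; exists n.+1%:R^-1; first by rewrite invr_gt0 ltr0n.
  move=> u' hu' i; rewrite ltNge; apply/negP => hi; apply: H2; exists u'; split => //.
  by exists i.
pose f n := projT1 (cid (bad n)).
have fP n : (forall i, `|f n i - u i| < n.+1%:R^-1) /\ exists i, e <= `|G (f n) i - G u i|.
  by rewrite /f; case: cid.
have cf i : (fun n => f n i) @ \oo --> u i.
  apply/cvgrPdist_lt => d d0; near=> n; rewrite distrC.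
  have [/(_ i) h _] := fP n; apply: lt_trans h _.
  rewrite invf_plt ?posrE//; near: n; exists (Num.truncn d^-1) => //= n hn.
  by apply: lt_le_trans (truncnS_gt _) _; rewrite ler_nat ltnS.
have : \forall n \near \oo, forall i, `|G u i - G (f n) i| < e.
  apply: filter_forall => i.
  have h : (fun n => G (f n) i) @ \oo --> G u i by exact: Gc.
  by move/cvgrPdist_lt : h; exact.
case=> N _ /(_ N (leqnn N)) /= hN.
by have [_ [i]] := fP N; rewrite leNgt distrC hN.
Unshelve. all: by end_near.
Qed.

Lemma is_derive_bigsum (R : realType) (I : Type) (r : seq I) (f : I -> R -> R) (df : I -> R) (s : R) :
  (forall i, is_derive s (1 : R) (f i) (df i)) ->
  is_derive s (1 : R) (fun t => \sum_(i <- r) f i t) (\sum_(i <- r) df i).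
Proof.
move=> h; elim: r => [|i r IH].
  under eq_fun do rewrite big_nil; rewrite big_nil; exact: is_derive_const.
under eq_fun do rewrite big_cons; rewrite big_cons; exact: is_derive_add.
Qed.

Lemma cvg_bigsum (R : realType) (T I : Type) (F : set_system T) (FF : Filter F) (r : seq I)
    (f : I -> T -> R) (l : I -> R) :
  (forall i, f i @ F --> l i) ->
  (fun t => \sum_(i <- r) f i t) @ F --> \sum_(i <- r) l i.
Proof.
move=> h; elim: r => [|i r IH].
  under eq_fun do rewrite big_nil; rewrite big_nil; exact: cvg_cst.
under eq_fun do rewrite big_cons; rewrite big_cons; exact: cvgD.
Qed.

Lemma is_derive_continuous_at (R : realType) (f : R -> R) (s df : R) :
  is_derive s (1 : R) f df -> {for s, continuous f}.
Proof.
move=> hf; apply: differentiable_continuous; apply/derivable1_diffP.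
exact: (@ex_derive R R R s 1 f _ hf).
Qed.

Lemma halfline_continuous (R : realType) (f df : R -> R) (a b : R) :
  f @ at_right (0 : R) --> f 0 -> (forall t : R, 0 < t -> is_derive t (1 : R) f (df t)) ->
  0 <= a -> a < b -> {within `[a, b], continuous f}.
Proof.
move=> f0 fd a0 ab; have cont t : 0 < t -> {for t, continuous f}.
  by move=> /fd; exact: is_derive_continuous_at.
apply/continuous_within_itvP => //; split.
- by move=> t; rewrite in_itv/= => /andP[t1 _]; apply: cont; exact: le_lt_trans t1.
- move: a0; rewrite le_eqVlt => /orP[/eqP <-//|a0].
  exact/cvg_at_right_filter/cont.
- exact/cvg_at_left_filter/cont/(le_lt_trans a0).
Qed.

Lemma nonincreasing_of_derive (R : realType) (f df : R -> R) :
  f @ at_right (0 : R) --> f 0 -> (forall t : R, 0 < t -> is_derive t (1 : R) f (df t)) ->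
  (forall t, 0 < t -> df t <= 0) -> forall s t, 0 <= s -> s <= t -> f t <= f s.
Proof.
move=> f0 fd dn s t s0; rewrite le_eqVlt => /orP[/eqP ->//|st].
have [x|c cst E] := MVT st (df := df) (f := f) _ (halfline_continuous f0 fd s0 st).
  by rewrite in_itv/= => /andP[h _]; apply: fd; exact: le_lt_trans h.
rewrite -subr_le0 E mulr_le0_ge0 ?subr_ge0 ?(ltW st)//.
by apply: dn; move: cst; rewrite in_itv/= => /andP[h _]; exact: le_lt_trans h.
Qed.

(** The squared distance multiplied by exp (2 k t) has nonpositive derivative. The sign of k is
    free: k = 0 yields a nonincreasing distance. *)
Lemma trajectory_contract (R : realType) (V : finType) (G : (V -> R) -> V -> R) (u v : R -> V -> R) (k : R) :
  trajectory G u -> trajectory G v ->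
  (forall t, 0 < t -> \sum_i (G (u t) i - G (v t) i) * (u t i - v t i) <=
     - k * \sum_i (u t i - v t i) ^+ 2) ->
  forall t, 0 <= t ->
    \sum_i (u t i - v t i) ^+ 2 <= expR (- (2 * k * t)) * \sum_i (u 0 i - v 0 i) ^+ 2.
Proof.
move=> [u0 ud] [v0 vd] H t t0.
pose f s := expR (2 * k * s) * \sum_i (u s i - v s i) ^+ 2.
pose df s := expR (2 * k * s) * (\sum_i 2 * (u s i - v s i) * (G (u s) i - G (v s) i)) +
  (\sum_i (u s i - v s i) ^+ 2) * (expR (2 * k * s) * (2 * k)).
have dE s : is_derive s (1 : R) (fun x : R => expR (2 * k * x)) (expR (2 * k * s) * (2 * k)).
  have d1 : is_derive s (1 : R) (fun x : R => 2 * k * x) (2 * k).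
    refine (is_derive_conv (is_derive_mul (is_derive_const (2 * k) s) (is_derive_id s (1 : R))) _).
    by rewrite /= mulr0 addr0 mulr1.
  exact: (@is_derive1_comp R expR (fun x : R => 2 * k * x) s _ _ (is_derive_expR _) d1).
have fd (s : R) : 0 < s -> is_derive s (1 : R) f (df s).
  move=> s0; apply: is_derive_mul (dE s) _; apply: is_derive_bigsum => i.
  apply: is_derive_sqr; exact: is_derive_add (ud _ s0 i) (is_derive_opp (vd _ s0 i)).
have f0 : f @ at_right (0 : R) --> f 0.
  apply: cvgM; first exact/cvg_at_right_filter/(is_derive_continuous_at (dE 0)).
  apply: cvg_bigsum => i; rewrite expr2; under eq_fun do rewrite expr2.
  by apply: cvgM; apply: cvgB.
have := nonincreasing_of_derive f0 fd _ (lexx 0) t0.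
rewrite /f mulr0 expR0 mul1r => /(_ _) h.
rewrite expRN -ler_pdivrMl ?invr_gt0 ?expR_gt0// invrK; apply: h => s s0.
have := H s s0; rewrite /df.
have -> : \sum_i 2 * (u s i - v s i) * (G (u s) i - G (v s) i) =
    2 * \sum_i (G (u s) i - G (v s) i) * (u s i - v s i).
  by rewrite mulr_sumr; apply: eq_bigr => i _; ring.
move=> h2; have e0 := expR_gt0 (2 * k * s); set E := expR _ in e0 *.
set A := \sum_i _ in h2 *; set B := \sum_i _ in h2 *.
have -> : E * (2 * A) + B * (E * (2 * k)) = E * (2 * (A + k * B)) by ring.
by rewrite pmulr_rle0// pmulr_rle0//; lra.
Qed.

Lemma trajectory_shift (R : realType) (V : finType) (G : (V -> R) -> V -> R) (u : R -> V -> R) (s : R) :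
  trajectory G u -> 0 <= s -> trajectory G (fun t => u (s + t)).
Proof.
move=> [u0 ud]; rewrite le_eqVlt => /orP[/eqP <-|s0].
  by have -> : (fun t => u (0 + t)) = u by apply/funext => t; rewrite add0r.
have dsh t : is_derive t (1 : R) (fun x : R => s + x) 1.
  refine (is_derive_conv (is_derive_add (is_derive_const s t) (is_derive_id t (1 : R))) _).
  by rewrite /= add0r.
have d (t : R) : 0 <= t -> forall i, is_derive t (1 : R) (fun x => u (s + x) i) (G (u (s + t)) i).
  move=> t0 i; have st0 : 0 < s + t by rewrite ltr_wpDr.
  have := @is_derive1_comp R (fun x => u x i) (fun x : R => s + x) t _ _ (ud _ st0 i) (dsh t).
  by rewrite mulr1.
split=> [i|t /ltW]; last exact: d.
exact/cvg_at_right_filter/(is_derive_continuous_at (d 0 (lexx 0) i)).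
Qed.

Lemma trajectory_const (R : realType) (V : finType) (G : (V -> R) -> V -> R) (p : V -> R) :
  (forall i, G p i = 0) -> trajectory G (fun=> p).
Proof.
move=> Gp; split=> [i|t _ i]; first exact: cvg_cst.
by rewrite Gp; exact: is_derive_const.
Qed.

Lemma sqr_le_sum (R : realType) (V : finType) (f : V -> R) (i : V) : f i ^+ 2 <= \sum_j f j ^+ 2.
Proof. by rewrite (bigD1 i)//= lerDl sumr_ge0// => j _; exact: sqr_ge0. Qed.

Lemma cvg_expRN (R : realType) (k C e : R) : 0 < k -> 0 < e -> 0 <= C ->
  exists2 T, 0 <= T & expR (- (2 * k * T)) * C < e.
Proof.
(* The exponent becomes C / e, and exp (C / e) >= 1 + C / e > C / e. *)
move=> k0 e0 C0; exists (C / (2 * k * e)).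
  by rewrite divr_ge0// ltW// !mulr_gt0.
have -> : 2 * k * (C / (2 * k * e)) = C / e by field; rewrite !gt_eqF.
rewrite expRN -ltr_pdivlMl ?invr_gt0 ?expR_gt0// invrK -ltr_pdivrMr//.
by apply: lt_le_trans (expR_ge1Dx _); rewrite ltrDr.
Qed.

(** The hypothesis is what contraction gives for a bounded trajectory and its own time shift by
    s. *)
Lemma trajectory_cauchy (R : realType) (V : finType) (u : R -> V -> R) (k C : R) :
  0 < k -> 0 <= C ->
  (forall s t, 0 <= s -> 0 <= t -> \sum_i (u (s + t) i - u t i) ^+ 2 <= expR (- (2 * k * t)) * C) ->
  exists L : V -> R, forall i, (fun t => u t i) @ +oo --> L i.
Proof.
move=> k0 C0 H.
suff ex i : exists l : R, (fun t => u t i) @ +oo --> l.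
  by exists (fun i => projT1 (cid (ex i))) => i; case: cid.
have : cauchy ((fun t => u t i) @ +oo).
  apply: cauchy_exP => e e0.
  have [T T0 hT] := cvg_expRN k0 (exprn_gt0 2 e0) C0.
  exists (u T i); exists T; split; first exact: num_real.
  move=> t Tt; rewrite /= /ball/= distrC -(ltr_pXn2r (n := 2)) ?nnegrE ?(ltW e0)//.
  rewrite real_normK ?num_real//; apply: le_lt_trans hT.
  have := H (t - T) T; rewrite subrK subr_ge0 => /(_ (ltW Tt) T0); apply: le_trans.
  exact: (sqr_le_sum (fun i => u t i - u T i)).
by move=> /cauchy_cvgP/cvg_ex[l hl]; exists l.
Qed.

(** Over a unit interval far out, the increment of u is small and equals G at an intermediate time,
    which is close to G L. *)
Lemma limit_equilibrium (R : realType) (V : finType) (G : (V -> R) -> V -> R) (u : R -> V -> R) (L : V -> R) :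
  filter_continuous G -> trajectory G u -> (forall i, (fun t => u t i) @ +oo --> L i) ->
  forall i, G L i = 0.
Proof.
move=> Gc [u0 ud] uL i; apply/eqP/negPn/negP => g0.
have e0 : 0 < `|G L i| / 4 by rewrite divr_gt0// normr_gt0.
set e := _ / 4 in e0.
have Gu : (fun t => G (u t) i) @ +oo --> G L i by exact: Gc.
have [T1 [_ h1]] : \forall t \near +oo, `|G L i - G (u t) i| < e by move/cvgrPdist_lt : Gu; exact.
have [T2 [_ h2]] : \forall t \near +oo, `|L i - u t i| < e.
  by have := uL i; move/cvgrPdist_lt; exact.
pose T := Num.max 0 (Num.max T1 T2) + 1.
have [T0 TT1 TT2] : [/\ 0 < T, T1 < T & T2 < T].
  have : Num.max 0 (Num.max T1 T2) < T by rewrite ltrDl.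
  by rewrite !gt_max => /andP[? /andP[? ?]].
have TS : T < T + 1 by rewrite ltrDl.
have [x|c cT E] := MVT TS (df := fun t => G (u t) i) (f := fun t => u t i) _
   (halfline_continuous (u0 i) (fun t t0 => ud t t0 i) (ltW T0) TS).
  by rewrite in_itv/= => /andP[h _]; apply: ud; exact: lt_trans h.
move: cT; rewrite in_itv/= => /andP[Tc _].
have a1 := h1 c (lt_trans TT1 Tc); have a2 := h2 T TT2.
have a3 : `|L i - u (T + 1) i| < e by apply: h2; rewrite (lt_trans TT2)// ltrDl.
have TT : T + 1 - T = 1 by lra.
rewrite /= in a1 a2; rewrite TT mulr1 in E.
have : `|G L i| = 4 * e by rewrite /e; field.
have : `|G L i| <= `|G L i - G (u c) i| + (`|L i - u T i| + `|L i - u (T + 1) i|).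
  rewrite -[X in `|X|](subrK (G (u c) i)) (le_trans (ler_normD _ _))// lerD2l -E.
  have -> : u (T + 1) i - u T i = (L i - u T i) - (L i - u (T + 1) i) by ring.
  exact: ler_normB.
lra.
Qed.

(** A maximum of f above m on [0, t] is attained at some c > 0; just before c the derivative is
    negative, so f was larger there. *)
Lemma barrier (R : realType) (f df : R -> R) (m : R) :
  f @ at_right (0 : R) --> f 0 -> (forall t : R, 0 < t -> is_derive t (1 : R) f (df t)) ->
  f 0 <= m -> (forall t, 0 < t -> m < f t -> df t < 0) -> forall t, 0 <= t -> f t <= m.
Proof.
move=> f0 fd fm dn t; rewrite le_eqVlt => /orP[/eqP <-//|t0].
have [c c0t cmax] := EVT_max (ltW t0) (halfline_continuous f0 fd (lexx 0) t0).
apply: le_trans (cmax t _) _; first by rewrite in_itv/= lexx ltW.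
rewrite leNgt; apply/negP => mc.
have c0 : 0 < c.
  move: c0t; rewrite in_itv/= le_eqVlt => /andP[/orP[/eqP c0|//] _].
  by move: mc; rewrite -c0 ltNge fm.
have fc := is_derive_continuous_at (fd c c0).
have : \forall s \near c, m < f s by apply: (cvgr_gt _ fc).
case=> d /= d0 hd.
pose s := Num.max (c / 2) (c - d / 2).
have [s0 sc sd] : [/\ 0 < s, s < c & c - d < s].
  rewrite /s lt_max gt_max lt_max; split; first by rewrite divr_gt0.
    by apply/andP; split; lra.
  by apply/orP; right; lra.
have [x|x xs E] := MVT sc (df := df) (f := f) _ (halfline_continuous f0 fd (ltW s0) sc).
  by rewrite in_itv/= => /andP[h _]; apply: fd; exact: lt_trans h.
move: xs; rewrite in_itv/= => /andP[sx xc].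
have : df x < 0.
  apply: dn; first exact: lt_trans sx.
  by apply: hd; rewrite /ball/= ger0_norm ?subr_ge0 ?ltW//; lra.
move=> dx; have : f c - f s < 0 by rewrite E nmulr_rlt0// subr_gt0.
rewrite subr_lt0 ltNge cmax// in_itv/= (ltW s0) /=.
by move: c0t; rewrite in_itv/= => /andP[_]; apply: le_trans; exact: ltW.
Qed.

Local Close Scope classical_set_scope.

Lemma uniform_pos (R : realType) (T : finType) (P : T -> R -> Prop) :
  (forall a e e', P a e -> 0 < e' -> e' <= e -> P a e') ->
  (forall a, exists2 e : R, 0 < e & P a e) ->
  exists2 e : R, 0 < e & forall a, P a e.
Proof.
move=> mono ex; suff [e e0 He] : exists2 e : R, 0 < e & forall a, a \in enum T -> P a e.
  by exists e => // a; apply: He; rewrite mem_enum.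
elim: (enum T) => [|a s [e e0 IH]]; first by exists 1.
have [e' e'0 Pa] := ex a; exists (Num.min e e'); first by rewrite lt_min e0.
move=> b; rewrite inE => /orP[/eqP ->|bs].
  by apply: mono Pa _ _; rewrite ?lt_min ?e0// ge_min lexx orbT.
by apply: mono (IH b bs) _ _; rewrite ?lt_min ?e0// ge_min lexx.
Qed.

(* Abel summation over the vertices sorted by u: each initial segment A pays
   its gap times the sum of g over A. *)
Lemma abel_coercive (R : realType) (V : finType) (u g : V -> R) (d C : R) :
  \sum_i g i = 0 ->
  (forall (A : {set V}) (gap : R), A != finset.set0 -> A != [set: V] -> 0 <= gap ->
     (forall a b, a \in A -> b \notin A -> u a + gap <= u b) ->
     d * gap - C <= gap * \sum_(i in A) g i) -> 0 <= d -> 0 <= C ->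
  forall x y, \sum_i g i * u i <= - d * (u x - u y) + #|V|%:R * C.
Proof.
move=> g0 H d0 C0 x y.
pose le := relpre u (<=%R : rel R); pose s := sort le (enum V).
have tr : transitive le by move=> a b c; exact: le_trans.
have ss : sorted le s by apply: sort_sorted => a b; exact: le_total.
have us : uniq s by rewrite sort_uniq enum_uniq.
have ms z : z \in s by rewrite mem_sort mem_enum.
have szs : size s = #|V| by rewrite size_sort cardE.
have sumE (f : V -> R) : \sum_i f i = \sum_(i <- s) f i.
  by rewrite -big_enum; apply: perm_big; rewrite perm_sym perm_sort.
(* Induction on the sorted prefix. Raising the reference level from u w to u z adds the gap u z - u
   w times the sum of g over the prefix ending in w, to which the hypothesis applies. *)
have main s1 : forall z s2, s = rcons s1 z ++ s2 ->
   d * (u z - u (head z s1)) - (size s1)%:R * C <= \sum_(i <- rcons s1 z) g i * (u z - u i).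
  elim/last_ind: s1 => [|s1 w IH] z s2 Es.
    by rewrite /= big_seq1 !subrr !mulr0 mul0r subrr.
  have Es' : s = rcons s1 w ++ z :: s2 by rewrite -cat_rcons.
  have IHw := IH w (z :: s2) Es'.
  have Eh : head z (rcons s1 w) = head w s1 by case: (s1).
  rewrite Eh size_rcons -cats1 big_cat big_seq1 /= subrr mulr0 addr0.
  have pw : pairwise le s by rewrite -sorted_pairwise.
  move: pw us; rewrite Es' pairwise_cat cat_uniq => /and3P[/allrelP pwz pw1 pw2] /and3P[u1 nz u2].
  have zn : z \notin rcons s1 w by apply/negP => zs; move: nz; rewrite /= zs.
  have aw a : a \in rcons s1 w -> u a <= u w.
    move: pw1; rewrite -cats1 pairwise_cat => /and3P[/allrelP p _ _].
    by rewrite mem_cat inE => /orP[as1|/eqP ->//]; apply: p => //; rewrite inE.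
  have zb b : b \in z :: s2 -> u z <= u b.
    move: pw2 => /= /andP[/allP p _]; rewrite inE => /orP[/eqP ->//|]; exact: p.
  have wz : u w <= u z by apply: pwz; rewrite ?mem_rcons ?inE ?eqxx.
  have := H [set i in rcons s1 w] (u z - u w).
  have -> : \sum_(i in [set i in rcons s1 w]) g i = \sum_(i <- rcons s1 w) g i.
    by rewrite big_uniq//; apply: eq_bigl => i; rewrite inE.
  move=> H1.
  have H2 : d * (u z - u w) - C <= (u z - u w) * \sum_(i <- rcons s1 w) g i.
    apply: H1.
    - by apply/finset.set0Pn; exists w; rewrite inE mem_rcons inE eqxx.
    - by apply/eqP => /finset.setP/(_ z); rewrite !inE (negPf zn).
    - by rewrite subr_ge0.
    - move=> a b; rewrite !inE => /aw ha hb.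
      have : b \in z :: s2 by have := ms b; rewrite Es' mem_cat (negPf hb).
      by move=> /zb; lra.
  have -> : \sum_(i <- rcons s1 w) g i * (u z - u i) =
      (u z - u w) * \sum_(i <- rcons s1 w) g i + \sum_(i <- rcons s1 w) g i * (u w - u i).
    by rewrite mulr_sumr -big_split; apply: eq_bigr => i _ /=; ring.
  by rewrite -natr1; lra.
case/lastP: s ss us ms szs sumE main => [|s1 z] ss us ms szs sumE main; first by have := ms x.
have := main s1 z [::]; rewrite cats0 => /(_ erefl) h.
have pw : pairwise le (rcons s1 z) by rewrite -sorted_pairwise.
have xz : u x <= u z.
  move: pw; rewrite -cats1 pairwise_cat => /and3P[/allrelP p _ _].
  by have := ms x; rewrite mem_rcons inE => /orP[/eqP ->//|xs]; apply: p => //; rewrite inE.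
have hy : u (head z s1) <= u y.
  move: pw (ms y); case: (s1) => [|w s2] /=; first by rewrite inE => _ /eqP ->.
  by move=> /andP[/allP p _]; rewrite inE => /orP[/eqP ->//|]; exact: p.
(* The reference level u z drops out because g has sum 0. *)
have E : \sum_(i <- rcons s1 z) g i * (u z - u i) = - \sum_i g i * u i.
  rewrite -sumE; transitivity ((\sum_i g i) * u z - \sum_i g i * u i); last by rewrite g0 mul0r sub0r.
  by rewrite mulr_suml -sumrB; apply: eq_bigr => i _; ring.
rewrite E in h.
have sz : (size s1)%:R * C <= #|V|%:R * C.
  by rewrite ler_wpM2r// ler_nat -szs size_rcons.
have : d * (u x - u y) <= d * (u z - u (head z s1)) by rewrite ler_wpM2l//; lra.
lra.
Qed.

(** * The curvature field in logarithmic coordinates *)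

Definition edge_cos (R : realType) (V : finType) (Theta : {set V} -> R) (a b : V) : R :=
  cos (Theta [set a; b]).

Lemma edge_cosC (R : realType) (V : finType) (Theta : {set V} -> R) (a b : V) :
  edge_cos Theta a b = edge_cos Theta b a.
Proof. by rewrite /edge_cos finset.setUC. Qed.

Lemma tri_admissible (R : realType) (V : finType) (F : {set {set V}}) (Theta : {set V} -> R) (v a b : V) :
  (forall t, t \in F -> #|t| = 3%N) ->
  (forall e, e \in tri_edges F -> 0 <= Theta e < pi) -> cond_C1 F Theta -> [set v; a; b] \in F ->
  admissible (edge_cos Theta v a) (edge_cos Theta v b) (edge_cos Theta a b).
Proof.
move=> F3 HTh C1 tF.
have rng x y : [set x; y] \in tri_edges F -> -1 < edge_cos Theta x y <= 1.
  move=> /HTh /andP[h1 h2]; rewrite /edge_cos cos_le1 andbT -cospi.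
  by rewrite ltr_cos// in_itv/= ?pi_ge0 ?lexx// h1 ltW.
have avb : [set a; v; b] = [set v; a; b] by apply/finset.setP => x; rewrite !inE; do 3 case: (x == _).
have bva : [set b; v; a] = [set v; a; b] by apply/finset.setP => x; rewrite !inE; do 3 case: (x == _).
have abv : [set a; b; v] = [set v; a; b] by apply/finset.setP => x; rewrite !inE; do 3 case: (x == _).
split; split.
- by apply: rng; apply: (set3_edge (v := b)) => //; rewrite bva.
- by apply: rng; apply: (set3_edge (v := a)) => //; rewrite avb.
- by apply: rng; exact: set3_edge tF.
- by rewrite mulrC; exact: C1.
- by rewrite mulrC (edge_cosC Theta a b); apply: C1; rewrite set3_swap.
- by rewrite mulrC (edge_cosC Theta v b) (edge_cosC Theta v a); apply: C1; rewrite abv.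
Qed.

Definition log_field (R : realType) (V : finType) (F : {set {set V}}) (Theta : {set V} -> R)
    (u : V -> R) (i : V) : R :=
  K_av R F - curvature F Theta (fun j => expR (u j)) i.

Definition log_angle (R : realType) (V : finType) (Theta : {set V} -> R) (u : V -> R) (v a b : V) : R :=
  ang (expR (u v)) (expR (u a)) (expR (u b))
    (edge_cos Theta v a) (edge_cos Theta v b) (edge_cos Theta a b).

Lemma log_angle_rot (R : realType) (V : finType) (Theta : {set V} -> R) (u : V -> R) (v a b : V) :
  log_angle Theta u a b v = ang (expR (u a)) (expR (u b)) (expR (u v))
    (edge_cos Theta a b) (edge_cos Theta v a) (edge_cos Theta v b).
Proof. by rewrite /log_angle (edge_cosC Theta a v) (edge_cosC Theta b v). Qed.

Lemma log_angle_rot2 (R : realType) (V : finType) (Theta : {set V} -> R) (u : V -> R) (v a b : V) :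
  log_angle Theta u b v a = ang (expR (u b)) (expR (u v)) (expR (u a))
    (edge_cos Theta v b) (edge_cos Theta a b) (edge_cos Theta v a).
Proof. by rewrite /log_angle (edge_cosC Theta b v) (edge_cosC Theta b a). Qed.

Lemma tri_angle_log (R : realType) (V : finType) (F : {set {set V}}) (Theta : {set V} -> R) (u : V -> R) (v a b : V) :
  (forall v a b, [set v; a; b] \in F ->
     admissible (edge_cos Theta v a) (edge_cos Theta v b) (edge_cos Theta a b)) ->
  [set v; a; b] \in F ->
  tri_angle Theta (fun j => expR (u j)) v a b = log_angle Theta u v a b.
Proof.
by move=> adm tF; rewrite tri_angle_ang//; [move=> i; exact: expR_gt0 | exact: adm].
Qed.

Definition dirichlet (R : realType) (V : finType) (F : {set {set V}}) (w : V -> R) : R :=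
  tri_sum F (fun v a b => (w v - w a) ^+ 2 + (w v - w b) ^+ 2 + (w a - w b) ^+ 2).

(** Only the cone angles survive in the difference of the fields. Grouping the three corners of each
    triangle by cyclic symmetrization reduces the claim to [ang_monotone], with one constant for all
    triangles. *)
Lemma log_field_monotone (R : realType) (V : finType) (F : {set {set V}}) (Theta : {set V} -> R) (B : R) :
  (forall v a b, [set v; a; b] \in F ->
     admissible (edge_cos Theta v a) (edge_cos Theta v b) (edge_cos Theta a b)) ->
  exists2 k : R, 0 < k & forall u v : V -> R, (forall i, `|u i| <= B) -> (forall i, `|v i| <= B) ->
    \sum_i (log_field F Theta u i - log_field F Theta v i) * (u i - v i) <=
    - k * dirichlet F (fun i => u i - v i).
Proof.
move=> adm.
pose P (t : V * V * V) (k : R) := let: (x, a, b) := t in [set x; a; b] \in F ->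
  forall u v : V -> R, (forall i, `|u i| <= B) -> (forall i, `|v i| <= B) ->
  (log_angle Theta u x a b - log_angle Theta v x a b) * (u x - v x) +
  (log_angle Theta u a b x - log_angle Theta v a b x) * (u a - v a) +
  (log_angle Theta u b x a - log_angle Theta v b x a) * (u b - v b) <=
  - k * ((u x - v x - (u a - v a)) ^+ 2 + (u x - v x - (u b - v b)) ^+ 2 + (u a - v a - (u b - v b)) ^+ 2).
have [|[[x a] b]|k k0 hk] := @uniform_pos R _ P.
- move=> [[x a] b] e e' H e'0 ee' tF u v hu hv; apply: le_trans (H tF u v hu hv) _.
  by rewrite ler_wpM2r ?lerN2// !addr_ge0// sqr_ge0.
- have [tF|ntF] := boolP ([set x; a; b] \in F); last by exists 1 => // tF; rewrite tF in ntF.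
  have [k k0 hk] := ang_monotone B (adm _ _ _ tF); exists k => // _ u v hu hv.
  rewrite !(log_angle_rot _ _ x a b) !(log_angle_rot2 _ _ x a b).
  exact: (hk (u x) (u a) (u b) (v x) (v a) (v b)).
exists (k / 6); first by rewrite divr_gt0.
move=> u v hu hv.
have -> : \sum_i (log_field F Theta u i - log_field F Theta v i) * (u i - v i) =
    6^-1 * tri_sum F (fun x a b =>
  (log_angle Theta u x a b - log_angle Theta v x a b) * (u x - v x) +
  (log_angle Theta u a b x - log_angle Theta v a b x) * (u a - v a) +
  (log_angle Theta u b x a - log_angle Theta v b x a) * (u b - v b)).
  rewrite (tri_sum_cyc F (fun x a b => (log_angle Theta u x a b - log_angle Theta v x a b) * (u x - v x))).
  rewrite mulrA (_ : 6^-1 * 3 = 2^-1); last by field.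
  rewrite /tri_sum mulr_sumr; apply: eq_bigr => i _; rewrite /log_field /curvature /cone_angle.
  transitivity (2^-1 * ((\sum_a \sum_(b | [set i; a; b] \in F) tri_angle Theta (fun j => expR (u j)) i a b)
    - \sum_a \sum_(b | [set i; a; b] \in F) tri_angle Theta (fun j => expR (v j)) i a b) * (u i - v i)).
    by ring.
  rewrite -mulrA; congr (_ * _); rewrite -sumrB mulr_suml; apply: eq_bigr => a _.
  rewrite -sumrB mulr_suml; apply: eq_bigr => b tF.
  by rewrite !(tri_angle_log _ adm tF).
rewrite -subr_ge0.
have -> : - (k / 6) * dirichlet F (fun i => u i - v i) = 6^-1 * (- k * dirichlet F (fun i => u i - v i)) by ring.
rewrite -mulrBr mulr_ge0 ?invr_ge0// /dirichlet -tri_sumZ -tri_sumB; apply: tri_sum_ge0 => x a b tF.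
by rewrite subr_ge0; exact: (hk (x, a, b) tF u v hu hv).
Qed.

Lemma skel_dirichlet (R : realType) (V : finType) (F : {set {set V}}) (w : V -> R) (a b : V) :
  (forall t, t \in F -> #|t| = 3%N) -> skel_rel F a b -> (w a - w b) ^+ 2 <= dirichlet F w.
Proof.
move=> F3 /existsP[t /and3P[tF ta tb]].
have D0 v x y : [set v; x; y] \in F -> 0 <= (w v - w x) ^+ 2 + (w v - w y) ^+ 2 + (w x - w y) ^+ 2.
  by move=> _; rewrite !addr_ge0// sqr_ge0.
have [->|ab] := eqVneq a b; first by rewrite subrr expr0n; exact: tri_sum_ge0.
have : #|t :\: [set a; b]| = 1%N.
  rewrite cardsD (finset.setIidPr _) ?cards2 ?ab ?F3//.
  by rewrite finset.subUset !finset.sub1set ta.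
move=> /eqP/cards1P[c Ec].
have Et : t = [set a; b; c].
  rewrite -Ec; apply/finset.setP => x; rewrite !inE.
  by case: eqP => [->|_]; case: eqP => [->|_]; rewrite ?ta ?tb.
have h : [set a; b; c] \in F by rewrite -Et.
apply: le_trans (tri_sum_ge_term D0 h).
by rewrite -addrA lerDl addr_ge0 ?sqr_ge0.
Qed.

(** A path in the 1-skeleton bounds each difference of values by its length times the square root of
    the energy. For sum 0, the squared differences over all pairs add up to 2 |V| times the sum of
    squares. *)
Lemma poincare (R : realType) (V : finType) (F : {set {set V}}) :
  (forall t, t \in F -> #|t| = 3%N) -> (forall a b, connect (skel_rel F) a b) ->
  exists2 c : R, 0 < c & forall w : V -> R, \sum_i w i = 0 -> c * \sum_i w i ^+ 2 <= dirichlet F w.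
Proof.
move=> F3 conn.
have D0 w : 0 <= dirichlet F w :> R.
  by apply: tri_sum_ge0 => *; rewrite !addr_ge0// sqr_ge0.
have pathb w p (a : V) : path (skel_rel F) a p ->
    `|w a - w (last a p)| <= (size p)%:R * Num.sqrt (dirichlet F w) :> R.
  elim: p a => [|x p IH] a /=; first by rewrite subrr normr0 mul0r.
  move=> /andP[ax /IH h]; rewrite -natr1 mulrDl mul1r [X in _ <= X]addrC.
  rewrite -(subrK (w x) (w a)) -addrA (le_trans (ler_normD _ _))// lerD//.
  rewrite -sqrtr_sqr ler_wsqrtr//; exact: skel_dirichlet.
have [|[a b]|e e0 He] := @uniform_pos R (V * V)%type
    (fun p e => forall w : V -> R, e * (w p.1 - w p.2) ^+ 2 <= dirichlet F w).
- move=> p e e' H e'0 ee' w; apply: le_trans (H w); by rewrite ler_wpM2r ?sqr_ge0.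
(* The successor keeps the constant positive when the path is empty. *)
- have /connectP[p pp ->] := conn a b; exists ((size p).+1%:R ^- 2).
    by rewrite invr_gt0 exprn_gt0// ltr0n.
  move=> w /=; have := pathb w _ _ pp; have s0 : 0 < (size p).+1%:R :> R by rewrite ltr0n.
  rewrite [X in _ -> X <= _]mulrC ler_pdivrMr ?exprn_gt0// => h.
  rewrite -[X in X <= _]real_normK ?num_real// -[X in X * _]sqr_sqrtr// -exprMn mulrC.
  rewrite ler_pXn2r ?nnegrE ?mulr_ge0 ?sqrtr_ge0 ?ler0n//.
  by apply: le_trans h _; rewrite ler_wpM2r ?sqrtr_ge0// ler_nat.
have [n0|n0] := posnP #|V|.
  exists 1 => // w _; rewrite big1 ?mulr0// => i _.
  by have := card0_eq n0 i; rewrite inE.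
have nR : 0 < #|V|%:R :> R by rewrite ltr0n.
exists (2 * e / #|V|%:R); first by rewrite divr_gt0// mulr_gt0.
move=> w w0.
have E : \sum_i \sum_j (w i - w j) ^+ 2 = 2 * #|V|%:R * \sum_i w i ^+ 2.
  transitivity (\sum_i (#|V|%:R * w i ^+ 2 - 2 * w i * (\sum_j w j) + \sum_j w j ^+ 2)).
    apply: eq_bigr => i _; rewrite mulr_sumr.
    have -> : #|V|%:R * w i ^+ 2 = \sum_(j : V) w i ^+ 2 by rewrite sumr_const mulr_natl.
    by rewrite -sumrB -big_split; apply: eq_bigr => j _ /=; ring.
  rewrite w0; under eq_bigr do rewrite mulr0 subr0.
  by rewrite big_split /= -mulr_sumr sumr_const -[X in _ + X]mulr_natl; ring.
have : \sum_(i : V) \sum_(j : V) e * (w i - w j) ^+ 2 <= \sum_(i : V) \sum_(j : V) dirichlet F w.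
  by apply: ler_sum => i _; apply: ler_sum => j _; exact: (He (i, j) w).
rewrite !sumr_const -mulrnA -[X in _ <= X]mulr_natl natrM.
under eq_bigr do rewrite -mulr_sumr.
rewrite -mulr_sumr E => h.
have -> : 2 * e / #|V|%:R * \sum_i w i ^+ 2 =
    (e * (2 * #|V|%:R * \sum_i w i ^+ 2)) / (#|V|%:R * #|V|%:R).
  by field; rewrite gt_eqF.
by rewrite ler_pdivrMr ?mulr_gt0// [X in _ <= X]mulrC.
Qed.

Lemma tri_defect_rot (R : realType) (V : finType) (Theta : {set V} -> R) (th : V -> V -> V -> R)
    (A : {set V}) (v a b : V) : tri_defect Theta th A a b v = tri_defect Theta th A v a b.
Proof. rewrite /tri_defect /=; ring. Qed.

Lemma log_angle_sum (R : realType) (V : finType) (Theta : {set V} -> R) (u : V -> R) (v a b : V) :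
  admissible (edge_cos Theta v a) (edge_cos Theta v b) (edge_cos Theta a b) ->
  log_angle Theta u v a b + log_angle Theta u a b v + log_angle Theta u b v a = pi.
Proof.
by move=> adm; rewrite (log_angle_rot _ _ v a b) (log_angle_rot2 _ _ v a b) ang_sum ?expR_gt0.
Qed.

Lemma sum_log_field (R : realType) (V : finType) (F : {set {set V}}) (Theta : {set V} -> R)
    (u : V -> R) (A : {set V}) :
  (forall t, t \in F -> #|t| = 3%N) ->
  (forall e, e \in tri_edges F -> (#|faces_at F e| == 1)%N || (#|faces_at F e| == 2)%N) ->
  (forall v a b, [set v; a; b] \in F ->
     admissible (edge_cos Theta v a) (edge_cos Theta v b) (edge_cos Theta a b)) ->
  \sum_(i in A) log_field F Theta u i = K_av R F * #|A|%:R -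
    (- Lk_sum F Theta A + 2 * pi * chi_GA_int R F A + pi * chi_GA_bd R F A) -
    6^-1 * tri_sum F (tri_defect Theta (log_angle Theta u) A).
Proof.
move=> F3 F12 adm; rewrite sumrB sumr_const mulr_natr (curvature_defect Theta _ A F3 F12) opprD addrA.
congr (_ - _ * _); apply: eq_tri_sum => v a b tF.
have tF2 : [set a; b; v] \in F by rewrite -set3_rot -set3_rot.
have tF3 : [set b; v; a] \in F by rewrite -set3_rot.
by rewrite /tri_defect !(tri_angle_log _ adm).
Qed.

(** The two sides differ by the number of boundary vertices minus that of boundary edges, which is 0
    by [card_bd]. *)
Lemma chi_setT (R : realType) (V : finType) (F : {set {set V}}) : surface_triangulation F ->
  2 * chi_GA_int R F [set: V] + chi_GA_bd R F [set: V] = 2 * euler_char R F.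
Proof.
move=> HT; have bd := card_bd HT; have [F3 _] := HT.
have nd (e : {set V}) : (0 < #|e|)%N -> ~~ [disjoint e & [set: V]].
  by rewrite finset.disjoints_subset finset.setCT finset.subset0 -finset.cards_eq0 -lt0n.
have Ed e : e \in tri_edges F -> ~~ [disjoint e & [set: V]].
  by rewrite inE => /andP[/eqP e2 _]; apply: nd; rewrite e2.
have Fd t : t \in F -> ~~ [disjoint t & [set: V]] by move=> /F3 t3; apply: nd; rewrite t3.
rewrite /chi_GA_int /chi_GA_bd /euler_char.
have -> : [set t in F | ~~ [disjoint t & [set: V]]] = F.
  by apply/finset.setP => t; rewrite inE; case: (boolP (t \in F)) => //= /Fd ->.
have -> : [set e in tri_edges F | bd_edge F e & ~~ [disjoint e & [set: V]]] =
    [set e in tri_edges F | bd_edge F e].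
  by apply/finset.setP => e; rewrite inE [RHS]inE; case: (boolP (e \in _)) => //= /Ed ->; rewrite andbT.
have -> : [set e in tri_edges F | ~~ bd_edge F e & ~~ [disjoint e & [set: V]]] =
    [set e in tri_edges F | ~~ bd_edge F e].
  by apply/finset.setP => e; rewrite inE [RHS]inE; case: (boolP (e \in _)) => //= /Ed ->; rewrite andbT.
have EV : (#|[set v in [set: V] | bd_vertex F v]| + #|[set v in [set: V] | ~~ bd_vertex F v]| = #|V|)%N.
  rewrite -(cardC (bd_vertex F)); congr (_ + _)%N; apply: eq_card => v; by rewrite !inE.
have EE : (#|[set e in tri_edges F | bd_edge F e]| + #|[set e in tri_edges F | ~~ bd_edge F e]| = #|tri_edges F|)%N.
  rewrite -(finset.cardsID [set e | bd_edge F e] (tri_edges F)); congr (_ + _)%N; apply: eq_card => e.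
    by rewrite inE [RHS]inE; congr (_ && _); rewrite inE.
  by rewrite inE [RHS]inE andbC; congr (_ && _); rewrite inE.
have bdV : #|[set v in [set: V] | bd_vertex F v]| = #|[set v | bd_vertex F v]|.
  by apply: eq_card => v; rewrite !inE.
rewrite -EV -EE !natrD bd bdV; ring.
Qed.

(** Gauss-Bonnet, as the case A = V of [sum_log_field]: the link is empty and each defect is pi
    minus the angle sum of a triangle. *)
Lemma sum_log_field0 (R : realType) (V : finType) (F : {set {set V}}) (Theta : {set V} -> R) (u : V -> R) :
  surface_triangulation F ->
  (forall v a b, [set v; a; b] \in F ->
     admissible (edge_cos Theta v a) (edge_cos Theta v b) (edge_cos Theta a b)) ->
  \sum_i log_field F Theta u i = 0.
Proof.
move=> HT adm; have [F3 [_ [F12 _]]] := HT.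
have [n0|n0] := posnP #|V|.
  by rewrite big1// => i _; have := card0_eq n0 i; rewrite inE.
transitivity (\sum_(i in [set: V]) log_field F Theta u i).
  by apply: eq_bigl => i; rewrite inE.
rewrite sum_log_field//.
have -> : Lk_sum F Theta [set: V] = 0.
  rewrite /Lk_sum big_pred0// => e; rewrite finset.disjoints_subset finset.setCT finset.subset0.
  by rewrite inE; case: eqP => // e2; case: eqP => [e0|]; rewrite ?andbF//; move: e2; rewrite e0 cards0.
have -> : tri_sum F (tri_defect Theta (log_angle Theta u) [set: V]) = 0.
  rewrite -[RHS](mul0r (tri_sum F (fun _ _ _ => 0))) -tri_sumZ; apply: eq_tri_sum => v a b tF.
  rewrite /tri_defect /ind !inE /= !mul1r log_angle_sum; last exact: adm.
  by ring.
have := chi_setT R HT => E.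
have -> : chi_GA_bd R F [set: V] = 2 * euler_char R F - 2 * chi_GA_int R F [set: V] by lra.
rewrite /K_av cardsT; field; by rewrite pnatr_eq0 -lt0n.
Qed.

Lemma log_field_bounded (R : realType) (V : finType) (F : {set {set V}}) (Theta : {set V} -> R) :
  (forall v a b, [set v; a; b] \in F ->
     admissible (edge_cos Theta v a) (edge_cos Theta v b) (edge_cos Theta a b)) ->
  exists2 M : R, 0 <= M & forall u i, `|log_field F Theta u i| <= M.
Proof.
move=> adm; pose S : R := 2^-1 * \sum_(a : V) \sum_(b : V) pi.
have S0 : 0 <= S.
  apply: mulr_ge0; first by rewrite invr_ge0.
  by do 2 (apply: sumr_ge0 => ? _); exact: pi_ge0.
have p0 := pi_ge0 R.
exists (`|K_av R F| + (2 * pi + S)); first by rewrite !addr_ge0// mulr_ge0.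
move=> u i; rewrite /log_field /curvature.
have cone : 0 <= cone_angle F Theta (fun j => expR (u j)) i <= S.
  have ang01 a b : [set i; a; b] \in F -> 0 <= tri_angle Theta (fun j => expR (u j)) i a b <= pi.
    move=> tF; rewrite (tri_angle_log _ adm tF).
    by have /andP[h1 h2] := ang_itv (expR (u i)) (expR (u a)) (expR (u b))
      (edge_cos Theta i a) (edge_cos Theta i b) (edge_cos Theta a b); rewrite /log_angle !ltW.
  rewrite /cone_angle mulr_ge0 ?invr_ge0//=; last first.
    by apply: sumr_ge0 => a _; apply: sumr_ge0 => b /ang01/andP[].
  rewrite ler_wpM2l ?invr_ge0//; apply: ler_sum => a _.
  rewrite [X in X <= _]big_mkcond /=; apply: ler_sum => b _.
  by case: ifP => [/ang01/andP[]|_]//.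
rewrite (le_trans (ler_normB _ _))// lerD2l; case/andP: cone => h1 h2.
by case: ifP => _; rewrite ler_norml; apply/andP; split; lra.
Qed.

Lemma log_field_continuous (R : realType) (V : finType) (F : {set {set V}}) (Theta : {set V} -> R) :
  (forall v a b, [set v; a; b] \in F ->
     admissible (edge_cos Theta v a) (edge_cos Theta v b) (edge_cos Theta a b)) ->
  filter_continuous (log_field F Theta).
Proof.
move=> adm T G FG f u fu i.
have ce j : ((fun t => expR (f t j)) @ G --> expR (u j))%classic.
  by apply: (@continuous_cvg _ _ _ _ _ _ (@expR R)); [exact: continuous_expR | exact: fu].
apply: cvgB; first exact: cvg_cst.
apply: cvgB; first exact: cvg_cst.
apply: cvgM; first exact: cvg_cst.
apply: cvg_bigsum => a; rewrite [X in (_ --> X)%classic]big_mkcond /=.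
under eq_fun do rewrite big_mkcond /=.
apply: cvg_bigsum => b; have [tF|_] := boolP ([set i; a; b] \in F); last exact: cvg_cst.
rewrite (tri_angle_log _ adm tF).
under eq_fun do rewrite (tri_angle_log _ adm tF).
by apply: cvg_ang; rewrite ?expR_gt0//; first [exact: adm | exact: ce].
Qed.

(** * Triangle defects and condition (E3) *)

Lemma set3_rotF (V : finType) (F : {set {set V}}) (v a b : V) :
  [set v; a; b] \in F -> [set a; b; v] \in F.
Proof. by rewrite -set3_rot -set3_rot. Qed.

(** With no or three corners in A the defect is 0; with one it is pi - Theta minus the angle there,
    positive by [ang_lt_opp]; with two it is the third angle. *)
Lemma tri_defect_gt0 (R : realType) (V : finType) (F : {set {set V}}) (Theta : {set V} -> R)
    (u : V -> R) (A : {set V}) (v a b : V) :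
  (forall v a b, [set v; a; b] \in F ->
     admissible (edge_cos Theta v a) (edge_cos Theta v b) (edge_cos Theta a b)) ->
  (forall v a b, [set v; a; b] \in F -> 0 <= Theta [set a; b] < pi) ->
  [set v; a; b] \in F ->
  0 <= tri_defect Theta (log_angle Theta u) A v a b /\
  (v \in A -> a \notin A -> 0 < tri_defect Theta (log_angle Theta u) A v a b) /\
  (v \notin A -> a \in A -> 0 < tri_defect Theta (log_angle Theta u) A v a b).
Proof.
move=> adm HTh tF.
have one x y z : [set x; y; z] \in F -> log_angle Theta u x y z < pi - Theta [set y; z].
  move=> h; have := ang_lt_opp (expR_gt0 (u x)) (expR_gt0 (u y)) (expR_gt0 (u z)) (adm _ _ _ h).
  have /andP[h1 h2] := HTh _ _ _ h.
  by rewrite /edge_cos cosK// in_itv/= h1 ltW.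
have pos x y z : 0 < log_angle Theta u x y z.
  by have /andP[] := ang_itv (expR (u x)) (expR (u y)) (expR (u z))
     (edge_cos Theta x y) (edge_cos Theta x z) (edge_cos Theta y z).
have o1 := one _ _ _ tF; have o2 := one _ _ _ (set3_rotF tF).
have o3 := one _ _ _ (set3_rotF (set3_rotF tF)).
have p1 := pos v a b; have p2 := pos a b v; have p3 := pos b v a.
have S := log_angle_sum u (adm _ _ _ tF).
rewrite /tri_defect /ind; set X1 := log_angle _ _ v a b in o1 p1 S *.
set X2 := log_angle _ _ a b v in o2 p2 S *; set X3 := log_angle _ _ b v a in o3 p3 S *.
by case: (v \in A); case: (a \in A); case: (b \in A) => /=;
  (split; [|split=> // _ _]); lra.
Qed.

(** Connectedness of the 1-skeleton supplies a triangle with corners both in A and outside; its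
    positive defect makes the inequality strict. *)
Lemma E3_of_equilibrium (R : realType) (V : finType) (F : {set {set V}}) (Theta : {set V} -> R)
    (u : V -> R) (A : {set V}) :
  surface_triangulation F ->
  (forall v a b, [set v; a; b] \in F ->
     admissible (edge_cos Theta v a) (edge_cos Theta v b) (edge_cos Theta a b)) ->
  (forall v a b, [set v; a; b] \in F -> 0 <= Theta [set a; b] < pi) ->
  (forall i, log_field F Theta u i = 0) -> A != finset.set0 -> A != [set: V] ->
  - Lk_sum F Theta A + 2 * pi * chi_GA_int R F A + pi * chi_GA_bd R F A < K_av R F * #|A|%:R.
Proof.
move=> HT adm HTh G0 A0 AT; have [F3 [_ [F12 [_ [conn _]]]]] := HT.
have := sum_log_field u A F3 F12 adm; rewrite big1 => [E|i _]; last exact: G0.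
suff : 0 < tri_sum F (tri_defect Theta (log_angle Theta u) A) by lra.
have D0 v a b : [set v; a; b] \in F -> 0 <= tri_defect Theta (log_angle Theta u) A v a b.
  by move=> /(tri_defect_gt0 u A adm HTh)[].
have [x xA] := finset.set0Pn _ A0.
have [y yA] : exists y, y \notin A.
  apply: contrapT => /forallNP h; move/negP: AT; apply; apply/eqP/finset.setP => z.
  by rewrite inE; apply/negPn/negP => /(h z).
have [a [b [aA bA ab]]] : exists a b, [/\ a \in A, b \notin A & skel_rel F a b].
  apply: contrapT => h; have : y \in A; last by rewrite (negPf yA).
  apply: (connect_closed (P := fun z => z \in A) _ (conn x y) xA) => a b aA ab.
  by apply/negPn/negP => bA; apply: h; exists a, b.
have [t /and3P[tF ta tb]] := existsP ab.
have anb : a != b by apply/eqP => e; rewrite e (negPf bA) in aA.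
have : #|t :\: [set a; b]| = 1%N.
  rewrite cardsD (finset.setIidPr _) ?cards2 ?anb ?F3//.
  by rewrite finset.subUset !finset.sub1set ta.
move=> /eqP/cards1P[c Ec].
have Et : t = [set a; b; c].
  rewrite -Ec; apply/finset.setP => z; rewrite !inE.
  by case: eqP => [->|_]; case: eqP => [->|_]; rewrite ?ta ?tb.
have h : [set a; b; c] \in F by rewrite -Et.
apply: lt_le_trans (tri_sum_ge_term D0 h).
by have [_ [h1 _]] := tri_defect_gt0 u A adm HTh h; exact: h1.
Qed.

(** One corner in A: its angle approaches pi - Theta of the opposite edge. Two corners: the angle at
    the large outer circle approaches 0. The gap threshold is written as an inverse so that the
    property persists when e shrinks, as [uniform_pos] requires. *)
Lemma tri_defect_small (R : realType) (V : finType) (F : {set {set V}}) (Theta : {set V} -> R)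
    (A : {set V}) (v a b : V) (eps : R) :
  (forall v a b, [set v; a; b] \in F ->
     admissible (edge_cos Theta v a) (edge_cos Theta v b) (edge_cos Theta a b)) ->
  (forall v a b, [set v; a; b] \in F -> 0 <= Theta [set a; b] < pi) ->
  [set v; a; b] \in F -> 0 < eps ->
  exists2 e : R, 0 < e & forall (u : V -> R) (gap : R), e^-1 <= gap ->
    (forall x y, x \in A -> y \notin A -> u x + gap <= u y) ->
    tri_defect Theta (log_angle Theta u) A v a b <= eps.
Proof.
move=> adm HTh tF eps0.
have pow (d : R) : 0 < d -> exists2 e : R, 0 < e & forall s t gap : R, e^-1 <= gap ->
    s + gap <= t -> expR s <= d * expR t.
  (* A gap of at least - ln d in logarithmic radii is a ratio of radii of at most d. *)
  move=> d0; exists (`|ln d| + 1)^-1; first by rewrite invr_gt0 ltr_wpDl.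
  move=> s t gap; rewrite invrK => hg hs; rewrite -{1}(lnK d0) -expRD ler_expR.
  by have := ler_norm (- ln d); rewrite normrN; lra.
have single x y z : [set x; y; z] \in F -> x \in A -> y \notin A -> z \notin A ->
    exists2 e : R, 0 < e & forall (u : V -> R) (gap : R), e^-1 <= gap ->
    (forall x y, x \in A -> y \notin A -> u x + gap <= u y) ->
    tri_defect Theta (log_angle Theta u) A x y z <= eps.
  move=> h xA yA zA; have [d d0 hd] := ang_near_opp (adm _ _ _ h) eps0.
  have [e e0 he] := pow d d0; exists e => // u gap hg sep.
  have := hd _ _ _ (expR_gt0 (u x)) (expR_gt0 (u y)) (expR_gt0 (u z))
    (he _ _ _ hg (sep _ _ xA yA)) (he _ _ _ hg (sep _ _ xA zA)).
  have /andP[h1 h2] := HTh _ _ _ h.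
  rewrite {2}/edge_cos cosK ?in_itv/= ?h1 ?(ltW h2)// -/(log_angle Theta u x y z).
  by rewrite /tri_defect /ind xA (negPf yA) (negPf zA) /=; lra.
have double x y z : [set x; y; z] \in F -> x \notin A -> y \in A -> z \in A ->
    exists2 e : R, 0 < e & forall (u : V -> R) (gap : R), e^-1 <= gap ->
    (forall x y, x \in A -> y \notin A -> u x + gap <= u y) ->
    tri_defect Theta (log_angle Theta u) A x y z <= eps.
  move=> h xA yA zA; have [d d0 hd] := ang_near0 (adm _ _ _ h) eps0.
  have [e e0 he] := pow d d0; exists e => // u gap hg sep.
  have := hd _ _ _ (expR_gt0 (u x)) (expR_gt0 (u y)) (expR_gt0 (u z))
    (he _ _ _ hg (sep _ _ yA xA)) (he _ _ _ hg (sep _ _ zA xA)).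
  have := log_angle_sum u (adm _ _ _ h); rewrite -/(log_angle Theta u x y z).
  by rewrite /tri_defect /ind yA zA (negPf xA) /=; lra.
have r1 (u : V -> R) : tri_defect Theta (log_angle Theta u) A v a b =
    tri_defect Theta (log_angle Theta u) A a b v by exact/esym/tri_defect_rot.
have r2 (u : V -> R) : tri_defect Theta (log_angle Theta u) A v a b =
    tri_defect Theta (log_angle Theta u) A b v a by rewrite r1; exact/esym/tri_defect_rot.
have tF2 := set3_rotF tF; have tF3 := set3_rotF tF2.
case: (boolP (v \in A)) => vA; case: (boolP (a \in A)) => aA; case: (boolP (b \in A)) => bA.
- exists 1 => // u gap _ _; have := log_angle_sum u (adm _ _ _ tF).
  by rewrite /tri_defect /ind vA aA bA /=; lra.
- by have [e e0 he] := double _ _ _ tF3 bA vA aA; exists e => // u gap; rewrite r2; exact: he.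
- by have [e e0 he] := double _ _ _ tF2 aA bA vA; exists e => // u gap; rewrite r1; exact: he.
- exact: single.
- exact: double.
- by have [e e0 he] := single _ _ _ tF2 aA bA vA; exists e => // u gap; rewrite r1; exact: he.
- by have [e e0 he] := single _ _ _ tF3 bA vA aA; exists e => // u gap; rewrite r2; exact: he.
- exists 1 => // u gap _ _.
  by rewrite /tri_defect /ind (negPf vA) (negPf aA) (negPf bA) /=; lra.
Qed.

(** For large gaps the defects use up only part of the slack in (E3). The number e is both the lower
    bound and the inverse of the gap threshold, which makes it uniform over the finitely many A. *)
Lemma E3_gap (R : realType) (V : finType) (F : {set {set V}}) (Theta : {set V} -> R) :
  surface_triangulation F ->
  (forall v a b, [set v; a; b] \in F ->
     admissible (edge_cos Theta v a) (edge_cos Theta v b) (edge_cos Theta a b)) ->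
  (forall v a b, [set v; a; b] \in F -> 0 <= Theta [set a; b] < pi) ->
  (forall A : {set V}, A != finset.set0 -> A != [set: V] ->
    - Lk_sum F Theta A + 2 * pi * chi_GA_int R F A + pi * chi_GA_bd R F A < K_av R F * #|A|%:R) ->
  exists2 e : R, 0 < e & forall (A : {set V}) (u : V -> R) (gap : R),
    A != finset.set0 -> A != [set: V] -> e^-1 <= gap ->
    (forall x y, x \in A -> y \notin A -> u x + gap <= u y) ->
    e <= \sum_(i in A) log_field F Theta u i.
Proof.
move=> HT adm HTh E3; have [F3 [_ [F12 _]]] := HT.
apply: (@uniform_pos R _ (fun A e => forall (u : V -> R) (gap : R),
    A != finset.set0 -> A != [set: V] -> e^-1 <= gap ->
    (forall x y, x \in A -> y \notin A -> u x + gap <= u y) ->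
    e <= \sum_(i in A) log_field F Theta u i)).
  move=> A e e' H e'0 ee' u gap A0 AT hg sep; apply: (le_trans ee'); apply: (H u gap) => //.
  by apply: le_trans hg; rewrite lef_pV2 ?posrE//; exact: lt_le_trans ee'.
move=> A; have [A0|A0] := boolP (A != finset.set0); last by exists 1.
have [AT|AT] := boolP (A != [set: V]); last by exists 1.
have := E3 A A0 AT; set bnd := _ + pi * _; rewrite -subr_gt0 => eta0.
set eta := K_av R F * _ - bnd in eta0.
(* N counts ordered triples. Defects of at most eta / (N + 1) cost less than eta / 6 in all, leaving
   more than eta / 2. *)
pose N : R := tri_sum F (fun _ _ _ => 1).
have N0 : 0 <= N by apply: tri_sum_ge0.
have eps0 : 0 < eta / (N + 1) by rewrite divr_gt0// ltr_wpDl.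
have [|[[v a] b]|e e0 He] := @uniform_pos R (V * V * V)%type (fun t e =>
    let: (v, a, b) := t in [set v; a; b] \in F -> forall (u : V -> R) (gap : R), e^-1 <= gap ->
    (forall x y, x \in A -> y \notin A -> u x + gap <= u y) ->
    tri_defect Theta (log_angle Theta u) A v a b <= eta / (N + 1)).
- move=> [[v a] b] e e' H e'0 ee' tF u gap hg; apply: (H tF); apply: le_trans hg.
  by rewrite lef_pV2 ?posrE//; exact: lt_le_trans ee'.
- have [tF|ntF] := boolP ([set v; a; b] \in F); last by exists 1 => // tF; rewrite tF in ntF.
  by have [e e0 he] := tri_defect_small A adm HTh tF eps0; exists e.
exists (Num.min e (eta / 2)); first by rewrite lt_min e0 divr_gt0.
move=> u gap _ _ hg sep; rewrite ge_min; apply/orP; right.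
have hg' : e^-1 <= gap.
  apply: le_trans hg; rewrite lef_pV2 ?posrE ?ge_min ?lexx// lt_min e0 divr_gt0//.
rewrite (sum_log_field u A F3 F12 adm) -/bnd -/eta.
have : tri_sum F (tri_defect Theta (log_angle Theta u) A) <= eta / (N + 1) * N.
  rewrite -subr_ge0 /N -tri_sumZ -tri_sumB; apply: tri_sum_ge0 => v a b tF.
  by rewrite mulr1 subr_ge0; exact: (He (v, a, b) tF u gap hg' sep).
have : eta / (N + 1) * N <= eta.
  rewrite mulrAC ler_pdivrMr ?ltr_wpDl// mulrDr mulr1 lerDl; exact: ltW.
lra.
Qed.

(** * Boundedness and convergence of trajectories *)

Lemma sum_trajectory (R : realType) (V : finType) (G : (V -> R) -> V -> R) (u : R -> V -> R) :
  (forall p, \sum_i G p i = 0) -> trajectory G u ->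
  forall t, 0 <= t -> \sum_i u t i = \sum_i u 0 i.
Proof.
move=> G0 [u0 ud] t t0.
have c0 : ((fun t => \sum_i u t i) @ at_right (0 : R) --> \sum_i u 0 i)%classic.
  exact: cvg_bigsum.
have d (s : R) : 0 < s -> is_derive s (1 : R) (fun t => \sum_i u t i) 0.
  by move=> s0; exact: is_derive_conv (is_derive_bigsum _ (fun i => ud _ s0 i)) (G0 _).
apply/eqP; rewrite eq_le; apply/andP; split.
  exact: (nonincreasing_of_derive c0 d (fun _ _ => lexx 0) (lexx 0) t0).
rewrite -lerN2; apply: (@nonincreasing_of_derive R (fun t => - \sum_i u t i) (fun=> 0)) => //.
  exact: cvgN.
by move=> s s0; exact: is_derive_conv (is_derive_opp (d s s0)) (oppr0 _).
Qed.

Lemma abs_le_of_sqr (R : realType) (x y : R) : x ^+ 2 <= y -> `|x| <= y + 1.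
Proof.
move=> h; have y0 : 0 <= y := le_trans (sqr_ge0 x) h.
rewrite -(ler_pXn2r (n := 2)) ?nnegrE ?addr_ge0// real_normK ?num_real//.
by apply: (le_trans h); have := sqr_ge0 y; lra.
Qed.

(** Equal sums are required for the strict estimate because adding a constant to u, a common scaling
    of the radii, leaves the curvature field unchanged. The constant k may depend on the bound B. *)
Definition dissipative (R : realType) (V : finType) (G : (V -> R) -> V -> R) :=
  [/\ filter_continuous G, forall p, \sum_i G p i = 0 &
  forall B, exists2 k : R, 0 < k & forall p q : V -> R,
    (forall i, `|p i| <= B) -> (forall i, `|q i| <= B) ->
    \sum_i (G p i - G q i) * (p i - q i) <= 0 /\
    (\sum_i p i = \sum_i q i ->
     \sum_i (G p i - G q i) * (p i - q i) <= - k * \sum_i (p i - q i) ^+ 2)].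

(** A trajectory and its time shifts have the same sum, so contraction makes it Cauchy. The limit is
    an equilibrium of that sum, and a second contraction, against this constant trajectory, gives
    the rate. *)
Lemma bounded_trajectory_cvg (R : realType) (V : finType) (G : (V -> R) -> V -> R)
    (u : R -> V -> R) (B : R) :
  dissipative G -> trajectory G u -> (forall t, 0 <= t -> forall i, `|u t i| <= B) ->
  exists L : V -> R, [/\ forall i, ((fun t => u t i) @ +oo --> L i)%classic,
    forall i, G L i = 0 &
    exists k C : R, [/\ 0 < k, 0 <= C & forall t, 0 <= t ->
      \sum_i (u t i - L i) ^+ 2 <= expR (- (2 * k * t)) * C]].
Proof.
move=> [Gc G0 Gm] tu uB; have us := sum_trajectory G0 tu.
have [k k0 hk] := Gm B.
have [L uL] : exists L : V -> R, forall i, ((fun t => u t i) @ +oo --> L i)%classic.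
  apply: (@trajectory_cauchy R V u k (\sum_(i : V) (B + B) ^+ 2)) => //.
    by apply: sumr_ge0 => i _; exact: sqr_ge0.
  move=> s t s0 t0; have := @trajectory_contract R V G _ u k (trajectory_shift tu s0) tu _ t t0.
  move=> /(_ _) h; apply: le_trans (h _) _.
    move=> x /ltW x0; apply: (hk _ _ (uB _ (addr_ge0 s0 x0)) (uB _ x0)).2.
    by rewrite !us// addr_ge0.
  rewrite ler_wpM2l ?expR_ge0//; apply: ler_sum => i _; rewrite addr0.
  rewrite -[X in X <= _]real_normK ?num_real// ler_pXn2r ?nnegrE//; last first.
    by rewrite addr_ge0// (le_trans (normr_ge0 _) (uB 0 (lexx 0) i)).
  by rewrite (le_trans (ler_normB _ _))// lerD// uB.
exists L; have GL := limit_equilibrium Gc tu uL; split => //.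
(* A larger box, containing the limit as well as the trajectory. *)
have [k' k'0 hk'] := Gm (`|B| + \sum_i `|L i|).
exists k', (\sum_i (u 0 i - L i) ^+ 2); split => //.
  by apply: sumr_ge0 => i _; exact: sqr_ge0.
have SL : \sum_i L i = \sum_i u 0 i.
  have c1 : ((fun t => \sum_i u t i) @ +oo --> \sum_i L i)%classic by exact: cvg_bigsum.
  apply: (norm_cvg_unique c1).
  apply: (@cvg_trans _ ((fun=> \sum_i u 0 i) @ +oo)%classic); last exact: cvg_cst.
  apply: near_eq_cvg; exists 0; split => // t /ltW t0; exact/esym/us.
apply: (trajectory_contract tu (trajectory_const GL)) => t /ltW t0.
have LB i : `|L i| <= `|B| + \sum_i `|L i|.
  rewrite (bigD1 i)//= addrCA lerDl addr_ge0// sumr_ge0//.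
have uB' i : `|u t i| <= `|B| + \sum_i `|L i|.
  rewrite (le_trans (uB t t0 i))// (le_trans (ler_norm B))// lerDl sumr_ge0//.
by apply: (hk' _ _ uB' LB).2; rewrite SL us.
Qed.

Lemma equilibrium_bounded (R : realType) (V : finType) (G : (V -> R) -> V -> R)
    (u : R -> V -> R) (p : V -> R) :
  dissipative G -> trajectory G u -> (forall i, G p i = 0) ->
  exists B, forall t, 0 <= t -> forall i, `|u t i| <= B.
Proof.
move=> [_ _ Gm] tu Gp.
exists (\sum_i (u 0 i - p i) ^+ 2 + 1 + \sum_i `|p i|) => t t0 i.
have := @trajectory_contract R V G u (fun=> p) 0 tu (trajectory_const Gp) _ t t0.
rewrite mulr0 mul0r oppr0 expR0 mul1r => /(_ _) h.
have {}h : \sum_i (u t i - p i) ^+ 2 <= \sum_i (u 0 i - p i) ^+ 2.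
  apply: h => s s0; rewrite ?oppr0 ?mul0r.
  (* The box may depend on the time s, because only the sign of the pairing is used. *)
  have [k _ hk] := Gm (\sum_i `|u s i| + \sum_i `|p i|).
  have le1 (q : V -> R) (S : R) j : 0 <= S -> `|q j| <= \sum_i `|q i| + S.
    by move=> S0; rewrite (bigD1 j)//= -addrA lerDl addr_ge0// sumr_ge0.
  apply: (hk _ _ _ _).1 => j; first by apply: le1; exact: sumr_ge0.
  by rewrite addrC; apply: le1; exact: sumr_ge0.
have h2 := abs_le_of_sqr (le_trans (sqr_le_sum (fun i => u t i - p i) i) h).
rewrite -(subrK (p i) (u t i)) (le_trans (ler_normD _ _))// lerD//.
by rewrite (bigD1 i)//= lerDl sumr_ge0.
Qed.

(** [barrier] for the squared distance to the constant mean m: a large distance forces a large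
    spread u x - u y, and coercivity then makes the derivative negative. *)
Lemma coercive_bounded (R : realType) (V : finType) (G : (V -> R) -> V -> R)
    (u : R -> V -> R) (d C : R) :
  (forall p, \sum_i G p i = 0) -> trajectory G u -> 0 < d ->
  (forall p x y, \sum_i G p i * p i <= - d * (p x - p y) + C) ->
  exists B, forall t, 0 <= t -> forall i, `|u t i| <= B.
Proof.
move=> G0 tu d0 coer; have us := sum_trajectory G0 tu.
have [V0|V0] := posnP #|V|.
  by exists 0 => t _ i; have := card0_eq V0 i; rewrite inE.
have nR : 0 < #|V|%:R :> R by rewrite ltr0n.
have sc (c : R) : \sum_(j : V) c = #|V|%:R * c by rewrite sumr_const mulr_natl.
pose m : R := (\sum_i u 0 i) / #|V|%:R.
have nm : #|V|%:R * m = \sum_i u 0 i by rewrite /m mulrC divfK ?gt_eqF.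
pose f t := \sum_i (u t i - m) ^+ 2.
(* A spread above rho gives - d (p x - p y) + C < 0. *)
pose rho : R := (`|C| + 1) / d.
have rho0 : 0 < rho by rewrite divr_gt0// ltr_wpDl.
pose bound := Num.max (f 0) (\sum_(i : V) rho ^+ 2).
case: (tu) => u0 ud.
have f0 : (f @ at_right (0 : R) --> f 0)%classic.
  apply: cvg_bigsum => i; rewrite expr2; under eq_fun do rewrite expr2.
  by apply: cvgM; apply: cvgB => //; exact: cvg_cst.
have fd (t : R) : 0 < t -> is_derive t (1 : R) f (\sum_i 2 * (u t i - m) * G (u t) i).
  move=> t0; apply: is_derive_bigsum => i; apply: is_derive_sqr.
  refine (is_derive_conv (is_derive_add (ud _ t0 i) (is_derive_opp (is_derive_const m t))) _).
  by rewrite oppr0 addr0.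
have fb : forall t, 0 <= t -> f t <= bound.
  apply: (barrier f0 fd); first by rewrite le_max lexx.
  move=> t t0; rewrite gt_max => /andP[_ ft].
  have -> : \sum_i 2 * (u t i - m) * G (u t) i = 2 * \sum_i G (u t) i * u t i.
    transitivity (2 * (\sum_i G (u t) i * u t i) - 2 * m * \sum_i G (u t) i).
      by rewrite !mulr_sumr -sumrB; apply: eq_bigr => i _; ring.
    by rewrite G0 mulr0 subr0.
  have sw : \sum_i (u t i - m) = 0.
    by rewrite sumrB (us _ (ltW t0)) sc nm subrr.
  have [x [y xy]] : exists x y, rho < u t x - u t y.
    (* If every difference is at most rho, averaging over the other index puts each coordinate
       within rho of the mean. *)
    apply: contrapT => h.
    have h2 i j : u t i - u t j <= rho by rewrite leNgt; apply/negP => hh; apply: h; exists i, j.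
    move: ft; apply/negP; rewrite -leNgt; apply: ler_sum => i _.
    have up : #|V|%:R * (u t i - m) <= #|V|%:R * rho.
      have : \sum_(j : V) (u t i - u t j) <= \sum_(j : V) rho by apply: ler_sum => j _; exact: h2.
      rewrite sumrB (us _ (ltW t0)) !sc.
      by rewrite mulrBr nm.
    have lo : #|V|%:R * (m - u t i) <= #|V|%:R * rho.
      have : \sum_(j : V) (u t j - u t i) <= \sum_(j : V) rho by apply: ler_sum => j _; exact: h2.
      rewrite sumrB (us _ (ltW t0)) !sc.
      by rewrite mulrBr nm.
    rewrite ler_pM2l// in up; rewrite ler_pM2l// in lo.
    rewrite -[X in X <= _]real_normK ?num_real// ler_pXn2r ?nnegrE ?(ltW rho0)//.
    by rewrite ler_norml; apply/andP; split; lra.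
  have := coer (u t) x y; have : d * rho < d * (u t x - u t y) by rewrite ltr_pM2l.
  have : d * rho = `|C| + 1 by rewrite /rho mulrC divfK ?gt_eqF.
  have := ler_norm C; rewrite pmulr_rlt0//; lra.
exists (bound + 1 + `|m|) => t t0 i.
rewrite -(subrK m (u t i)) (le_trans (ler_normD _ _))// lerD2r.
apply: abs_le_of_sqr; apply: le_trans (fb t t0).
exact: (sqr_le_sum (fun i => u t i - m)).
Qed.

Lemma log_field_dissipative (R : realType) (V : finType) (F : {set {set V}}) (Theta : {set V} -> R) :
  surface_triangulation F ->
  (forall v a b, [set v; a; b] \in F ->
     admissible (edge_cos Theta v a) (edge_cos Theta v b) (edge_cos Theta a b)) ->
  dissipative (log_field F Theta).
Proof.
move=> HT adm; have [F3 [_ [_ [_ [conn _]]]]] := HT; split.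
- exact: log_field_continuous.
- by move=> p; exact: sum_log_field0.
move=> B; have [k k0 hk] := log_field_monotone B adm.
have [c c0 hc] := poincare R F3 conn.
exists (k * c); first exact: mulr_gt0.
move=> p q hp hq; have := hk p q hp hq => h; split.
  apply: (le_trans h); rewrite mulNr oppr_le0 mulr_ge0 ?(ltW k0)//.
  by apply: tri_sum_ge0 => *; rewrite !addr_ge0// sqr_ge0.
move=> pq; apply: (le_trans h); rewrite !mulNr lerN2 -mulrA ler_pM2l//; apply: hc.
by rewrite sumrB pq subrr.
Qed.

Lemma E3_bounded (R : realType) (V : finType) (F : {set {set V}}) (Theta : {set V} -> R)
    (u : R -> V -> R) :
  surface_triangulation F ->
  (forall v a b, [set v; a; b] \in F ->
     admissible (edge_cos Theta v a) (edge_cos Theta v b) (edge_cos Theta a b)) ->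
  (forall v a b, [set v; a; b] \in F -> 0 <= Theta [set a; b] < pi) ->
  (forall A : {set V}, A != finset.set0 -> A != [set: V] ->
    - Lk_sum F Theta A + 2 * pi * chi_GA_int R F A + pi * chi_GA_bd R F A < K_av R F * #|A|%:R) ->
  trajectory (log_field F Theta) u ->
  exists B, forall t, 0 <= t -> forall i, `|u t i| <= B.
Proof.
move=> HT adm HTh E3 tu; have [e e0 He] := E3_gap HT adm HTh E3.
have [M M0 hM] := log_field_bounded adm.
have S0 p : \sum_i log_field F Theta p i = 0 by exact: sum_log_field0.
(* Absorbs the gaps below e^-1, for which [E3_gap] says nothing: there e times the gap is at most 1,
   and the sum of the field is at least - |V| M. *)
pose C : R := 1 + e^-1 * (#|V|%:R * M).
have C0 : 0 <= C by rewrite addr_ge0// !mulr_ge0// invr_ge0 ltW.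
apply: (@coercive_bounded R V (log_field F Theta) u e (#|V|%:R * C)) => // p x y.
apply: (abel_coercive (S0 p)) => //; last exact: ltW.
move=> A gap A0 AT gap0 sep; have [hg|hg] := leP e^-1 gap.
  have := ler_wpM2l gap0 (He A p gap A0 AT hg sep); rewrite mulrC; lra.
have SA : - (#|V|%:R * M) <= \sum_(i in A) log_field F Theta p i.
  rewrite lerNl -sumrN; apply: (@le_trans _ _ (\sum_(i in A) M)).
    by apply: ler_sum => i _; rewrite (le_trans (ler_norm _))// normrN.
  by rewrite sumr_const -[X in X <= _]mulr_natl ler_wpM2r// ler_nat max_card.
have := ler_wpM2l gap0 SA.
have : gap * (#|V|%:R * M) <= e^-1 * (#|V|%:R * M) by rewrite ler_wpM2r ?mulr_ge0// ltW.
have : e * gap <= 1 by rewrite -ler_pdivlMl// mulr1 ltW.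
rewrite /C; lra.
Qed.

(** * The flow of the radii and the geometry of its limit *)

Lemma flow_trajectory (R : realType) (V : finType) (F : {set {set V}}) (Theta : {set V} -> R)
    (r0 : V -> R) (r : R -> V -> R) :
  flow_solution F Theta r0 r -> trajectory (log_field F Theta) (fun t i => ln (r t i)).
Proof.
move=> [E0 rpos rc rd]; split=> [i|t t0 i].
  apply: (@continuous_cvg _ _ _ _ _ _ (@ln R)); last by rewrite E0; exact: rc.
  exact/continuous_ln/rpos.
have rt := rpos t (ltW t0) i.
have := @is_derive1_comp R (@ln R) (fun s => r s i) t _ _ (is_derive1_ln rt) (rd t t0 i).
rewrite mulrC mulfK ?gt_eqF// /log_field.
have -> : (fun j => expR (ln (r t j))) = r t; last by [].
by apply/funext => j; rewrite lnK// posrE rpos// ltW.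
Qed.

Lemma equilibrium_log (R : realType) (V : finType) (F : {set {set V}}) (Theta : {set V} -> R)
    (r : V -> R) : (forall i, 0 < r i) -> (forall i, curvature F Theta r i = K_av R F) ->
  forall i, log_field F Theta (fun j => ln (r j)) i = 0.
Proof.
move=> r0 rK i; rewrite /log_field.
have -> : (fun j => expR (ln (r j))) = r; last by rewrite rK subrr.
by apply/funext => j; rewrite lnK// posrE.
Qed.

Lemma flow_exists (R : realType) (V : finType) (F : {set {set V}}) (Theta : {set V} -> R)
    (r0 : V -> R) :
  (forall v a b, [set v; a; b] \in F ->
     admissible (edge_cos Theta v a) (edge_cos Theta v b) (edge_cos Theta a b)) ->
  (forall i, 0 < r0 i) -> exists r, flow_solution F Theta r0 r.
Proof.
move=> adm r00; have [M M0 hM] := log_field_bounded adm.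
have [u [u0 ul ud]] := @peano_global R V _ M (fun i => ln (r0 i)) hM
  (filter_continuous_eps (log_field_continuous adm)).
have r0E : (fun i => expR (u 0 i)) = r0.
  by apply/funext => i; rewrite u0 lnK// posrE.
exists (fun t i => expR (u t i)); split => //.
- by move=> t _ i; exact: expR_gt0.
- move=> i; rewrite -r0E; apply: (@continuous_cvg _ _ _ _ _ _ (@expR R)); first exact: continuous_expR.
  have M1 : 0 < M + 1 by rewrite ltr_wpDl.
  apply/cvgrPdist_le => e e0; near=> t.
  have t0 : 0 < t by near: t; exact: nbhs_right_gt.
  rewrite distrC (le_trans (ul 0 t (lexx 0) (ltW t0) i))// subr0.
  have : t <= e / (M + 1) by near: t; apply: nbhs_right_le; rewrite divr_gt0.
  by rewrite ler_pdivlMr// mulrDr mulr1; lra.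
- move=> t t0 i; have := @is_derive1_comp R (@expR R) (fun s => u s i) t _ _ (is_derive_expR _) (ud t t0 i).
  by rewrite mulrC.
Unshelve. all: by end_near.
Qed.

(* If r converges then u = ln r is bounded above from some time on, and then
   also below because its sum is constant. *)
Lemma cvg_flow_equilibrium (R : realType) (V : finType) (G : (V -> R) -> V -> R) (u : R -> V -> R)
    (L : V -> R) :
  dissipative G -> trajectory G u ->
  (forall i, ((fun t => expR (u t i)) @ +oo --> L i)%classic) ->
  exists p, forall i, G p i = 0.
Proof.
move=> dG tu cL; have [_ G0 _] := dG.
have [T [_ hT]] : (\forall t \near +oo, forall i, `|L i - expR (u t i)| < 1)%classic.
  apply: filter_forall => i; have := cL i; move/cvgrPdist_lt; exact.
pose T0 := Num.max 0 T + 1; pose S := \sum_i (`|L i| + 1).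
have [T00 TT0] : 0 <= T0 /\ T < T0.
  have : Num.max 0 T < T0 by rewrite ltrDl.
  by rewrite gt_max => /andP[/ltW].
have S0 : 0 <= S by apply: sumr_ge0 => i _; rewrite addr_ge0.
have up t : 0 <= t -> forall i, u (T0 + t) i <= S.
  move=> t0 i; have /hT/(_ i) h : T < T0 + t by rewrite ltr_wpDr.
  have h1 : `|L i| + 1 <= S by rewrite /S (bigD1 i)//= lerDl sumr_ge0// => j _; rewrite addr_ge0.
  have h2 := expR_ge1Dx (u (T0 + t) i); have h3 := ler_norm (L i).
  by move: h; rewrite ltr_norml => /andP[h4 _]; lra.
have us := sum_trajectory G0 tu.
have bd t : 0 <= t -> forall i, `|u (T0 + t) i| <= `|\sum_i u 0 i| + #|V|%:R * S + S.
  move=> t0 i; have := us (T0 + t) (addr_ge0 T00 t0).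
  rewrite (bigD1 i)//= => E; have h1 := up t t0 i.
  have h2 : \sum_(j | j != i) u (T0 + t) j <= #|V|%:R * S.
    apply: (@le_trans _ _ (\sum_(j | j != i) S)); first by apply: ler_sum => j _; exact: up.
    by rewrite sumr_const -[X in X <= _]mulr_natl ler_wpM2r// ler_nat max_card.
  have h3 := ler_norm (\sum_i u 0 i); have h4 := ler_norm (- \sum_i u 0 i).
  have h5 : 0 <= #|V|%:R * S by rewrite mulr_ge0.
  rewrite normrN in h4; rewrite ler_norml; apply/andP; split; lra.
have [p [_ Gp _]] := bounded_trajectory_cvg dG (trajectory_shift tu T00) bd.
by exists p.
Qed.

(** The strict triangle inequality amounts to a cosine above -1 at the opposite vertex, which
    follows from the positivity of [gram]. *)
Lemma cone_metric (R : realType) (V : finType) (F : {set {set V}}) (Theta : {set V} -> R) (r : V -> R) :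
  (forall v a b, [set v; a; b] \in F ->
     admissible (edge_cos Theta v a) (edge_cos Theta v b) (edge_cos Theta a b)) ->
  (forall i, 0 < r i) -> euclidean_cone_metric F Theta r.
Proof.
move=> adm r0 a b c tF.
have tF' : [set c; a; b] \in F by exact: set3_rotF (set3_rotF tF).
have ad := adm _ _ _ tF'; have [[ha hb hc] _] := ad.
have g0 := gram_gt0 (r0 c) (r0 a) (r0 b) ad.
have L1 := sqlen_gt0 (r0 c) (r0 a) ha; have L2 := sqlen_gt0 (r0 c) (r0 b) hb.
have L3 := sqlen_gt0 (r0 a) (r0 b) hc.
have -> : edge_len Theta r a c = Num.sqrt (sqlen (r c) (r a) (edge_cos Theta c a)).
  by rewrite sqlenC edge_cosC.
have -> : edge_len Theta r b c = Num.sqrt (sqlen (r c) (r b) (edge_cos Theta c b)).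
  by rewrite sqlenC edge_cosC.
rewrite -[edge_len _ _ _ _]/(Num.sqrt (sqlen (r a) (r b) (edge_cos Theta a b))).
set l1 := Num.sqrt (sqlen _ (r a) _); set l2 := Num.sqrt (sqlen _ (r b) (edge_cos Theta c b)).
have l10 : 0 < l1 by rewrite sqrtr_gt0.
have l20 : 0 < l2 by rewrite sqrtr_gt0.
have E1 : l1 ^+ 2 = sqlen (r c) (r a) (edge_cos Theta c a) by rewrite sqr_sqrtr ?(ltW L1).
have E2 : l2 ^+ 2 = sqlen (r c) (r b) (edge_cos Theta c b) by rewrite sqr_sqrtr ?(ltW L2).
rewrite -(ltr_pXn2r (n := 2)) ?nnegrE ?sqrtr_ge0 ?addr_ge0 ?(ltW l10) ?(ltW l20)//.
rewrite sqr_sqrtr ?(ltW L3)//.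
set N := cosnum (r c) (r a) (r b) (edge_cos Theta c a) (edge_cos Theta c b) (edge_cos Theta a b).
have Nl : `|N| < l1 * l2.
  rewrite -(ltr_pXn2r (n := 2)) ?nnegrE ?mulr_ge0 ?(ltW l10) ?(ltW l20)//.
  by rewrite real_normK ?num_real// exprMn E1 E2 -subr_gt0.
have -> : sqlen (r a) (r b) (edge_cos Theta a b) = l1 ^+ 2 + l2 ^+ 2 - 2 * N.
  rewrite E1 E2 /N /cosnum /sqlen; ring.
by move: Nl; rewrite ltr_norml => /andP[h _]; lra.
Qed.

Lemma circle_pattern (R : realType) (V : finType) (F : {set {set V}}) (Theta : {set V} -> R) (r : V -> R) :
  (forall e, e \in tri_edges F -> 0 <= Theta e < pi) ->
  (forall i, 0 < r i) -> supports_circle_pattern F Theta (edge_len Theta r).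
Proof.
move=> HTh r0; exists r; split => // a b _ /HTh/andP[t0 tpi].
have hc : -1 < edge_cos Theta a b <= 1.
  rewrite /edge_cos cos_le1 andbT -cospi.
  by rewrite ltr_cos// in_itv/= ?pi_ge0 ?lexx// t0 ltW.
have L0 := sqlen_gt0 (r0 a) (r0 b) hc.
rewrite -[edge_len _ _ _ _]/(Num.sqrt (sqlen (r a) (r b) (edge_cos Theta a b))).
have ab := mulr_gt0 (r0 a) (r0 b).
split; last 1 first.
- rewrite sqr_sqrtr ?(ltW L0)//.
  have -> : (sqlen (r a) (r b) (edge_cos Theta a b) - r a ^+ 2 - r b ^+ 2) / (2 * r a * r b)
     = cos (Theta [set a; b]).
    by rewrite /sqlen /edge_cos; field; rewrite !gt_eqF.
  by rewrite cosK// in_itv/= t0 ltW.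
- have := sqrt_sqlen_ge (r0 a) (r0 b) hc.
  have := sqrt_sqlen_ge (r0 b) (r0 a) (_ : -1 < edge_cos Theta a b <= 1).
  rewrite sqlenC => /(_ hc) h1 h2; rewrite ler_norml; apply/andP; split; lra.
- exact: sqrt_sqlen_le.
Qed.

Lemma expR_lipschitz (R : realType) (S a b : R) :
  a <= S -> b <= S -> `|expR a - expR b| <= expR S * `|a - b|.
Proof.
move=> aS bS; have half x y : x <= S -> y <= x -> expR x - expR y <= expR S * (x - y) :> R.
  move=> xS yx; apply: (@le_trans _ _ (expR x * (x - y))).
    have -> : expR y = expR x * expR (y - x) by rewrite -expRD addrC subrK.
    have := ler_wpM2l (expR_ge0 x) (expR_ge1Dx (y - x)); lra.
  by rewrite ler_wpM2r ?subr_ge0// ler_expR.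
have [ab|ba] := leP b a.
  by rewrite !ger0_norm ?subr_ge0 ?ler_expR// half.
rewrite distrC (distrC a) !ger0_norm ?subr_ge0 ?ler_expR ?(ltW ba)//.
by rewrite half// ltW.
Qed.

Unset Implicit Arguments.

Theorem theorem0p8 (R : realType) (V : finType) (F : {set {set V}})
  (Theta : {set V} -> R)
  (HT : surface_triangulation F)
  (HTheta : forall e, e \in tri_edges F -> 0 <= Theta e < pi)
  (HC1 : cond_C1 F Theta)
  (r0 : V -> R) (Hr0 : forall i, 0 < r0 i) :
  let Kav := K_av R F in
  let E2 := exists r : V -> R, (forall i, 0 < r i) /\
              (forall i, curvature F Theta r i = Kav) in
  let E3 := forall A : {set V}, A != finset.set0 -> A != [set: V] ->
              2 * pi * euler_char R F * #|A|%:R / #|V|%:R >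
                - Lk_sum F Theta A + 2 * pi * chi_GA_int R F A
                + pi * chi_GA_bd R F A in
  (exists r : R -> V -> R, flow_solution F Theta r0 r) /\
  forall r : R -> V -> R, flow_solution F Theta r0 r ->
    let E1 := exists L : V -> R,
                forall i, ((fun t => r t i) @ +oo --> L i)%classic in
    (E1 <-> E2) /\ (E2 <-> E3) /\
    ((E1 \/ E2 \/ E3) ->
       exists rs : V -> R,
         [/\ forall i, 0 < rs i,
             (exists C lam : R, 0 < lam /\
                forall t : R, 0 <= t -> forall i,
                  `|r t i - rs i| <= C * expR (- lam * t)),
             euclidean_cone_metric F Theta rs,
             forall i, curvature F Theta rs i = Kav &
             supports_circle_pattern F Theta (edge_len Theta rs)]).
Proof.
move=> Kav E2 E3; have [F3 [cover [F12 _]]] := HT.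
have adm := fun v a b => @tri_admissible R V F Theta v a b F3 HTheta HC1.
have HTh v a b (tF : [set v; a; b] \in F) := HTheta _ (set3_edge F3 tF).
have dG := log_field_dissipative HT adm.
split; first exact: flow_exists.
move=> r hr E1; have tu := flow_trajectory hr; have [_ rpos _ _] := hr.
have rE t i : 0 <= t -> expR (ln (r t i)) = r t i by move=> t0; rewrite lnK// posrE rpos.
(* The hub of the equivalences: E2 and E3 each imply it, it implies E1 and the final conclusion, and
   E1 -> E2 -> E3 closes the circle. *)
pose bdd := exists B, forall t, 0 <= t -> forall i, `|ln (r t i)| <= B.
have E3E : E3 <-> forall A : {set V}, A != finset.set0 -> A != [set: V] ->
    - Lk_sum F Theta A + 2 * pi * chi_GA_int R F A + pi * chi_GA_bd R F A < K_av R F * #|A|%:R.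
  by split=> H A A0 AT; have := H A A0 AT; rewrite /K_av [X in _ < X]mulrAC.
have eqE2 p : (forall i, log_field F Theta p i = 0) -> E2.
  move=> Gp; exists (fun i => expR (p i)); split=> i; first exact: expR_gt0.
  by have := Gp i; rewrite /log_field => /eqP; rewrite subr_eq0 => /eqP.
have E2eq : E2 -> exists p, forall i, log_field F Theta p i = 0.
  by move=> [p [p0 pK]]; exists (fun j => ln (p j)); exact: equilibrium_log.
have E2b : E2 -> bdd by move=> /E2eq[p Gp]; exact: (equilibrium_bounded dG tu Gp).
(* The limit in E1 is not assumed positive, so the equilibrium is found through boundedness of ln r
   instead of being read off from L. *)
have E12 : E1 -> E2.
  move=> [L rL]; have [|p Gp] := @cvg_flow_equilibrium R V _ _ L dG tu; last exact: eqE2 Gp.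
  move=> i; apply: cvg_trans (rL i); apply: near_eq_cvg; exists 0; split => // t /ltW t0.
  by rewrite rE.
have bdd_concl : bdd -> exists rs : V -> R,
     [/\ forall i, 0 < rs i,
         (exists C lam : R, 0 < lam /\
            forall t : R, 0 <= t -> forall i,
              `|r t i - rs i| <= C * expR (- lam * t)),
         forall i, ((fun t => r t i) @ +oo --> rs i)%classic &
         forall i, curvature F Theta rs i = Kav].
  move=> [B uB]; have [L [uL GL [k [C [k0 C0 hkC]]]]] := bounded_trajectory_cvg dG tu uB.
  exists (fun i => expR (L i)); split.
  - by move=> i; exact: expR_gt0.
  (* The first factor is a Lipschitz constant of exp on the range of ln r and L. The squared
     distance decays at rate 2 k, so each coordinate decays at rate k, and C + 1 replaces a square
     root since C <= (C + 1)^2. *)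
  - exists (expR (`|B| + \sum_i `|L i|) * (C + 1)), k; split => // t t0 i.
    have h := hkC t t0; set w := fun i => ln (r t i) - L i.
    have hw : `|w i| <= expR (- k * t) * (C + 1).
      rewrite -(ler_pXn2r (n := 2)) ?nnegrE ?mulr_ge0 ?expR_ge0 ?addr_ge0//.
      rewrite real_normK ?num_real//; apply: (le_trans (sqr_le_sum w i)); apply: (le_trans h).
      have -> : (expR (- k * t) * (C + 1)) ^+ 2 = expR (- (2 * k * t)) * (C + 1) ^+ 2.
        by rewrite exprMn [expR _ ^+ 2]expr2 -expRD; congr (expR _ * _); ring.
      by rewrite ler_wpM2l ?expR_ge0//; have := sqr_ge0 C; lra.
    have S0 : 0 <= \sum_j `|L j| by exact: sumr_ge0.
    have uS : ln (r t i) <= `|B| + \sum_j `|L j|.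
      have := uB t t0 i; rewrite ler_norml => /andP[_ h1]; have := ler_norm B; lra.
    have LS : L i <= `|B| + \sum_j `|L j|.
      have : `|L i| <= \sum_j `|L j| by rewrite (bigD1 i)//= lerDl sumr_ge0.
      have := ler_norm (L i); have := normr_ge0 B; lra.
    rewrite -(rE t i t0); apply: (le_trans (expR_lipschitz uS LS)).
    by rewrite -mulrA ler_wpM2l ?expR_ge0// mulrC.
  - move=> i; have c : ((fun t => expR (ln (r t i))) @ +oo --> expR (L i))%classic.
      by apply: (@continuous_cvg _ _ _ _ _ _ (@expR R)); [exact: continuous_expR | exact: uL].
    apply: cvg_trans c; apply: near_eq_cvg; exists 0; split => // t /ltW t0.
    by rewrite rE.
  - by move=> i; have := GL i; rewrite /log_field => /eqP; rewrite subr_eq0 => /eqP.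
have bE1 : bdd -> E1 by move=> /bdd_concl[rs [_ _ h _]]; exists rs.
have E2E3 : E2 -> E3.
  move=> /E2eq[p Gp]; apply/E3E => A A0 AT; exact: E3_of_equilibrium HT adm HTh Gp A0 AT.
have E3b : E3 -> bdd by move=> /E3E h; exact: E3_bounded HT adm HTh h tu.
split; first by split=> // /E2b.
split; first by split=> // /E3b/bE1.
move=> H; have /bdd_concl[rs [rs0 rexp _ rsK]] : bdd by case: H => [/E12/E2b|[/E2b|/E3b]].
by exists rs; split => //; [exact: cone_metric | exact: circle_pattern].
Qed.
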